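(* Let $\Gamma=(K,I,J,g,C,D,\pi,q)$ be a zero-sum repeated game (with finite $K,I,J,C,D$ and $\pi\in\Delta_f(K\times\mathbb N\times\mathbb N)$) with a more informed controller, i.e. such that assumptions (A1), (A2a), (A2b) and (A3) stated in the context hold. Then the uniform value exists in $\Gamma_\infty(\pi)$, i.e. $\underline v_\infty(\pi)=\overline v_\infty(\pi)$.
   Context: **Model.** For a metric space $X$, $\Delta(X)$ is the set of Borel probability distributions on $X$ and $\Delta_f(X)\subset\Delta(X)$ those with finite support; $\delta_x$ is the Dirac mass at $x$. $K$ (states), $I,J$ (actions of players 1, 2), $C,D$ (signals of players 1, 2) are finite sets, $g:K\times I\times J\to[0,1]$ is the payoff, $q:K\times I\times J\to\Delta(K\times C\times D)$ the transition, and $\pi\in\Delta_f(K\times\mathbb N\times\mathbb N)$ the initial probability. At the start $(k_1,c_1,d_1)$ is drawn from $\pi$. At stage $m\ge1$ player 1 observes $c_m$, player 2 observes $d_m$; then they choose actions $i_m\in I$, $j_m\in J$ (perfect recall of own past signals and actions); $(k_{m+1},c_{m+1},d_{m+1})$ is drawn from $q(k_m,i_m,j_m)$; the stage payoff of player 1 is $g(k_m,i_m,j_m)$ (not observed). Private histories: $h^I_m=(c_1,i_1,\dots,c_{m-1},i_{m-1},c_m)$ and $h^{II}_m=(d_1,j_1,\dots,d_{m-1},j_{m-1},d_m)$. A behavior strategy of player 1 (set $\Sigma$) is a sequence $\sigma_m:\mathbb N\times(I\times C)^{m-1}\to\Delta(I)$, and of player 2 (set $\mathcal T$) a sequence $\tau_m:\mathbb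 N\times(J\times D)^{m-1}\to\Delta(J)$. $\mathbb P^\pi_{\sigma\tau}$ is the induced probability on plays, $\mathbb E^\pi_{\sigma\tau}$ its expectation, and $\gamma_n(\pi,\sigma,\tau)=\mathbb E^\pi_{\sigma\tau}[\frac1n\sum_{m=1}^n g(k_m,i_m,j_m)]$. **Uniform value.** Player 1 can guarantee $v\in\mathbb R$ in $\Gamma_\infty(\pi)$ if for every $\epsilon>0$ there are $\sigma\in\Sigma$ and $N\in\mathbb N$ with $\gamma_n(\pi,\sigma,\tau)\ge v-\epsilon$ for all $n\ge N$ and $\tau\in\mathcal T$; $\underline v_\infty(\pi)$ is the supremum of such $v$. Player 2 can guarantee $v$ if for every $\epsilon>0$ there are $\tau\in\mathcal T$ and $N$ with $\gamma_n(\pi,\sigma,\tau)\le v+\epsilon$ for all $n\ge N$ and $\sigma\in\Sigma$; $\overline v_\infty(\pi)$ is the infimum of such $v$. The uniform value exists if $\underline v_\infty(\pi)=\overline v_\infty(\pi)$. **Beliefs.** $\mathcal L_{\mathbb P}(\xi\mid\mathcal F)$ is the conditional law of $\xi$ given $\mathcal F$ (an $\mathcal F$-measurable random variable), $\mathcal L_{\mathbb P}(\xi)$ the law of $\xi$. Given $\pi,\sigma,\tau$: $x_n=\mathcal L_{\mathbb P^\pi_{\sigma\tau}}(k_n\mid h^I_n)\in\Delta(K)$, $y_n=\mathcal L_{\mathbb P^\pi_{\sigma\tau}}(x_n\mid h^{II}_n)\in\Delta_f(\Delta(K))$, $\eta_n=\mathcal L_{\mathbb P^\pi_{\sigma\tau}}(y_n)\in\Delta_f(\Delta_f(\Delta(K)))$.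 In particular $x_1,y_1,\eta_1$ depend only on $\pi$. **Assumptions.** - (A1): for all $n\ge1$ and $(\sigma,\tau)\in\Sigma\times\mathcal T$, $\mathcal L_{\mathbb P^\pi_{\sigma\tau}}(k_n\mid h^I_n,h^{II}_n)=\mathcal L_{\mathbb P^\pi_{\sigma\tau}}(k_n\mid h^I_n)$. - (A1a), a property of an initial probability $\pi'$: $\pi'(c)\pi'(k,c,d)=\pi'(k,c)\pi'(c,d)$ for all $(k,c,d)$ (marginals denoted by omitting variables). It is (A1) for $n=1$. - (A2a), a property of an initial probability $\pi'$: there is a map $f_1$ from initial signals of player 1 to $\Delta(\Delta(K))$ with $y_1=f_1(c_1)$ $\pi'$-almost surely. In the theorem, (A2a) is assumed for $\pi$. - If $\pi'$ satisfies (A2a), a strategy $\sigma\in\Sigma$ is reduced if it depends on the initial signal $c_1$ only through $(x_1,y_1)$; $\Sigma'(\pi')$ is the set of reduced strategies. - (A2b): for all $\pi'\in\Delta_f(K\times\mathbb N\times\mathbb N)$ satisfying (A2a), all $\sigma\in\Sigma'(\pi')$ and all $\tau\in\mathcal T$, there is $f_2=f_2^{\pi',\sigma,\tau}:\mathbb N\times I\times C\to\Delta(\Delta(K))$ with $y_2=f_2(c_1,i_1,c_2)$ $\mathbb P^{\pi'}_{\sigma\tau}$-almost surely. - $\Delta^*_f(K\times\mathbb N\times\mathbb N)$ is the set of $\pi'\in\Delta_f(K\times\mathbb N\times\mathbb N)$ satisfying (A1a) and (A2a). - (A3): for all $\pi'\in\Delta^*_f(K\times\mathbb N\times\mathbb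 N)$ and all $\sigma\in\Sigma'(\pi')$, $\eta_2$ (computed under $\mathbb P^{\pi'}_{\sigma\tau}$) is independent of $\tau\in\mathcal T$. *)

(* Defs.v *)
From HB Require Import structures.
From mathcomp Require Import all_boot all_order all_algebra finmap.
From mathcomp Require Import classical_sets reals constructive_ereal ereal.

Set Implicit Arguments.
Unset Strict Implicit.
Unset Printing Implicit Defensive.

Import Order.TTheory GRing.Theory Num.Theory.
Local Open Scope fset_scope.
Local Open Scope ring_scope.

(** * Finitely supported probability distributions *)

Section Fdist.
Variable R : realType.

(* [fdist R T] is the set of probability distributions with finite support on
   [T]. It is again a choiceType, so it can be iterated; when [K] is finite,
   [fdist R K] is the whole simplex over [K]. *)
Record fdist (T : choiceType) := Fdist {
  fdist_val :> {fsfun T -> R with 0};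
  _ : all (fun x => 0 <= fdist_val x) (finsupp fdist_val)
      && (\sum_(x <- finsupp fdist_val) fdist_val x == 1) }.

HB.instance Definition _ (T : choiceType) := [isSub for @fdist_val T].
HB.instance Definition _ (T : choiceType) := [Choice of fdist T by <:].

Lemma fdist_ge0 (T : choiceType) (P : fdist T) x : 0 <= P x.
Proof.
case: P => f /= /andP[/allP f0 _].
by case: finsuppP => // xf; exact: f0.
Qed.

Lemma fdist_sum1 (T : choiceType) (P : fdist T) :
  \sum_(x <- finsupp P) P x = 1.
Proof. by case: P => f /= /andP[_ /eqP]. Qed.

Section Make.
Variables (T : choiceType) (S : {fset T}) (f : T -> R).
Hypotheses (f0 : forall x, x \in S -> 0 <= f x) (f1 : \sum_(x <- S) f x = 1).

Let h : {fsfun T -> R with 0} := [fsfun x in S => f x | 0].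

Fact mk_fdist_subproof :
  all (fun x => 0 <= h x) (finsupp h) && (\sum_(x <- finsupp h) h x == 1).
Proof.
have hE x : h x = if x \in S then f x else 0 by rewrite /h fsfunE.
apply/andP; split.
  by apply/allP => x _; rewrite hE; case: ifP => // /f0.
apply/eqP; rewrite -f1.
have <- : \sum_(x <- S) h x = \sum_(x <- S) f x.
  by apply: eq_big_seq => x xS; rewrite hE xS.
apply: big_fset_incl => [|x xS]; last by move/fsfun_dflt.
apply/fsubsetP => x; rewrite mem_finsupp hE.
by case: ifP => // _; rewrite eqxx.
Qed.

Definition mk_fdist : fdist T := Fdist mk_fdist_subproof.
End Make.

Section Dirac.
Variables (T : choiceType) (a : T).

Fact dret_ge0 x : x \in [fset a] -> 0 <= (fun=> 1 : R) x.
Proof. by move=> _; exact: ler01. Qed.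

Fact dret_sum1 : \sum_(x <- [fset a]) (fun=> 1 : R) x = 1.
Proof. by rewrite big_seq_fset1. Qed.

Definition dret : fdist T := mk_fdist dret_ge0 dret_sum1.
End Dirac.

Section Bind.
Variables (T U : choiceType) (P : fdist T) (f : T -> fdist U).

Let S : {fset U} := \bigcup_(t <- finsupp P) finsupp (f t).
Let h (u : U) : R := \sum_(t <- finsupp P) P t * f t u.

Fact dbind_ge0 u : u \in S -> 0 <= h u.
Proof. by move=> _; apply: sumr_ge0 => t _; apply: mulr_ge0; exact: fdist_ge0. Qed.

Fact dbind_sum1 : \sum_(u <- S) h u = 1.
Proof.
rewrite exchange_big /= -(fdist_sum1 P); apply: eq_big_seq => t tP.
rewrite -big_distrr /= -[RHS]mulr1; congr (_ * _).
rewrite -(fdist_sum1 (f t)); apply/esym/big_fset_incl.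
  by apply/fsubsetP => u uf; apply/bigfcupP; exists t; rewrite ?tP.
by move=> u _ /fsfun_dflt.
Qed.

Definition dbind : fdist U := mk_fdist dbind_ge0 dbind_sum1.
End Bind.

(* The law of [X] under [P]. *)
Definition dmap (T U : choiceType) (X : T -> U) (P : fdist T) : fdist U :=
  dbind P (fun t => dret (X t)).

Definition expect (T : choiceType) (P : fdist T) (X : T -> R) : R :=
  \sum_(t <- finsupp P) P t * X t.

Definition almost_surely (T : choiceType) (P : fdist T) (Q : T -> Prop) : Prop :=
  forall t, t \in finsupp P -> Q t.

Section Conditioning.
Variables (T : choiceType) (P : fdist T) (A : pred T).

Definition dprob : R := \sum_(t <- finsupp P | A t) P t.

Let h (t : T) : R :=
  if dprob == 0 then P t else if A t then P t / dprob else 0.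

Fact dcond_ge0 t : t \in finsupp P -> 0 <= h t.
Proof.
move=> _; rewrite /h; case: ifP => _; first exact: fdist_ge0.
case: ifP => // _.
by rewrite divr_ge0 ?fdist_ge0 // sumr_ge0 // => x _; exact: fdist_ge0.
Qed.

Fact dcond_sum1 : \sum_(t <- finsupp P) h t = 1.
Proof.
rewrite /h; case: eqVneq => [_|P0]; first exact: fdist_sum1.
by rewrite -big_mkcond -big_distrl /= divff.
Qed.

(* [P] conditioned on the event [A]; when [A] is [P]-null the value is
   conventional. *)
Definition dcond : fdist T := mk_fdist dcond_ge0 dcond_sum1.
End Conditioning.

(* The conditional law of [X] given (the sigma-algebra generated by) [Y], as a
   [Y]-measurable random variable; it is conventional on [P]-null values of
   [Y]. *)
Definition cond_law (T U : choiceType) (V : eqType)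
    (P : fdist T) (X : T -> U) (Y : T -> V) (w : T) : fdist U :=
  dmap X (dcond P (fun w' => Y w' == Y w)).

End Fdist.

(** * The repeated game *)

Section Game.
Variables (R : realType) (K I J C D : finType).

(* An initial draw (k_1, c_1, d_1). *)
Definition start : choiceType := (K * nat * nat)%type.

(* [((k_1, c_1, d_1), s)] where the [m]-th item of [s] is
   [((i_m, j_m), (k_(m+1), c_(m+1), d_(m+1)))]. A play with [size s = n]
   describes the game up to the signals of stage [n + 1]. *)
Definition play : choiceType := (start * seq ((I * J) * (K * C * D)))%type.

Implicit Types w : play.

Definition states w : seq K := w.1.1.1 :: [seq s.2.1.1 | s <- w.2].
Definition last_state w : K := last w.1.1.1 (states w).
Definition signal1 w : nat := w.1.1.2.
Definition signal2 w : nat := w.1.2.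

(* Private histories (c_1, [(i_1, c_2); ...]) and (d_1, [(j_1, d_2); ...]). *)
Definition hist1 w : nat * seq (I * C) :=
  (signal1 w, [seq (s.1.1, s.2.1.2) | s <- w.2]).
Definition hist2 w : nat * seq (J * D) :=
  (signal2 w, [seq (s.1.2, s.2.2) | s <- w.2]).

(* The length of the list is the number of past stages, so that such a function
   is a sequence of maps from nat * (I * C)^(m-1), m >= 1. *)
Definition strategy1 := nat * seq (I * C) -> fdist R I.
Definition strategy2 := nat * seq (J * D) -> fdist R J.

Variable q : K -> I -> J -> fdist R (K * C * D)%type.

Definition init_law (p : fdist R start) : fdist R play :=
  dmap (fun x : start => (x, [::]) : play) p.

Definition next_law (sigma : strategy1) (tau : strategy2) w : fdist R play :=
  dbind (sigma (hist1 w)) (fun i =>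
  dbind (tau (hist2 w)) (fun j =>
  dmap (fun x => (w.1, rcons w.2 ((i, j), x)) : play) (q (last_state w) i j))).

(* The law, induced by the initial probability and the strategies, of the play
   up to the signals of stage [n + 1]. *)
Fixpoint play_law (p : fdist R start) (sigma : strategy1) (tau : strategy2)
    (n : nat) : fdist R play :=
  if n is n'.+1 then dbind (play_law p sigma tau n') (next_law sigma tau)
  else init_law p.

(** * Payoffs and the uniform value *)

Variable g : K -> I -> J -> R.

(* [zip] drops the final state, at which no action has been taken yet. *)
Definition total_payoff w : R :=
  \sum_(x <- zip (states w) w.2) g x.1 x.2.1.1 x.2.1.2.

(* [gamma 0] is 0 by convention; this is immaterial below, where N can be
   enlarged. *)
Definition gamma (n : nat) (p : fdist R start) (sigma : strategy1)
    (tau : strategy2) : R :=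
  expect (play_law p sigma tau n) (fun w => n%:R^-1 * total_payoff w).

Definition guarantees1 (p : fdist R start) (v : R) : Prop :=
  forall eps : R, 0 < eps -> exists (sigma : strategy1) (N : nat),
    forall n, (N <= n)%N -> forall tau : strategy2,
      v - eps <= gamma n p sigma tau.

Definition guarantees2 (p : fdist R start) (v : R) : Prop :=
  forall eps : R, 0 < eps -> exists (tau : strategy2) (N : nat),
    forall n, (N <= n)%N -> forall sigma : strategy1,
      gamma n p sigma tau <= v + eps.

Definition lower_uniform_value (p : fdist R start) : \bar R :=
  ereal_sup [set v%:E | v in guarantees1 p]%classic.

Definition upper_uniform_value (p : fdist R start) : \bar R :=
  ereal_inf [set v%:E | v in guarantees2 p]%classic.

(** * Beliefs *)

(* With [P := play_law p sigma tau n], the following are x_(n+1), y_(n+1) and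
   eta_(n+1); with [P := init_law p] they are x_1, y_1 and eta_1. *)
Definition belief1 (P : fdist R play) : play -> fdist R K :=
  cond_law P last_state hist1.

Definition belief2 (P : fdist R play) : play -> fdist R (fdist R K) :=
  cond_law P (belief1 P) hist2.

Definition belief_law (P : fdist R play) : fdist R (fdist R (fdist R K)) :=
  dmap (belief2 P) P.

(** * Assumptions *)

Definition assumption_A1 (p : fdist R start) : Prop :=
  forall (n : nat) (sigma : strategy1) (tau : strategy2),
    let P := play_law p sigma tau n in
    almost_surely P (fun w =>
      cond_law P last_state (fun w' => (hist1 w', hist2 w')) w
      = cond_law P last_state hist1 w).

Definition property_A1a (p : fdist R start) : Prop :=
  forall (k : K) (c d : nat),
    dmap (fun x : start => x.1.2) p c * p (k, c, d)
    = dmap (fun x : start => x.1) p (k, c)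
      * dmap (fun x : start => (x.1.2, x.2)) p (c, d).

(* Since y_1 takes values in finitely supported distributions, so does f_1
   wherever it is constrained; the same holds for f_2 in (A2b). *)
Definition property_A2a (p : fdist R start) : Prop :=
  exists f1 : nat -> fdist R (fdist R K),
    almost_surely (init_law p) (fun w =>
      belief2 (init_law p) w = f1 (signal1 w)).

(* The values of [sigma] at initial signals of probability zero are
   unconstrained, since (x_1, y_1) is only defined almost surely. *)
Definition reduced (p : fdist R start) (sigma : strategy1) : Prop :=
  exists phi : fdist R K -> fdist R (fdist R K) -> seq (I * C) -> fdist R I,
    almost_surely (init_law p) (fun w =>
      forall h : seq (I * C), sigma (signal1 w, h)
        = phi (belief1 (init_law p) w) (belief2 (init_law p) w) h).

Definition assumption_A2b : Prop :=
  forall (p : fdist R start) (sigma : strategy1) (tau : strategy2),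
    property_A2a p -> reduced p sigma ->
    let P := play_law p sigma tau 1 in
    exists f2 : nat -> I -> C -> fdist R (fdist R K),
      almost_surely P (fun w =>
        forall (c1 : nat) (i1 : I) (c2 : C),
          hist1 w = (c1, [:: (i1, c2)]) -> belief2 P w = f2 c1 i1 c2).

Definition assumption_A3 : Prop :=
  forall (p : fdist R start) (sigma : strategy1),
    property_A1a p -> property_A2a p -> reduced p sigma ->
    forall tau tau' : strategy2,
      belief_law (play_law p sigma tau 1) = belief_law (play_law p sigma tau' 1).

End Game.

(* Main.v *)
Require Import Defs.
From mathcomp Require Import all_boot all_order all_algebra finmap.
From mathcomp Require Import classical_sets reals constructive_ereal ereal.
From mathcomp Require Import boolp filter topology normedtype.
From mathcomp Require Import ring lra zify.

(** Player 2's second order belief [y] is an MDP controlled by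
    player 1: by (A2b) player 1 can compute the next [y], by (A3) its law does not
    depend on player 2's action, so that action may be fixed to [j0] in the
    transitions while stage payoffs are those against a best reply. Let [value n w]
    be the value of that MDP with stage weights [w], and let [limit_value] be the
    infimum over [n] of the supremum over [m] of its value with uniform weights on
    the stages [m+1, ..., m+n].

    Player 2 guarantees [limit_value] by blocks of [n] stages: against a known
    strategy of player 1, replying to the true belief keeps the payoff of a block
    below its value; the minmax theorem then gives a single reply, which extends
    whatever was played in the previous blocks.

    For player 1, averaging the translates of slowly varying weights [w] over a long
    block shows that [limit_value] is at most the supremum over [m] of the value of
    [w] delayed by [m] stages. The functions [value n w] are 1-Lipschitz for the L1
    distance between joint laws of signals and states, hence form a totally bounded
    family, and so a delay bounded independently of [w] nearly suffices; for slow
    nonincreasing [w] it costs nothing. Hence every mixture of long Cesaro means has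
    value at least [limit_value - e]. The minmax theorem turns this into a strategy
    that is good for all horizons in a long window, and a limit of such strategies
    along an ultrafilter is good for all large horizons. *)

Set Implicit Arguments.
Unset Strict Implicit.
Unset Printing Implicit Defensive.

Import Order.TTheory GRing.Theory Num.Theory numFieldNormedType.Exports.
Local Open Scope fset_scope.
Local Open Scope ring_scope.

(** * Finitely supported distributions *)

(** (A2b) and (A3) speak of the first transition only, but for every initial probability. To use
    them at a later stage, the current belief [y] of player 2 is turned into an initial probability:
    player 1 is told a code of a posterior drawn from [y], player 2 a constant. Then (A1a) and (A2a)
    hold by construction. For the first transition from there to be the transition from [y], the
    posterior of player 1 must not react to what only player 2 sees; (A1) gives this for the
    histories that are possible from [p], and [stable_family] carries it from stage to stage.
    Beliefs are kept as unnormalised families over an arbitrary finite type of private information: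
    transitions are then linear, and two encodings of one belief are compared through integrals of
    functions of the posterior. The guarantee of player 1 comes as a sequence [rho] of secured stage
    payoffs, valid for all weights at once; so the choice of a horizon becomes a finite set of moves
    for the opponent. *)

Section FdistTheory.
Variable R : realType.
Implicit Types T U V : choiceType.

Lemma eq_ler (x x' : R) : x = x' -> x <= x'.
Proof. by move->. Qed.

Lemma mk_fdistE T (S : {fset T}) (f : T -> R) f0 f1 x :
  @mk_fdist R T S f f0 f1 x = if x \in S then f x else 0.
Proof. by rewrite /mk_fdist /= fsfunE. Qed.

Lemma fdistP T (P Q : fdist R T) : P =1 Q -> P = Q.
Proof. by move=> PQ; apply/val_inj/fsfunP. Qed.

Lemma dretE T (a x : T) : dret R a x = (x == a)%:R.
Proof. by rewrite mk_fdistE inE; case: eqP. Qed.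

Lemma expect_sub T (P : fdist R T) (S : {fset T}) X :
  finsupp P `<=` S -> expect P X = \sum_(t <- S) P t * X t.
Proof.
by move=> PS; apply: big_fset_incl => // t _ /fsfun_dflt ->; rewrite mul0r.
Qed.

Lemma expectT (T : finType) (P : fdist R T) X : expect P X = \sum_t P t * X t.
Proof.
rewrite /expect big_uniq ?fset_uniq //= big_mkcond /=; apply: eq_bigr => t _.
by case: ifPn => // /fsfun_dflt ->; rewrite mul0r.
Qed.

Lemma fdist_sumT (T : finType) (P : fdist R T) : \sum_t P t = 1.
Proof.
rewrite -(fdist_sum1 P) [RHS]big_uniq ?fset_uniq //= [RHS]big_mkcond /=.
by apply: eq_bigr => t _; case: ifPn => // /fsfun_dflt.
Qed.

Lemma fdist_le1 T (P : fdist R T) x : P x <= 1.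
Proof.
have [xP|/fsfun_dflt ->] := boolP (x \in finsupp P); last exact: ler01.
rewrite -(fdist_sum1 P) (big_fsetD1 x) //= lerDl sumr_ge0 // => y _.
exact: fdist_ge0.
Qed.

Lemma finsupp_gt0 T (P : fdist R T) x : (x \in finsupp P) = (0 < P x).
Proof. by rewrite mem_finsupp lt0r fdist_ge0 andbT. Qed.

Lemma dbindE T U (P : fdist R T) (f : T -> fdist R U) u :
  dbind P f u = expect P (fun t => f t u).
Proof.
rewrite mk_fdistE; case: ifPn => // uS; rewrite /expect big_seq big1 // => t tP.
rewrite [f t u]fsfun_dflt ?mulr0 //; apply: contra uS => uf.
by apply/bigfcupP; exists t; rewrite ?tP.
Qed.

Lemma expect_dret T (a : T) X : expect (dret R a) X = X a.
Proof.
rewrite (@expect_sub _ _ [fset a]); first by rewrite big_seq_fset1 dretE eqxx mul1r.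
by apply/fsubsetP => x; rewrite mem_finsupp dretE inE; case: (x == a) => //=; rewrite eqxx.
Qed.

Lemma finsupp_dbind T U (P : fdist R T) (f : T -> fdist R U) t u :
  t \in finsupp P -> u \in finsupp (f t) -> u \in finsupp (dbind P f).
Proof.
rewrite !finsupp_gt0 dbindE /expect => tP uf.
rewrite (big_fsetD1 t) ?finsupp_gt0 //= ltr_pwDl ?mulr_gt0 //.
by apply: sumr_ge0 => x _; rewrite mulr_ge0 // fdist_ge0.
Qed.

Lemma expect_dbind T U (P : fdist R T) (f : T -> fdist R U) X :
  expect (dbind P f) X = expect P (fun t => expect (f t) X).
Proof.
rewrite {1}/expect.
under eq_bigr do rewrite dbindE /expect big_distrl /=.
rewrite exchange_big /=; rewrite /expect; apply: eq_big_seq => t tP.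
rewrite [X in _ = _ * X](@expect_sub _ _ (finsupp (dbind P f))).
  by rewrite big_distrr /=; apply: eq_bigr => u _; rewrite mulrA.
by apply/fsubsetP => u; apply: finsupp_dbind.
Qed.

Lemma expect_dmap T U (P : fdist R T) (f : T -> U) X :
  expect (dmap f P) X = expect P (X \o f).
Proof.
by rewrite expect_dbind /expect; apply: eq_bigr => t _; rewrite -/(expect _ _) expect_dret.
Qed.

Lemma eq_expect T (P : fdist R T) X Y :
  {in finsupp P, X =1 Y} -> expect P X = expect P Y.
Proof. by move=> XY; apply: eq_big_seq => t /XY ->. Qed.

Lemma expectZ T (P : fdist R T) c X : expect P (fun t => c * X t) = c * expect P X.
Proof. by rewrite /expect big_distrr /=; apply: eq_bigr => t _; rewrite mulrCA. Qed.

Lemma expect_sum T (I : Type) (r : seq I) (P : fdist R T) (X : I -> T -> R) :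
  expect P (fun t => \sum_(i <- r) X i t) = \sum_(i <- r) expect P (X i).
Proof. by rewrite exchange_big /expect; apply: eq_bigr => t _; rewrite big_distrr. Qed.

Lemma expect_cst T (P : fdist R T) c : expect P (fun=> c) = c.
Proof. by rewrite /expect -big_distrl /= fdist_sum1 mul1r. Qed.

Lemma expect_eq0P T (P : fdist R T) (x : T) : expect P (fun t => (t == x)%:R) = P x.
Proof.
rewrite /expect; under eq_bigr do rewrite mulr_natr mulrb.
rewrite -big_mkcond /= big_mkcond /=.
have [xP|xP] := boolP (x \in finsupp P).
  rewrite (big_fsetD1 x) //= eqxx big1_fset ?addr0 // => t.
  by rewrite in_fsetD1 => /andP[/negPf ->].
rewrite [RHS]fsfun_dflt // big_seq big1 // => t tP.
by case: eqP => // tx; rewrite -tx tP in xP.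
Qed.

Lemma expect_mulr T (P : fdist R T) c X : expect P (fun t => X t * c) = expect P X * c.
Proof. by rewrite mulrC -expectZ; apply: eq_expect => t _; rewrite mulrC. Qed.

Lemma finsupp_dbindP T U (P : fdist R T) (f : T -> fdist R U) u :
  u \in finsupp (dbind P f) -> exists2 t, t \in finsupp P & u \in finsupp (f t).
Proof.
move=> uPf; apply: contrapT => H; move: uPf; apply/negP.
rewrite mem_finsupp negbK dbindE /expect big_seq big1 // => t tP.
rewrite [f t u]fsfun_dflt ?mulr0 //; apply/negP => uf; apply: H; exists t => //.
Qed.

Lemma finsupp_dret T (a : T) : finsupp (dret R a) = [fset a].
Proof. by apply/fsetP => x; rewrite finsupp_gt0 dretE inE; case: eqP; rewrite ?ltr01 ?ltxx. Qed.

Lemma finsupp_dmap T U (P : fdist R T) (f : T -> U) u :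
  reflect (exists2 t, t \in finsupp P & u = f t) (u \in finsupp (dmap f P)).
Proof.
apply: (iffP idP) => [/finsupp_dbindP[t tP]|[t tP ->]].
  by rewrite finsupp_dret inE => /eqP ->; exists t.
by apply: finsupp_dbind tP _; rewrite finsupp_dret inE.
Qed.

(* A family that is not a probability on [S] is sent to the junk value [dflt]. *)
Definition to_fdist T (S : {fset T}) (f : T -> R) (dflt : fdist R T) : fdist R T :=
  match pselect ((forall x, x \in S -> 0 <= f x) /\ \sum_(x <- S) f x = 1) with
  | left H => mk_fdist H.1 H.2
  | right _ => dflt
  end.

Lemma to_fdistE T (S : {fset T}) (f : T -> R) dflt x :
  (forall x, x \in S -> 0 <= f x) -> \sum_(x <- S) f x = 1 ->
  to_fdist S f dflt x = if x \in S then f x else 0.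
Proof.
by move=> f0 f1; rewrite /to_fdist; case: pselect => [H|[]//]; rewrite mk_fdistE.
Qed.

Definition to_fdistT (T : finType) (f : T -> R) (dflt : fdist R T) : fdist R T :=
  to_fdist [fset x in T] f dflt.

Lemma to_fdistTE (T : finType) (f : T -> R) dflt x :
  (forall x, 0 <= f x) -> \sum_x f x = 1 -> to_fdistT f dflt x = f x.
Proof.
move=> f0 f1; rewrite to_fdistE ?inE // -f1 big_uniq ?fset_uniq //=.
by apply: eq_bigl => y; rewrite inE.
Qed.

(** Full support makes every action possible, so that conditional laws computed under it see all
    histories. *)
Definition uniform_fdist (T : finType) (t0 : T) : fdist R T :=
  to_fdistT (fun=> #|T|%:R^-1) (dret R t0).

Lemma uniform_fdist_gt0 (T : finType) (t0 t : T) : 0 < uniform_fdist t0 t.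
Proof.
have T0 : 0 < #|T|%:R :> R by rewrite ltr0n; apply/card_gt0P; exists t0.
rewrite to_fdistTE ?invr_gt0 //.
by rewrite sumr_const -[_ *+ _]mulr_natr mulVf ?gt_eqF.
Qed.

Lemma dcondE T (P : fdist R T) (A : pred T) t : dcond P A t =
  if t \in finsupp P
  then if dprob P A == 0 then P t else if A t then P t / dprob P A else 0
  else 0.
Proof. exact: mk_fdistE. Qed.

Lemma cond_prob_gt0 T (V : eqType) (P : fdist R T) (Y : T -> V) w :
  w \in finsupp P -> 0 < expect P (fun t => (Y t == Y w)%:R).
Proof.
move=> wP; rewrite /expect (big_fsetD1 w) //= eqxx mulr1 ltr_pwDl -?finsupp_gt0 //.
by apply: sumr_ge0 => t _; rewrite mulr_ge0 ?fdist_ge0 ?ler0n.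
Qed.

Lemma cond_lawP T U (V : eqType) (P : fdist R T) (X : T -> U) (Y : T -> V) w u :
  w \in finsupp P ->
  expect P (fun t => ((X t == u) && (Y t == Y w))%:R) =
  cond_law P X Y w u * expect P (fun t => (Y t == Y w)%:R).
Proof.
move=> wP; set A := fun w' => Y w' == Y w.
have pE : dprob P A = expect P (fun t => (Y t == Y w)%:R).
  by rewrite /dprob big_mkcond; apply: eq_bigr => t _; rewrite /A; case: eqP;
    rewrite ?mulr1 ?mulr0.
have p0 : dprob P A != 0.
  by rewrite pE gt_eqF // cond_prob_gt0.
rewrite /cond_law /dmap dbindE -pE (@expect_sub _ (dcond P A) (finsupp P)); last first.
  apply/fsubsetP => x; rewrite mem_finsupp dcondE.
  by case: ifP => // _; rewrite eqxx.
rewrite -/A big_distrl /= /expect; apply: eq_big_seq => t tP.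
rewrite dretE dcondE tP (negPf p0) -/(A t) [u == _]eq_sym.
case: (X t == u); case: (A t) => /=; rewrite ?mulr0 ?mul0r ?mulr1 //.
by rewrite divfK.
Qed.

(** The observed value has positive probability on the support, so one may divide by it. The
    posteriors below are identified through this criterion. *)
Lemma cond_law_unique T U (V : eqType) (P : fdist R T) (X : T -> U) (Y : T -> V) w
    (z : fdist R U) : w \in finsupp P ->
  (forall u, expect P (fun t => ((X t == u) && (Y t == Y w))%:R) =
     z u * expect P (fun t => (Y t == Y w)%:R)) ->
  cond_law P X Y w = z.
Proof.
move=> wP zE; apply/fdistP => u; apply: (mulIf (lt0r_neq0 (cond_prob_gt0 Y wP))).
by rewrite -zE -cond_lawP.
Qed.

Lemma eq_cond_law T U (V : eqType) (P : fdist R T) (X : T -> U) (Y : T -> V) w w' :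
  Y w = Y w' -> cond_law P X Y w = cond_law P X Y w'.
Proof. by rewrite /cond_law => ->. Qed.

End FdistTheory.

(** * Unnormalised second order beliefs *)

Lemma sum_pair (R : nmodType) (A B : finType) (F : A * B -> R) :
  \sum_t F t = \sum_a \sum_b F (a, b).
Proof. by rewrite pair_bigA; apply: eq_bigr; case. Qed.

Section Families.
Variables (R : realType) (K I J C D : finType).
Variables (q : K -> I -> J -> fdist R (K * C * D)%type) (g : K -> I -> J -> R).
Variables (k0 : K) (i0 : I).
Implicit Types (A B : finType).

Definition mass (x : K -> R) : R := \sum_k x k.

(** Bayes update without the division: for a probability [x], the mass of the result is the
    likelihood of the signals [c], [d]. *)
Definition step i j c d (x : K -> R) : K -> R := fun k' => \sum_k x k * q k i j (k', c, d).

Definition norm (x : K -> R) : fdist R K := to_fdistT (fun k => x k / mass x) (dret R k0).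

Lemma mass_ge0 (x : K -> R) : (forall k, 0 <= x k) -> 0 <= mass x.
Proof. by move=> x0; apply: sumr_ge0. Qed.

Lemma mass_fdist (x : fdist R K) : mass x = 1.
Proof. exact: fdist_sumT. Qed.

Lemma mass_scale l (x : K -> R) : mass (fun k => l * x k) = l * mass x.
Proof. by rewrite /mass big_distrr. Qed.

Lemma mass_eq0 (x : K -> R) : (forall k, 0 <= x k) -> mass x = 0 -> forall k, x k = 0.
Proof.
by move=> x0 /eqP; rewrite psumr_eq0 // => /allP h k; apply/eqP/(implyP (h k _));
  rewrite ?mem_index_enum.
Qed.

Lemma step_ge0 i j c d (x : K -> R) : (forall k, 0 <= x k) -> forall k, 0 <= step i j c d x k.
Proof. by move=> x0 k; apply: sumr_ge0 => k' _; rewrite mulr_ge0 ?fdist_ge0. Qed.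

Lemma step_scale i j c d l (x x' : K -> R) : (forall k, x k = l * x' k) ->
  forall k, step i j c d x k = l * step i j c d x' k.
Proof.
by move=> xx' k; rewrite big_distrr; apply: eq_bigr => k' _ /=; rewrite xx' mulrA.
Qed.

Lemma sum_mass_step i j (x : K -> R) : \sum_c \sum_d mass (step i j c d x) = mass x.
Proof.
transitivity (\sum_(t : K * C * D) \sum_k x k * q k i j t).
  rewrite !sum_pair [RHS]exchange_big /=; apply: eq_bigr => c _.
  by rewrite [RHS]exchange_big.
rewrite exchange_big; apply: eq_bigr => k _ /=.
by rewrite -big_distrr /= fdist_sumT mulr1.
Qed.

Lemma normE (x : K -> R) k : (forall k, 0 <= x k) -> 0 < mass x -> norm x k = x k / mass x.
Proof.
move=> x0 m0; rewrite to_fdistTE // => [k'|]; first by rewrite divr_ge0 ?mass_ge0.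
by rewrite -big_distrl /= divff ?gt_eqF.
Qed.

Lemma mass_norm (x : K -> R) k : (forall k, 0 <= x k) -> x k = mass x * norm x k.
Proof.
move=> x0; have [m0|] := ltP 0 (mass x); first by rewrite normE // mulrC divfK ?gt_eqF.
rewrite le_eqVlt ltNge mass_ge0 // orbF => /eqP m0.
by rewrite (mass_eq0 x0 m0) m0 mul0r.
Qed.

Lemma norm_scale l (x x' : K -> R) : (forall k, 0 <= x' k) -> 0 < l ->
  (forall k, x k = l * x' k) -> norm x = norm x'.
Proof.
move=> x0 l0 xx'; have -> : x = fun k => l * x' k by apply/funext.
congr to_fdistT; apply/funext => k; rewrite mass_scale invfM mulrACA divff ?mul1r //.
by rewrite gt_eqF.
Qed.

Lemma norm_fdist (x : fdist R K) : norm x = x.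
Proof.
by apply/fdistP => k; rewrite normE ?mass_fdist ?divr1 // => k'; exact: fdist_ge0.
Qed.

Lemma step_norm i j c d (x : K -> R) k : (forall k, 0 <= x k) ->
  step i j c d x k = mass x * step i j c d (norm x) k.
Proof. by move=> x0; apply: step_scale => k'; exact: mass_norm. Qed.

(* A family [s : A -> K -> R] is an unnormalised belief of player 2: [s al k] is
   the probability that player 1's private information is [al] and that the state
   is [k], on the event that player 2 observed a given history. *)
Definition nonneg A (s : A -> K -> R) := forall al k, 0 <= s al k.

Definition total_mass A (s : A -> K -> R) : R := \sum_al mass (s al).

(** Player 1 recalls his action and signal, hence the index [A * I * C]; [j] and [d] are fixed, as
    player 2 sees them. The probability with which player 2 chose [j] is left out, so the family
    does not depend on his mixed action. *)
Definition next_family j A (s : A -> K -> R) (a : A -> fdist R I) (d : D)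
    (t : A * I * C) : K -> R :=
  fun k => a t.1.1 t.1.2 * step t.1.2 j t.2 d (s t.1.1) k.

Definition stage_pay j A (s : A -> K -> R) (a : A -> fdist R I) : R :=
  \sum_al \sum_i \sum_k a al i * s al k * g k i j.

(** The integral of [h] against the unnormalised law of player 1's posterior. *)
Definition pairing A (s : A -> K -> R) (h : fdist R K -> R) : R :=
  \sum_al mass (s al) * h (norm (s al)).

Definition belief_action A (s : A -> K -> R) (a : fdist R K -> fdist R I) : A -> fdist R I :=
  fun al => a (norm (s al)).

Definition equivalent l A B (s : A -> K -> R) (s' : B -> K -> R) :=
  forall h, pairing s h = l * pairing s' h.

Lemma next_family_ge0 j A (s : A -> K -> R) a d : nonneg s -> nonneg (next_family j s a d).
Proof.
by move=> s0 t k; rewrite mulr_ge0 ?fdist_ge0 //; apply: step_ge0 => k'; exact: s0.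
Qed.

Lemma total_mass_ge0 A (s : A -> K -> R) : nonneg s -> 0 <= total_mass s.
Proof. by move=> s0; apply: sumr_ge0 => al _; exact: mass_ge0. Qed.

Lemma mass_next j A (s : A -> K -> R) a d t :
  mass (next_family j s a d t) = a t.1.1 t.1.2 * mass (step t.1.2 j t.2 d (s t.1.1)).
Proof. exact: mass_scale. Qed.

Lemma sum_total_mass_next j A (s : A -> K -> R) a : \sum_d total_mass (next_family j s a d) =
  total_mass s.
Proof.
rewrite /total_mass exchange_big /=.
rewrite !sum_pair; apply: eq_bigr => al _; rewrite -[RHS]mul1r -(fdist_sumT (a al)) big_distrl /=.
apply: eq_bigr => i _; rewrite -(sum_mass_step i j (s al)) big_distrr /=.
apply: eq_bigr => c _; rewrite big_distrr; apply: eq_bigr => d _ /=.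
by rewrite mass_next.
Qed.

(** Integrals on the event that player 1 plays [i]. Stage payoffs and next beliefs are linear in
    them, so action rules with the same [typed_pairing] are interchangeable. *)
Definition typed_pairing A (s : A -> K -> R) (a : A -> fdist R I) i (h : fdist R K -> R) : R :=
  \sum_al mass (s al) * a al i * h (norm (s al)).

Lemma stage_pay_typed_pairing j A (s : A -> K -> R) a : nonneg s ->
  stage_pay j s a = \sum_i typed_pairing s a i (fun x => \sum_k x k * g k i j).
Proof.
move=> s0; rewrite /stage_pay exchange_big; apply: eq_bigr => i _; apply: eq_bigr => al _ /=.
rewrite big_distrr; apply: eq_bigr => k _ /=.
by rewrite {1}(mass_norm k (s0 al)); ring.
Qed.

Lemma pairing_next j A (s : A -> K -> R) a d h : nonneg s ->
  pairing (next_family j s a d) h = \sum_i typed_pairing s a i (fun x => \sum_c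
    mass (step i j c d x) * h (norm (step i j c d x))).
Proof.
move=> s0; rewrite /pairing !sum_pair exchange_big; apply: eq_bigr => i _;
  apply: eq_bigr => al _ /=.
rewrite big_distrr; apply: eq_bigr => c _ /=.
have E k : next_family j s a d (al, i, c) k =
    mass (s al) * a al i * step i j c d (norm (s al)) k.
  by rewrite /next_family /= step_norm //; ring.
have -> : mass (next_family j s a d (al, i, c)) =
    mass (s al) * a al i * mass (step i j c d (norm (s al))).
  by rewrite -mass_scale; apply: eq_bigr.
(* The scalar [mass (s al) * a al i] is either positive, and then invisible to [norm], or zero, and
   then both sides vanish. *)
rewrite -mulrA; case: (eqVneq (mass (s al) * a al i) 0) => [->|n0]; first by rewrite !mul0r.
congr (_ * (_ * h _)); apply: norm_scale E; last first.
  by rewrite lt0r n0 mulr_ge0 ?mass_ge0 ?fdist_ge0.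
by apply: step_ge0 => k; exact: fdist_ge0.
Qed.

Lemma typed_pairing_belief_action A (s : A -> K -> R) (a : fdist R K -> fdist R I) i h :
  typed_pairing s (belief_action s a) i h = pairing s (fun x => a x i * h x).
Proof. by apply: eq_bigr => al _; rewrite mulrA. Qed.

Lemma equivalent_lin l A B (s : A -> K -> R) (s' : B -> K -> R) a i h : equivalent l s s' ->
  typed_pairing s (belief_action s a) i h = l * typed_pairing s' (belief_action s' a) i h.
Proof. by move=> ss'; rewrite !typed_pairing_belief_action ss'. Qed.

Lemma equivalent_pay j l A B (s : A -> K -> R) (s' : B -> K -> R) a :
  nonneg s -> nonneg s' -> equivalent l s s' ->
  stage_pay j s (belief_action s a) = l * stage_pay j s' (belief_action s' a).
Proof.
move=> s0 s'0 ss'; rewrite !stage_pay_typed_pairing // big_distrr; apply: eq_bigr => i _ /=.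
exact: equivalent_lin.
Qed.

Lemma equivalent_nxt j d l A B (s : A -> K -> R) (s' : B -> K -> R) a :
  nonneg s -> nonneg s' -> equivalent l s s' ->
  equivalent l (next_family j s (belief_action s a) d) (next_family j s' (belief_action s' a) d).
Proof.
move=> s0 s'0 ss' h; rewrite !pairing_next // big_distrr; apply: eq_bigr => i _ /=.
exact: equivalent_lin.
Qed.

Lemma total_mass_pairing A (s : A -> K -> R) : total_mass s = pairing s (fun=> 1).
Proof. by apply: eq_bigr => al _; rewrite mulr1. Qed.

Lemma equivalent_total_mass l A B (s : A -> K -> R) (s' : B -> K -> R) :
  equivalent l s s' -> total_mass s = l * total_mass s'.
Proof. by move=> ss'; rewrite !total_mass_pairing. Qed.

Lemma equivalentV l A B (s : A -> K -> R) (s' : B -> K -> R) : l != 0 ->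
  equivalent l s s' -> equivalent l^-1 s' s.
Proof. by move=> l0 ss' h; rewrite ss' mulKf. Qed.

(* Player 1 gains nothing from recalling more than his belief: [sigma] may be
   averaged over the types that share the same posterior. *)
Lemma average_strategy A (s : A -> K -> R) (sigma : A -> fdist R I) : nonneg s ->
  exists a : fdist R K -> fdist R I,
    forall i h, typed_pairing s sigma i h = typed_pairing s (belief_action s a) i h.
Proof.
move=> s0; have m0 al : 0 <= mass (s al) by exact: mass_ge0.
pose M x := \sum_(al | norm (s al) == x) mass (s al).
have M0 x : 0 <= M x by apply: sumr_ge0.
(* The conditional probability of [i] given the posterior [x], under the joint law of type and
   action. *)
pose f x i := (\sum_(al | norm (s al) == x) mass (s al) * sigma al i) / M x.
exists (fun x => to_fdistT (f x) (dret R i0)) => i h.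
have fE al : mass (s al) != 0 -> to_fdistT (f (norm (s al))) (dret R i0) i = f (norm (s al)) i.
  move=> mn0; have Mn0 : M (norm (s al)) != 0.
    rewrite gt_eqF // /M (bigD1 al) //= ltr_pwDl ?sumr_ge0 //.
    by rewrite lt0r mn0 m0.
  rewrite to_fdistTE // => [i'|].
    by rewrite divr_ge0 ?sumr_ge0 // => be _; rewrite mulr_ge0 ?fdist_ge0.
  rewrite -big_distrl /= exchange_big /=.
  rewrite (eq_bigr (fun be => mass (s be))) ?divff // => be _.
  by rewrite -big_distrr /= fdist_sumT mulr1.
transitivity (\sum_al mass (s al) * f (norm (s al)) i * h (norm (s al))); last first.
  apply: eq_bigr => al _; rewrite /belief_action.
  by have [->|/fE ->//] := eqVneq (mass (s al)) 0; rewrite !mul0r.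
transitivity (\sum_al \sum_(be | norm (s be) == norm (s al))
    mass (s al) * (mass (s be) * sigma be i) / M (norm (s al)) * h (norm (s al))); last first.
  by apply: eq_bigr => al _; rewrite -!big_distrl -big_distrr /= /f mulrA.
rewrite (exchange_big_dep xpredT) //=; apply: eq_bigr => be _.
transitivity (\sum_(al | norm (s al) == norm (s be))
  mass (s be) * sigma be i * h (norm (s be)) / M (norm (s be)) * mass (s al)); last first.
  by apply: eq_big => [al|al /eqP <-]; [rewrite eq_sym|ring].
rewrite -big_distrr /= -/(M _); have [m|Mn0] := eqVneq (M (norm (s be))) 0.
  move/eqP: m; rewrite psumr_eq0 // => /allP /(_ be (mem_index_enum _)).
  by rewrite eqxx => /eqP ->; rewrite !mul0r.
by rewrite divfK.
Qed.

End Families.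

(** * Second order beliefs as finitely supported distributions *)

Section Canon.
Variables (R : realType) (K : finType) (k0 : K).
Implicit Types (A B : finType) (y : fdist R (fdist R K)).
Notation norm := (norm k0).
Notation pairing := (pairing k0).
Notation equivalent := (equivalent k0).

(* Two families with the same normalised [canon] are the same belief of player 2,
   however player 1's private information is encoded. *)
Definition canon A (s : A -> K -> R) : fdist R (fdist R K) :=
  to_fdist [fset norm (s al) | al in A]
    (fun x => pairing s (fun z => (z == x)%:R) / total_mass s) (dret R (dret R k0)).

(** The converse encoding: the types are the posteriors in the support of [y], so that player 1
    knows his posterior and nothing more. *)
Definition belief_family y (x : finsupp y) : K -> R := fun k => y (val x) * val x k.
Arguments belief_family : clear implicits.

Lemma belief_family_ge0 y : nonneg (belief_family y).
Proof. by move=> x k; rewrite mulr_ge0 ?fdist_ge0. Qed.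

Lemma mass_belief_family y x : mass (belief_family y x) = y (val x).
Proof. by rewrite mass_scale mass_fdist mulr1. Qed.

Lemma norm_belief_family y x : norm (belief_family y x) = val x.
Proof.
rewrite -[RHS](norm_fdist k0); apply: (@norm_scale _ _ _ (y (val x))) => //.
  exact: fdist_ge0.
by rewrite -finsupp_gt0 fsvalP.
Qed.

Lemma pairing_belief_family y h : pairing (belief_family y) h = expect y h.
Proof.
rewrite /expect big_seq_fsetE /=; apply: eq_bigr => x _.
by rewrite mass_belief_family norm_belief_family.
Qed.

Lemma total_mass_belief_family y : total_mass (belief_family y) = 1.
Proof. by rewrite (total_mass_pairing k0) pairing_belief_family expect_cst. Qed.

Lemma pairing_sum A (s : A -> K -> R) (I : Type) (r : seq I) (h : I -> fdist R K -> R) :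
  pairing s (fun x => \sum_(i <- r) h i x) = \sum_(i <- r) pairing s (h i).
Proof. by rewrite exchange_big; apply: eq_bigr => al _; rewrite big_distrr. Qed.

Lemma canonE A (s : A -> K -> R) x : nonneg s -> 0 < total_mass s ->
  canon s x = pairing s (fun z => (z == x)%:R) / total_mass s.
Proof.
move=> s0 t0; rewrite to_fdistE.
- case: ifPn => // xS; rewrite /pairing big1 ?mul0r // => al _.
  case: eqP => [E|]; last by rewrite mulr0.
  by case/negP: xS; rewrite -E; apply: in_imfset.
- move=> z _; apply: divr_ge0; last exact: ltW.
  by apply: sumr_ge0 => al _; rewrite mulr_ge0 ?mass_ge0 ?ler0n.
- rewrite -big_distrl -pairing_sum /= -[RHS](@divff _ (total_mass s)) ?gt_eqF //; congr (_ / _).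
  rewrite (total_mass_pairing k0); apply: eq_bigr => al _; congr (_ * _).
  rewrite (big_fsetD1 (norm (s al))) /=; last exact: in_imfset.
  rewrite eqxx big1_fset ?addr0 // => z.
  by rewrite in_fsetD1 eq_sym => /andP[/negPf ->].
Qed.

(** Only finitely many posteriors are charged by either side; on that set [S], every [h] is a
    combination of indicators of points. *)
Lemma fdist_pairing A (s : A -> K -> R) y : nonneg s ->
  (forall x, pairing s (fun z => (z == x)%:R) = total_mass s * y x) ->
  forall h, pairing s h = total_mass s * expect y h.
Proof.
move=> s0 H h.
pose S := finsupp y `|` [fset norm (s al) | al in A].
rewrite (@expect_sub _ _ _ S) ?fsubsetUl // big_distrr /=.
transitivity (\sum_(x <- S) pairing s (fun z => (z == x)%:R) * h x); last first.
  by apply: eq_bigr => x _; rewrite H mulrA.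
under eq_bigr do rewrite big_distrl /=.
rewrite exchange_big; apply: eq_bigr => al _ /=.
rewrite (big_fsetD1 (norm (s al))) /=; last by rewrite in_fsetU; apply/orP; right;
  exact: in_imfset.
rewrite eqxx mulr1 big1_fset ?addr0 // => z.
by rewrite in_fsetD1 eq_sym => /andP[/negPf ->]; rewrite mulr0 mul0r.
Qed.

Lemma pairing_total_mass0 A (s : A -> K -> R) h : nonneg s -> total_mass s = 0 -> pairing s h = 0.
Proof.
move=> s0 /eqP; rewrite psumr_eq0 => [/allP t0|al _]; last exact: mass_ge0.
by apply: big1 => al _; rewrite (eqP (implyP (t0 al (mem_index_enum _)) isT)) mul0r.
Qed.

Lemma equivalent_canon A (s : A -> K -> R) : nonneg s -> equivalent (total_mass s) s
  (belief_family (canon s)).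
Proof.
move=> s0 h; rewrite pairing_belief_family; apply: fdist_pairing => // x.
have := total_mass_ge0 s0; rewrite le_eqVlt => /orP[/eqP/esym t0|t0].
  by rewrite pairing_total_mass0 // t0 mul0r.
by rewrite canonE // mulrC divfK ?gt_eqF.
Qed.

Lemma canon_unique A (s : A -> K -> R) y : nonneg s -> 0 < total_mass s ->
  (forall x, pairing s (fun z => (z == x)%:R) = total_mass s * y x) -> canon s = y.
Proof.
by move=> s0 t0 H; apply/fdistP => x; rewrite canonE // H mulrC mulKf ?gt_eqF.
Qed.

Lemma canon_equivalent l A B (s : A -> K -> R) (s' : B -> K -> R) :
  nonneg s -> nonneg s' -> 0 < total_mass s -> equivalent l s s' -> canon s = canon s'.
Proof.
move=> s0 s'0 t0 ss'; apply: canon_unique => // x; rewrite ss' (equivalent_total_mass ss').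
have ne := equivalent_total_mass ss'; rewrite {}ne in t0.
have t'0 : 0 < total_mass s'.
  by rewrite lt0r total_mass_ge0 // andbT; apply: contraL t0 => /eqP ->; rewrite mulr0 ltxx.
by rewrite canonE // -mulrA [total_mass s' * _]mulrC divfK ?gt_eqF.
Qed.

Lemma canon_supp A (s : A -> K -> R) x : nonneg s -> 0 < total_mass s ->
  x \in finsupp (canon s) -> exists2 al, 0 < mass (s al) & x = norm (s al).
Proof.
move=> s0 t0; rewrite finsupp_gt0 canonE // => H; apply: contrapT => N.
move: H; rewrite /pairing big1 ?mul0r ?ltxx // => al _.
case: eqP => [E|]; last by rewrite mulr0.
have := mass_ge0 (s0 al); rewrite le_eqVlt => /orP[/eqP <-|m0]; first by rewrite mul0r.
by case: N; exists al.
Qed.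

End Canon.
Arguments belief_family {R K} y.

(** * The controlled problem *)

Section Value.
Variables (R : realType) (K I J C D : finType).
Variables (q : K -> I -> J -> fdist R (K * C * D)%type) (g : K -> I -> J -> R).
Variables (k0 : K) (i0 : I) (j0 : J).
Hypothesis g01 : forall k i j, 0 <= g k i j <= 1.
Implicit Types (A B : finType) (w : nat -> R).
Notation equivalent := (equivalent k0).
Notation belief_action := (belief_action k0).
Notation next_family := (next_family q).
Notation stage_pay := (stage_pay g).

Lemma stage_pay_ge0 j A (s : A -> K -> R) (a : A -> fdist R I) : nonneg s -> 0 <= stage_pay j s a.
Proof.
move=> s0; apply: sumr_ge0 => al _; apply: sumr_ge0 => i _; apply: sumr_ge0 => k _.
by rewrite !mulr_ge0 ?fdist_ge0 //; case/andP: (g01 k i j).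
Qed.

Lemma stage_pay_le j A (s : A -> K -> R) (a : A -> fdist R I) : nonneg s -> stage_pay j s a <=
  total_mass s.
Proof.
move=> s0; apply: ler_sum => al _.
rewrite -[leRHS]mul1r -(fdist_sumT (a al)) big_distrl; apply: ler_sum => i _ /=.
rewrite big_distrr; apply: ler_sum => k _ /=.
by rewrite ler_piMr ?mulr_ge0 ?fdist_ge0 //; case/andP: (g01 k i j).
Qed.

Definition min_pay A (s : A -> K -> R) (a : A -> fdist R I) : R :=
  \big[Num.min/stage_pay j0 s a]_j stage_pay j s a.

Lemma min_pay_le j A (s : A -> K -> R) (a : A -> fdist R I) : min_pay s a <= stage_pay j s a.
Proof. exact: bigmin_le_cond. Qed.

Lemma min_payP A (s : A -> K -> R) (a : A -> fdist R I) : exists j, min_pay s a = stage_pay j s a.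
Proof.
rewrite /min_pay; elim/big_ind: _ => [|x y [j ->] [j' ->]|j _]; [by exists j0| |by exists j].
by rewrite minEle; case: ifP => _; [exists j|exists j'].
Qed.

Lemma min_pay_ge0 A (s : A -> K -> R) (a : A -> fdist R I) : nonneg s -> 0 <= min_pay s a.
Proof. by case: (min_payP s a) => j -> /stage_pay_ge0. Qed.

Lemma min_pay_le_total_mass A (s : A -> K -> R) (a : A -> fdist R I) : nonneg s -> min_pay s a
  <= total_mass s.
Proof. by case: (min_payP s a) => j -> /stage_pay_le. Qed.

Lemma min_pay_scale l A B (s : A -> K -> R) (s' : B -> K -> R) a a' : 0 <= l ->
  (forall j, stage_pay j s a = l * stage_pay j s' a') -> min_pay s a = l * min_pay s' a'.
Proof.
move=> l0 E; apply/eqP; rewrite eq_le; apply/andP; split.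
  by case: (min_payP s' a') => j ->; rewrite -E min_pay_le.
by case: (min_payP s a) => j ->; rewrite E ler_wpM2l // min_pay_le.
Qed.

(* The value of the [n]-stage problem with stage weights [w] in which player 2
   plays the dummy action [j0] as far as the signals are concerned, but is
   nevertheless charged a best reply at each stage. *)
Fixpoint value n (w : nat -> R) A (s : A -> K -> R) : R :=
  if n is n'.+1 then
    sup [set w 0 * min_pay s a + \sum_d value n' (w \o S) (next_family j0 s a d) |
         a in [set: A -> fdist R I]]%classic
  else 0.

Definition action_value n w A (s : A -> K -> R) a : R :=
  w 0 * min_pay s a + \sum_d value n (w \o S) (next_family j0 s a d).

Definition total_weight n w : R := \sum_(t < n) w t.

Lemma total_weightS n w : total_weight n.+1 w = w 0 + total_weight n (w \o S).
Proof. by rewrite /total_weight big_ord_recl. Qed.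

Lemma total_weight_ge0 n w : (forall t, 0 <= w t) -> 0 <= total_weight n w.
Proof. by move=> w0; apply: sumr_ge0. Qed.

(** These bounds also make each [sup] in [value] the supremum of a bounded set. *)
Lemma value_bounds n w A (s : A -> K -> R) : (forall t, 0 <= w t) -> nonneg s ->
  0 <= value n w s <= total_weight n w * total_mass s.
Proof.
elim: n w A s => [|n IH] w A s w0 s0 /=; first by rewrite /total_weight big_ord0 mul0r lexx.
have B a : 0 <= action_value n w s a <= total_weight n.+1 w * total_mass s.
  have H d := IH (w \o S) _ _ (fun t => w0 t.+1) (next_family_ge0 q j0 a d s0).
  apply/andP; split.
    rewrite addr_ge0 ?mulr_ge0 ?min_pay_ge0 ?sumr_ge0 // => d _.
    by case/andP: (H d).
  rewrite total_weightS mulrDl lerD ?ler_wpM2l ?min_pay_le_total_mass //.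
  rewrite -(sum_total_mass_next q j0 s a) big_distrr; apply: ler_sum => d _.
  by case/andP: (H d).
have h0 : has_sup [set action_value n w s a | a in [set: A -> fdist R I]]%classic.
  split; first by exists (action_value n w s (fun=> dret R i0)); exists (fun=> dret R i0).
  by exists (total_weight n.+1 w * total_mass s) => _ [a _ <-]; case/andP: (B a).
apply/andP; split.
  apply: le_trans (_ : action_value n w s (fun=> dret R i0) <= _);
    first by case/andP: (B (fun=> dret R i0)).
  by apply: ub_le_sup; [case: h0|exists (fun=> dret R i0)].
apply: ge_sup; first by case: h0.
by move=> _ [a _ <-]; case/andP: (B a).
Qed.

Lemma action_value_has_sup n w A (s : A -> K -> R) : (forall t, 0 <= w t) -> nonneg s ->
  has_sup [set action_value n w s a | a in [set: A -> fdist R I]]%classic.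
Proof.
move=> w0 s0; split; first by exists (action_value n w s (fun=> dret R i0));
  exists (fun=> dret R i0).
exists (total_weight n.+1 w * total_mass s) => _ [a _ <-].
rewrite total_weightS mulrDl lerD ?ler_wpM2l ?min_pay_le_total_mass //.
rewrite -(sum_total_mass_next q j0 s a) big_distrr; apply: ler_sum => d _.
by case/andP: (value_bounds n (fun t => w0 t.+1) (next_family_ge0 q j0 a d s0)).
Qed.

Lemma action_value_le n w A (s : A -> K -> R) a : (forall t, 0 <= w t) -> nonneg s ->
  action_value n w s a <= value n.+1 w s.
Proof. by move=> w0 s0; apply: ub_le_sup; [case: (action_value_has_sup n w0 s0)|exists a]. Qed.

Lemma value_le n w A (s : A -> K -> R) M : (forall a, action_value n w s a <= M) -> value n.+1
  w s <= M.
Proof.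
move=> UM; apply: ge_sup; first by exists (action_value n w s (fun=> dret R i0));
  exists (fun=> dret R i0).
by move=> _ [a _ <-]; exact: UM.
Qed.

Lemma value_approx n w A (s : A -> K -> R) e : (forall t, 0 <= w t) -> nonneg s -> 0 < e ->
  exists a, value n.+1 w s <= action_value n w s a + e.
Proof.
move=> w0 s0 e0; have [_ [a _ <-] /ltW] := sup_adherent e0 (action_value_has_sup n w0 s0).
by rewrite lerBlDr; exists a.
Qed.

(** Types of [s] mean nothing in [s'], but posteriors do: a strategy in [s] is first averaged over
    equal posteriors, and the resulting rule is played in [s']. *)
Lemma value_eqv_le n w l A B (s : A -> K -> R) (s' : B -> K -> R) :
  (forall t, 0 <= w t) -> nonneg s -> nonneg s' -> 0 <= l ->
  equivalent l s s' -> value n w s <= l * value n w s'.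
Proof.
elim: n w A B s s' => [|n IH] w A B s s' w0 s0 s'0 l0 ss'; first by rewrite mulr0.
apply: value_le => sigma; have [a aE] := average_strategy k0 i0 sigma s0.
apply: le_trans (_ : l * action_value n w s' (belief_action s' a) <= _);
  last by rewrite ler_wpM2l ?action_value_le.
have pE j : stage_pay j s sigma = stage_pay j s (belief_action s a).
  by rewrite !(stage_pay_typed_pairing g k0) //; apply: eq_bigr.
rewrite /action_value (@min_pay_scale l _ _ s s' sigma (belief_action s' a)) //; last first.
  by move=> j; rewrite pE; apply: equivalent_pay.
rewrite mulrDr mulrCA lerD // big_distrr; apply: ler_sum => d _ /=.
apply: IH => //; [move=> t; exact: w0|exact: next_family_ge0|exact: next_family_ge0|move=> h].
rewrite -(equivalent_nxt q j0 d a s0 s'0 ss') !pairing_next //.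
by apply: eq_bigr.
Qed.

Lemma value_eqv n w l A B (s : A -> K -> R) (s' : B -> K -> R) :
  (forall t, 0 <= w t) -> nonneg s -> nonneg s' -> 0 <= l ->
  equivalent l s s' -> value n w s = l * value n w s'.
Proof.
move=> w0 s0 s'0 l0 ss'; apply/eqP; rewrite eq_le value_eqv_le //=.
have [lz|lp] := eqVneq l 0.
  by rewrite lz mul0r; case/andP: (value_bounds n w0 s0).
rewrite -ler_pdivlMl ?lt0r ?lp //; apply: value_eqv_le => //; first by rewrite invr_ge0.
exact: equivalentV.
Qed.

Lemma value_canon n w A (s : A -> K -> R) : (forall t, 0 <= w t) -> nonneg s ->
  value n w s = total_mass s * value n w (belief_family (canon k0 s)).
Proof.
move=> w0 s0; apply: value_eqv => //; [exact: belief_family_ge0|exact: total_mass_ge0|exact: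
  equivalent_canon].
Qed.

Definition dist A (s s' : A -> K -> R) : R := \sum_al \sum_k `|s al k - s' al k|.

Lemma stage_pay_lip j A (s s' : A -> K -> R) (a : A -> fdist R I) :
  stage_pay j s a <= stage_pay j s' a + dist s s'.
Proof.
rewrite -lerBlDl -sumrB; apply: ler_sum => al _; rewrite -sumrB.
rewrite -[leRHS]mul1r -(fdist_sumT (a al)) big_distrl; apply: ler_sum => i _ /=.
rewrite -sumrB big_distrr; apply: ler_sum => k _ /=.
rewrite -mulrBl -mulrBr -mulrA ler_wpM2l ?fdist_ge0 //.
apply: le_trans (ler_norm _) _; rewrite normrM ler_piMr //.
by rewrite ger0_norm; case/andP: (g01 k i j).
Qed.

(** The absolute difference of two families is itself a nonnegative family, whose total mass is
    preserved by transitions; the rest is the triangle inequality. *)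
Lemma dist_next j A (s s' : A -> K -> R) (a : A -> fdist R I) :
  \sum_d dist (next_family j s a d) (next_family j s' a d) <= dist s s'.
Proof.
pose s'' al k := `|s al k - s' al k|.
have <- : total_mass s'' = dist s s' by [].
rewrite -(sum_total_mass_next q j s'' a); apply: ler_sum => d _; apply: ler_sum => t _.
apply: ler_sum => k _; rewrite /next_family -mulrBr normrM ger0_norm ?fdist_ge0 //.
rewrite ler_wpM2l ?fdist_ge0 // -sumrB; apply: le_trans (ler_norm_sum _ _ _) _.
by apply: ler_sum => k' _; rewrite -mulrBl normrM [X in _ * X]ger0_norm ?fdist_ge0.
Qed.

Lemma value_lip n w A (s s' : A -> K -> R) : (forall t, 0 <= w t) -> nonneg s -> nonneg s' ->
  value n w s <= value n w s' + total_weight n w * dist s s'.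
Proof.
elim: n w A s s' => [|n IH] w A s s' w0 s0 s'0.
  by rewrite /= add0r /total_weight big_ord0 mul0r.
apply: value_le => a; apply: le_trans (_ : action_value n w s' a + total_weight n.+1 w * dist s
  s' <= _); last first.
  by rewrite lerD2r action_value_le.
rewrite total_weightS mulrDl /action_value addrACA lerD //.
  rewrite -mulrDr ler_wpM2l //; case: (min_payP s' a) => j ->.
  exact: le_trans (min_pay_le j _ _) (stage_pay_lip _ _ _ _).
apply: le_trans (_ : _ <= \sum_d (value n (w \o S) (next_family j0 s' a d) +
    total_weight n (w \o S) * dist (next_family j0 s a d) (next_family j0 s' a d))) _.
  by apply: ler_sum => d _; apply: IH => [t||]; [exact: w0|exact: next_family_ge0|exact:
    next_family_ge0].
rewrite big_split lerD2l -big_distrr ler_wpM2l ?total_weight_ge0 ?dist_next // => t.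
exact: w0.
Qed.

(** One rule serves both weights on the left, while each term on the right is optimised separately.
    With an inequality between the weights, [w''] can absorb whatever [w'] misses. *)
Lemma value_sub n w w' w'' A (s : A -> K -> R) :
  (forall t, 0 <= w' t) -> (forall t, 0 <= w'' t) ->
  (forall t, (t < n)%N -> w t <= w' t + w'' t) -> nonneg s ->
  value n w s <= value n w' s + value n w'' s.
Proof.
elim: n w w' w'' A s => [|n IH] w w' w'' A s w'0 w''0 H s0; first by rewrite /= addr0.
apply: value_le => a.
apply: le_trans (_ : action_value n w' s a + action_value n w'' s a <= _);
  last by rewrite lerD ?action_value_le.
rewrite /action_value addrACA -mulrDl lerD ?ler_wpM2r ?min_pay_ge0 ?H // -big_split /=.
by apply: ler_sum => d _; apply: IH => // [t|t|t|];
  [exact: w'0|exact: w''0|exact: (H t.+1)|exact: next_family_ge0].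
Qed.

Lemma value0 n A (s : A -> K -> R) : nonneg s -> value n (fun=> 0) s = 0.
Proof.
move=> s0; have := @value_bounds n (fun=> 0) _ s (fun=> lexx _) s0.
by rewrite /total_weight big1 // mul0r -eq_le => /eqP.
Qed.

Lemma value_le_weight n w w' A (s : A -> K -> R) : (forall t, 0 <= w' t) ->
  (forall t, (t < n)%N -> w t <= w' t) -> nonneg s -> value n w s <= value n w' s.
Proof.
move=> w'0 H s0; rewrite -[leRHS]addr0 -(value0 n s0); apply: value_sub => // t tn.
by rewrite addr0 H.
Qed.

Lemma value_scale n w c A (s : A -> K -> R) : (forall t, 0 <= w t) -> 0 <= c -> nonneg s ->
  value n (fun t => c * w t) s <= c * value n w s.
Proof.
elim: n w A s => [|n IH] w A s w0 c0 s0; first by rewrite /= mulr0.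
apply: value_le => a; apply: le_trans (_ : c * action_value n w s a <= _);
  last by rewrite ler_wpM2l ?action_value_le.
rewrite /action_value mulrDr mulrA lerD2l big_distrr; apply: ler_sum => d _ /=.
by apply: (IH (w \o S)) => // [t|]; [exact: w0|exact: next_family_ge0].
Qed.

Lemma value_sum n N c (w : nat -> nat -> R) A (s : A -> K -> R) :
  (forall l t, 0 <= w l t) -> 0 <= c -> nonneg s ->
  value n (fun t => \sum_(l < N) c * w l t) s <= \sum_(l < N) c * value n (w l) s.
Proof.
move=> w0 c0 s0; elim: N => [|N IH].
  by rewrite [leRHS]big_ord0 -[leRHS](value0 n s0); apply: value_le_weight => // t _;
    rewrite big_ord0.
rewrite big_ord_recr /=; apply: le_trans (lerD IH (value_scale n (w0 N) c0 s0)).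
apply: value_sub => //= [t|t|t _]; last by rewrite big_ord_recr.
  by apply: sumr_ge0 => l _; rewrite mulr_ge0.
by rewrite mulr_ge0.
Qed.

Lemma value_tail n m w A (s : A -> K -> R) : (forall t, 0 <= w t) ->
  (forall t, (n <= t)%N -> w t = 0) -> nonneg s -> value (n + m) w s = value n w s.
Proof.
elim: n w A s => [|n IH] w A s w0 wn s0.
  rewrite add0n; have -> : w = fun=> 0 by apply/funext => t; exact: wn.
  by rewrite value0.
rewrite addSn /=; congr sup; congr image; apply/funext => a; congr (_ + _).
apply: eq_bigr => d _; apply: IH => [t|t nt|]; [exact: w0|exact: wn|exact: next_family_ge0].
Qed.

Lemma value_horizon n m w A (s : A -> K -> R) : (forall t, 0 <= w t) -> nonneg s ->
  value n w s <= value (n + m) w s.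
Proof.
move=> w0 s0; pose w' t := if (t < n)%N then w t else 0.
have w'0 t : 0 <= w' t by rewrite /w'; case: ifP.
apply: le_trans (_ : value n w' s <= _).
  by apply: value_le_weight => // t tn; rewrite /w' tn.
rewrite -(@value_tail n m) // => [|t nt]; last by rewrite /w' ltnNge nt.
by apply: value_le_weight => // t _; rewrite /w'; case: ifP.
Qed.

Lemma total_weight_tail n m w : (forall t, (n <= t)%N -> w t = 0) -> total_weight (n + m) w =
  total_weight n w.
Proof.
move=> wn; rewrite /total_weight big_split_ord /= [X in _ + X]big1 ?addr0 // => t _.
by rewrite wn ?leq_addr.
Qed.

Lemma total_weight_le n m w : (forall t, 0 <= w t) -> (n <= m)%N -> total_weight n w <=
  total_weight m w.
Proof.
move=> w0 nm; rewrite /total_weight (big_ord_widen _ w nm) big_mkcond.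
by apply: ler_sum => t _; case: ifP.
Qed.

(** Recursive so that [shift m.+1 w \o S] is convertible to [shift m w], matching the recursion of
    [value]. *)
Fixpoint shift m w : nat -> R :=
  if m is m'.+1 then fun t => if t is t'.+1 then shift m' w t' else 0 else w.

Lemma shiftE m w t : shift m w t = if (t < m)%N then 0 else w (t - m)%N.
Proof. by elim: m t => [|m IH] [|t] //=; rewrite ?subn0 // IH ltnS subSS. Qed.

Lemma shift_ge0 m w : (forall t, 0 <= w t) -> forall t, 0 <= shift m w t.
Proof. by move=> w0 t; rewrite shiftE; case: ifP. Qed.

Lemma total_weight_shift m n w : total_weight (m + n) (shift m w) = total_weight n w.
Proof.
elim: m => [//|m IH]; rewrite addSn total_weightS add0r; exact: IH.
Qed.

End Value.

(** * Total boundedness and slow weights *)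

Section Nets.
Variable R : realType.

Lemma ler_distP (a b c : R) : a <= b + c -> b <= a + c -> `|a - b| <= c.
Proof. by move=> ab ba; rewrite ler_norml; apply/andP; split; lra. Qed.

(** Coordinates are rounded down to multiples of [1 / M], which leaves finitely many cells, and a
    point is chosen in each nonempty one. No topology on [T] is involved, so this serves for
    posteriors, beliefs, continuations and strategies alike. *)
Lemma finite_net (T : Type) (N : finType) (f : T -> N -> R) (e : R) (t0 : T) :
  (forall t n, 0 <= f t n <= 1) -> 0 < e ->
  exists (L : finType) (rep : L -> T), forall t, exists l, forall n,
    `|f t n - f (rep l) n| <= e.
Proof.
move=> f01 e0.
pose M := (Num.truncn e^-1).+1.
have M0 : 0 < M%:R :> R by rewrite ltr0n.
have Me : M%:R^-1 <= e.
  rewrite -[leRHS]invrK lef_pV2 ?posrE ?invr_gt0 //; apply/ltW.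
  by case/andP: (truncn_itv (ltW (etrans (invr_gt0 e) e0))).
pose cell t : {ffun N -> 'I_M.+1} := [ffun n => inord (Num.truncn (f t n * M%:R))].
have cellP t t' : cell t = cell t' -> forall n, `|f t n - f t' n| <= e.
  move=> tt' n; apply: le_trans Me.
  have B u : (Num.truncn (f u n * M%:R) < M.+1)%N.
    case/andP: (f01 u n) => u0 u1; rewrite truncn_lt_nat ?mulr_ge0 //.
    by rewrite (@le_lt_trans _ _ M%:R) ?ltr_nat // ler_piMl ?ler0n.
  have : nat_of_ord (cell t n) = cell t' n by rewrite tt'.
  rewrite !ffunE !inordK // => E.
  have I u : (Num.truncn (f u n * M%:R))%:R <= f u n * M%:R < (Num.truncn (f u n * M%:R)).+1%:R.
    by apply: truncn_itv; case/andP: (f01 u n) => u0 _; rewrite mulr_ge0.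
  have := I t; have := I t'; rewrite -E -natr1 => /andP[a b] /andP[c d].
  rewrite ler_norml -(ler_pM2r M0) -[X in _ && X](ler_pM2r M0) mulNr mulVf ?gt_eqF //.
  by rewrite mulrBl; lra.
have repP (l : {ffun N -> 'I_M.+1}) : exists t, (exists t', cell t' = l) -> cell t = l.
  by case: (pselect (exists t', cell t' = l)) => [[t tl]|H]; [exists t|exists t0].
have [rep repE] := choice repP.
exists {ffun N -> 'I_M.+1}, rep => t; exists (cell t) => n.
by apply: cellP; rewrite repE //; exists t.
Qed.

End Nets.

Section TotallyBounded.
Variables (R : realType) (K I J C D : finType).
Variables (q : K -> I -> J -> fdist R (K * C * D)%type) (g : K -> I -> J -> R).
Variables (k0 : K) (i0 : I) (j0 : J).
Hypothesis g01 : forall k i j, 0 <= g k i j <= 1.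
Implicit Types (A B : finType) (w : nat -> R).
Notation pairing := (pairing k0).
Notation value := (value q g j0).

Definition scaled_family A (m : A -> R) (r : A -> fdist R K) : A -> K -> R :=
  fun al k => m al * r al k.

Lemma scaled_family_ge0 A (m : A -> R) r : (forall al, 0 <= m al) -> nonneg (scaled_family m r).
Proof. by move=> m0 al k; rewrite mulr_ge0 ?fdist_ge0. Qed.

Lemma mass_scaled A (m : A -> R) r al : mass (scaled_family m r al) = m al.
Proof. by rewrite mass_scale mass_fdist mulr1. Qed.

Lemma pairing_scaled A (m : A -> R) r h : (forall al, 0 <= m al) ->
  pairing (scaled_family m r) h = \sum_al m al * h (r al).
Proof.
move=> m0; apply: eq_bigr => al _; rewrite mass_scaled.
have [->|mn0] := eqVneq (m al) 0; first by rewrite !mul0r.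
congr (_ * h _); rewrite -[RHS](norm_fdist k0); apply: (@norm_scale _ _ _ (m al)) => //.
  exact: fdist_ge0.
by rewrite lt0r mn0 m0.
Qed.

Lemma dist_scaled A (m m' : A -> R) r :
  dist (scaled_family m r) (scaled_family m' r) = \sum_al `|m al - m' al|.
Proof.
apply: eq_bigr => al _; rewrite -[RHS]mulr1 -(fdist_sumT (r al)) big_distrr.
by apply: eq_bigr => k _; rewrite -mulrBl normrM [X in _ * X]ger0_norm ?fdist_ge0.
Qed.

Lemma simplex_net (e : R) : 0 < e -> exists (L : finType) (rep : L -> fdist R K),
  forall x : fdist R K, exists l, \sum_k `|x k - rep l k| <= e.
Proof.
move=> e0; have Kp : 0 < #|K|%:R :> R by rewrite ltr0n; apply/card_gt0P; exists k0.
have [t n||L [rep H]] := @finite_net R (fdist R K) K (fun x k => x k) (e / #|K|%:R) (dret R k0).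
- by rewrite fdist_ge0 fdist_le1.
- by rewrite divr_gt0.
exists L, rep => x; have [l xl] := H x; exists l.
apply: le_trans (_ : \sum_(k in K) e / #|K|%:R <= _); first by apply: ler_sum.
by rewrite sumr_const -[_ *+ _]mulr_natr divfK ?gt_eqF.
Qed.

(** Two discretisations: posteriors move to a net of the simplex, then the weights put on that net
    are rounded. By [value_lip] the error is proportional to the total weight, whatever the horizon.
    The three errors [e / 3] are for the posteriors of [y], for the weights, and for the posteriors
    of the representative. *)
Lemma belief_net (e : R) : 0 < e ->
  exists (L : finType) (rep : L -> fdist R (fdist R K)),
  forall y, exists l, forall n w, (forall t, 0 <= w t) ->
    `|value n w (belief_family y) - value n w (belief_family (rep l))| <= total_weight n w * e.
Proof.
move=> e0; have e3 : 0 < e / 3 by rewrite divr_gt0.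
have [L1 [rep1 net1]] := simplex_net e3.
have [cell cellE] := choice net1.
pose mu (y : fdist R (fdist R K)) := dmap cell y.
pose e' := e / 3 / #|L1|.+1%:R.
have e'0 : 0 < e' by rewrite divr_gt0.
have [t n|L [rep H]] := @finite_net R _ L1 (fun y => mu y) e' (dret R (dret R k0)) _ e'0.
  by rewrite fdist_ge0 fdist_le1.
have stepA y n w : (forall t, 0 <= w t) ->
    `|value n w (belief_family y) - value n w (scaled_family (mu y) rep1)| <= total_weight n w
      * (e / 3).
  move=> w0.
  (* This family keeps the types of [y] and moves only their posteriors, so it can be compared with
     [belief_family y] by [dist]; merging the types of a cell is then a mere change of encoding. *)
  pose s' := scaled_family (fun x : finsupp y => y (val x)) (fun x => rep1 (cell (val x))).
  have s'0 : nonneg s' by apply: scaled_family_ge0 => x; exact: fdist_ge0.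
  have dE : dist (belief_family y) s' <= e / 3.
    rewrite -[leRHS]mul1r -{1}(total_mass_belief_family k0 y) big_distrl;
      apply: ler_sum => x _ /=.
    rewrite mass_belief_family; apply: le_trans (_ : y (val x) * (\sum_k `|val x k - rep1 (cell
      (val x)) k|) <= _).
      rewrite big_distrr; apply: ler_sum => k _ /=.
      by rewrite -mulrBr normrM ger0_norm ?fdist_ge0.
    by apply: ler_wpM2l; [exact: fdist_ge0|exact: cellE].
  have dE' : dist s' (belief_family y) <= e / 3.
    by apply: le_trans dE; apply: ler_sum => x _; apply: ler_sum => k _; rewrite distrC.
  have -> : value n w (scaled_family (mu y) rep1) = value n w s'.
    rewrite -[RHS]mul1r; apply: (value_eqv q i0 j0 g01 n w0 (scaled_family_ge0 _ _) s'0 ler01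
      (k0 := k0)).
      by move=> l; exact: fdist_ge0.
    move=> h; rewrite mul1r !pairing_scaled => [|x|l]; try exact: fdist_ge0.
    by rewrite -expectT expect_dmap /expect big_seq_fsetE.
  have y0 : nonneg (belief_family y) by exact: belief_family_ge0.
  have Wn := total_weight_ge0 n w0.
  apply: ler_distP; last first.
    apply: le_trans (value_lip q i0 j0 g01 n w0 s'0 y0) _.
    by rewrite lerD2l ler_wpM2l.
  apply: le_trans (value_lip q i0 j0 g01 n w0 y0 s'0) _.
  by rewrite lerD2l ler_wpM2l.
exists L, rep => y; have [l yl] := H y; exists l => n w w0.
have Wn := total_weight_ge0 n w0.
have stepB : `|value n w (scaled_family (mu y) rep1) - value n w (scaled_family (mu (rep l))
  rep1)| <= total_weight n w * (e / 3).
  have D1 : dist (scaled_family (mu y) rep1) (scaled_family (mu (rep l)) rep1) <= e / 3.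
    rewrite dist_scaled; apply: le_trans (_ : \sum_(i in L1) e' <= _); first by apply: ler_sum.
    have e1 : #|L1|%:R / #|L1|.+1%:R <= 1 :> R by rewrite ler_pdivrMr // mul1r ler_nat.
    rewrite sumr_const -[_ *+ _]mulr_natr.
    have -> : e' * #|L1|%:R = e / 3 * (#|L1|%:R / #|L1|.+1%:R) by rewrite /e'; ring.
    by rewrite ler_piMr // ltW.
  have D2 : dist (scaled_family (mu (rep l)) rep1) (scaled_family (mu y) rep1) <= e / 3.
    by apply: le_trans D1; apply: ler_sum => x _; apply: ler_sum => k _; rewrite distrC.
  have F0 z : nonneg (scaled_family (mu z) rep1) by apply: scaled_family_ge0 => i;
    exact: fdist_ge0.
  apply: ler_distP; last first.
    apply: le_trans (value_lip q i0 j0 g01 n w0 (F0 _) (F0 y)) _.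
    by rewrite lerD2l ler_wpM2l.
  apply: le_trans (value_lip q i0 j0 g01 n w0 (F0 y) (F0 (rep l))) _.
  by rewrite lerD2l ler_wpM2l.
have := stepA y n w w0; have := stepA (rep l) n w w0; move: stepB.
have -> : total_weight n w * e = total_weight n w * (e / 3) + total_weight n w * (e / 3) +
  total_weight n w * (e / 3) by field.
rewrite !ler_norml => /andP[a1 a2] /andP[b1 b2] /andP[c1 c2].
apply/andP; split; lra.
Qed.

End TotallyBounded.

(** * Bounded delays, blocks and the limit value *)

Section Asymptotics.
Variables (R : realType) (K I J C D : finType).
Variables (q : K -> I -> J -> fdist R (K * C * D)%type) (g : K -> I -> J -> R).
Variables (k0 : K) (i0 : I) (j0 : J).
Hypothesis g01 : forall k i j, 0 <= g k i j <= 1.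
Implicit Types (A B : finType) (w : nat -> R).
Notation next_family := (next_family q).
Notation value := (value q g j0).
Notation action_value := (action_value q g j0).

(* [F] is the continuation value, as a function of the horizon and of the
   weights, after [m] unpaid stages of some strategy of player 1. *)
Fixpoint reached m A B (fam : B -> A -> K -> R) (F : nat -> (nat -> R) -> R) : Prop :=
  if m is m'.+1 then
    exists a : B -> A -> fdist R I,
      reached m' (fun bd : B * D => next_family j0 (fam bd.1) (a bd.1) bd.2) F
  else forall n w, F n w = \sum_b value n w (fam b).

Definition family_value n w A B (fam : B -> A -> K -> R) : R := \sum_b value n w
  (fam b).

Lemma reached_le m A B (fam : B -> A -> K -> R) F n w : (forall t, 0 <= w t) ->
  (forall b, nonneg (fam b)) -> reached m fam F -> F n w <= family_value (m +
    n) (shift m w) fam.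
Proof.
move=> w0; elim: m A B fam => [|m IH] A B fam sp0 /=; first by move=> ->.
move=> [a /IH H]; apply: le_trans (H _) _ => [b|]; first exact: next_family_ge0.
rewrite [leLHS]sum_pair; apply: ler_sum => b _.
apply: le_trans (action_value_le q i0 j0 g01 (m + n) (a b) (shift_ge0 m.+1 w0) (sp0 b)).
by rewrite /action_value mul0r add0r.
Qed.

Lemma reached_approx m A B (fam : B -> A -> K -> R) n w e : (forall t, 0 <= w t) ->
  (forall b, nonneg (fam b)) -> 0 < e ->
  exists2 F, reached m fam F & family_value (m + n) (shift m w) fam <= F n w
    + e.
Proof.
move=> w0; elim: m A B fam e => [|m IH] A B fam e sp0 e0 /=.
  by exists (fun n w => family_value n w fam) => //; rewrite lerDl ltW.
pose e' := e / 2 / #|B|.+1%:R.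
have e'0 : 0 < e' by rewrite !divr_gt0.
have [a aE] := choice (fun b => value_approx q i0 j0 g01 (m + n) (shift_ge0 m.+1 w0) (sp0 b) e'0).
have [||F HF FE] := IH _ _ (fun bd : B * D => next_family j0 (fam bd.1) (a bd.1) bd.2)
  (e / 2).
- by move=> b; exact: next_family_ge0.
- by rewrite divr_gt0.
exists F; first by exists a.
apply: le_trans (_ : family_value (m + n) (shift m w) (fun bd : B * D => next_family j0
  (fam bd.1) (a bd.1) bd.2) + e / 2 <= _); last first.
  by rewrite [in leRHS](splitr e) addrA lerD2r.
rewrite [family_value (m + n) _ _]sum_pair.
apply: le_trans (_ : \sum_b (\sum_d value (m + n) (shift m w) (next_family j0 (fam b)
  (a b) d) + e') <= _).
  apply: ler_sum => b _; apply: le_trans (aE b) _.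
  by rewrite /action_value mul0r add0r.
rewrite big_split /= lerD2l sumr_const -[_ *+ _]mulr_natr.
have e1 : #|B|%:R / #|B|.+1%:R <= 1 :> R by rewrite ler_pdivrMr // mul1r ler_nat.
have -> : e' * #|B|%:R = e / 2 * (#|B|%:R / #|B|.+1%:R) by rewrite /e'; ring.
by rewrite ler_piMr // ltW // divr_gt0.
Qed.

(** What is reached is a distribution over second order beliefs. Replacing each belief by its
    representative turns it into weights [phi] on [L], which depend neither on the horizon nor on
    [w]. *)
Lemma reached_net (L : finType) (rep : L -> fdist R (fdist R K)) e m A B
    (fam : B -> A -> K -> R) F :
  (forall y, exists l, forall n w, (forall t, 0 <= w t) ->
    `|value n w (belief_family y) - value n w (belief_family (rep l))| <= total_weight n w * e) ->
  (forall b, nonneg (fam b)) -> reached m fam F ->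
  exists phi : L -> R, [/\ forall l, 0 <= phi l, \sum_l phi l = \sum_b total_mass (fam
    b) &
    forall n w, (forall t, 0 <= w t) ->
      `|F n w - \sum_l phi l * value n w (belief_family (rep l))| <= (\sum_b total_mass
        (fam b)) * (total_weight n w * e)].
Proof.
move=> /choice[cell cellE]; elim: m A B fam => [|m IH] A B fam sp0 /=;
  last first.
  move=> [a aF]; have [b|phi [phi0 phi1 phiE]] := IH _ _ _ _ aF;
    first exact: (next_family_ge0 q j0 _ _ (sp0 b.1)).
  have E : \sum_(bd : B * D) total_mass (next_family j0 (fam bd.1) (a bd.1) bd.2) =
    \sum_b total_mass (fam b).
    by rewrite sum_pair; apply: eq_bigr => b _; exact: (sum_total_mass_next q j0 (fam
      b) (a b)).
  by exists phi; rewrite -E.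
move=> FE; pose l b := cell (canon k0 (fam b)).
exists (fun l' => \sum_(b | l b == l') total_mass (fam b)); split.
- by move=> l'; apply: sumr_ge0 => b _; exact: total_mass_ge0.
- rewrite (exchange_big_dep xpredT) //=; apply: eq_bigr => b _.
  by rewrite (big_pred1 (l b)) // => l'; rewrite eq_sym.
move=> n w w0; rewrite FE.
have -> : \sum_l' (\sum_(b | l b == l') total_mass (fam b)) * value n w (belief_family
  (rep l')) =
    \sum_b total_mass (fam b) * value n w (belief_family (rep (l b))).
  under eq_bigr do rewrite big_distrl /=.
  rewrite (exchange_big_dep xpredT) //=; apply: eq_bigr => b _.
  by rewrite (big_pred1 (l b)) // => l'; rewrite eq_sym.
rewrite -sumrB big_distrl /=; apply: le_trans (ler_norm_sum _ _ _) _.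
apply: ler_sum => b _; rewrite (value_canon q k0 i0 j0 g01 n w0 (sp0 b)) -mulrBr normrM.
by rewrite ger0_norm ?total_mass_ge0 // ler_wpM2l ?total_mass_ge0 // cellE.
Qed.

Section Initial.
Variables (A B : finType) (fam : B -> A -> K -> R).
Hypotheses (sp0 : forall b, nonneg (fam b)) (sp1 : \sum_b total_mass (fam b)
  = 1).

Lemma family_value_ge0 n w : (forall t, 0 <= w t) -> 0 <= family_value n w fam.
Proof.
by move=> w0; apply: sumr_ge0 => b _; case/andP: (value_bounds q i0 j0 g01 n w0 (sp0 b)).
Qed.

Lemma family_value_le n w : (forall t, 0 <= w t) -> family_value n w fam <=
  total_weight n w.
Proof.
move=> w0; rewrite -[leRHS]mulr1 -sp1 big_distrr; apply: ler_sum => b _.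
by case/andP: (value_bounds q i0 j0 g01 n w0 (sp0 b)).
Qed.

Lemma family_value_sub n w w' w'' : (forall t, 0 <= w' t) -> (forall t, 0 <= w'' t) ->
  (forall t, (t < n)%N -> w t <= w' t + w'' t) ->
  family_value n w fam <= family_value n w' fam + family_value n w''
    fam.
Proof.
move=> w'0 w''0 H; rewrite /family_value -big_split; apply: ler_sum => b _; exact: value_sub.
Qed.

Lemma family_value_tail n m w : (forall t, 0 <= w t) ->
  (forall t, (n <= t)%N -> w t = 0) -> family_value (n + m) w fam = family_value n w
    fam.
Proof. by move=> w0 wn; apply: eq_bigr => b _; exact: (value_tail q i0 j0 g01). Qed.

(** Whatever the delay, what is reached is described within [e / 4] by a vector in the cube over
    [L]. Finitely many of these vectors approximate all others, and [M] is the largest delay among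
    them. The four errors are near optimal play, two passages to the net, and the distance between
    the vectors. *)
Lemma bounded_delay e : 0 < e -> exists M : nat, forall m n w,
  (forall t, 0 <= w t) -> total_weight n w = 1 ->
  exists2 m', (m' <= M)%N & family_value (m + n) (shift m w) fam <= family_value (m' +
    n) (shift m' w) fam + e.
Proof.
move=> e0; have e4 : 0 < e / 4 by rewrite divr_gt0.
have [L [rep net]] := belief_net q k0 i0 j0 g01 e4.
pose admissible (x : nat * (nat -> (nat -> R) -> R) * (L -> R)) :=
  [/\ reached x.1.1 fam x.1.2, forall l, 0 <= x.2 l <= 1 &
    forall n w, (forall t, 0 <= w t) -> total_weight n w = 1 ->
      `|x.1.2 n w - \sum_l x.2 l * value n w (belief_family (rep l))| <= e / 4].
have admissibleP m F : reached m fam F -> exists phi, admissible (m, F, phi).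
  move=> mF; have [phi [phi0 phi1 phiE]] := reached_net net sp0 mF.
  exists phi; split=> //= [l|n w w0 w1]; last by have := phiE n w w0; rewrite sp1 w1 !mul1r.
  by rewrite phi0 -sp1 -phi1 (bigD1 l) //= lerDl sumr_ge0.
(* The delay zero provides the inhabitant of [T] that [finite_net] asks for. *)
have [phi0 g0] := @admissibleP 0 (fun n w => family_value n w fam) (fun _ _ => erefl).
pose T := {x | admissible x}.
have e' : 0 < e / 4 / #|L|.+1%:R by rewrite divr_gt0.
have [[x xg] l|L2 [rep2 net2]] :=
  @finite_net R T L (fun x => (sval x).2) _ (exist _ _ g0) _ e'.
  by case: xg.
exists (\max_(l : L2) (sval (rep2 l)).1.1) => m n w w0 w1.
have [F mF FE] := reached_approx m n w0 sp0 e4.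
have [phi mg] := admissibleP _ _ mF.
have [l2 lE] := net2 (exist _ _ mg).
exists (sval (rep2 l2)).1.1; first exact: (leq_bigmax l2).
move: lE; case: (rep2 l2) => -[[m' F'] phi'] /= [m'F' /= phi'01 phi'E] /= lE.
apply: le_trans FE _.
apply: le_trans (_ : F' n w + e <= _); last first.
  by rewrite lerD2r; exact: reached_le.
case: mg => _ /= phi01 phiE.
have := phiE n w w0 w1; have := phi'E n w w0 w1.
have : `|\sum_l phi l * value n w (belief_family (rep l)) - \sum_l phi' l * value n w
  (belief_family (rep l))| <= e / 4.
  rewrite -sumrB; apply: le_trans (ler_norm_sum _ _ _) _.
  apply: le_trans (_ : \sum_(l in L) e / 4 / #|L|.+1%:R <= _).
    apply: ler_sum => l _; rewrite -mulrBl normrM -[leRHS]mulr1 ler_pM //.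
    have y0 : nonneg (belief_family (rep l)) by exact: belief_family_ge0.
    have := value_bounds q i0 j0 g01 n w0 y0; rewrite w1 (total_mass_belief_family k0) mulr1 =>
      /andP[u0 u1].
    by rewrite ger0_norm.
  have e1 : #|L|%:R / #|L|.+1%:R <= 1 :> R by rewrite ler_pdivrMr // mul1r ler_nat.
  rewrite sumr_const -[_ *+ _]mulr_natr.
  have -> : e / 4 / #|L|.+1%:R * #|L|%:R = e / 4 * (#|L|%:R / #|L|.+1%:R) by ring.
  by rewrite ler_piMr // ltW.
rewrite !ler_norml => /andP[a1 a2] /andP[b1 b2] /andP[c1 c2]; lra.
Qed.

(** As [w] is nonincreasing, [shift m w] dominates it from stage [m] on. Both have the same total,
    so the excess [left] weighs as much as the first [m] stages of [w]. *)
Lemma family_value_delay m n w : (forall t, 0 <= w t) -> (forall t, (n <= t)%N -> w t = 0) ->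
  (forall t, w t.+1 <= w t) ->
  family_value (m + n) (shift m w) fam <= family_value n w fam + m%:R * w 0.
Proof.
move=> w0 wn wdec.
have wmono t u : w (t + u)%N <= w t.
  by elim: u => [|u IH]; rewrite ?addn0 // addnS; exact: le_trans (wdec _) IH.
pose left t := shift m w t - w t + (if (t < m)%N then w t else 0).
have left0 t : 0 <= left t.
  rewrite /left shiftE; case: ltnP => mt; first by rewrite sub0r addNr.
  by rewrite addr0 subr_ge0 -{1}(subnK mt).
rewrite -(family_value_tail m w0 wn) [(n + m)%N]addnC.
apply: le_trans (_ : family_value (m + n) w fam + family_value (m + n) left
  fam <= _).
  by apply: family_value_sub => // t _; rewrite /left shiftE; case: ifP => _;
    rewrite ?sub0r ?addNr ?addr0 // addrC subrK.
rewrite lerD2l; apply: le_trans (family_value_le _ left0) _.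
have -> : total_weight (m + n) left = total_weight m w.
  rewrite /total_weight /left !big_split /= sumrN -/(total_weight _ _) total_weight_shift.
  have -> : \sum_(i < m + n) w i = total_weight n w.
    rewrite addnC /total_weight big_split_ord /= [X in _ + X]big1 ?addr0 // => t _.
    by rewrite wn ?leq_addr.
  by rewrite subrr add0r -big_mkcond /= -(@big_ord_widen _ _ _ m (m + n) w) ?leq_addr.
rewrite /total_weight mulr_natl -[X in _ *+ X]card_ord -sumr_const; apply: ler_sum => t _.
by rewrite -[nat_of_ord t]add0n.
Qed.

(* Averaging the [N] translates of [w] over a block of [N] stages gives, up to
   the first [k] stages of the block, the uniform weights on that block. *)
Lemma family_value_block m N k w M : (forall t, 0 <= w t) -> (forall t, (k <= t)%N -> w t = 0) ->
  total_weight k w = 1 -> (forall m, family_value (m + k) (shift m w) fam <= M) ->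
  family_value (m + N.+1) (shift m (fun=> N.+1%:R^-1)) fam <= M + k%:R / N.+1%:R.
Proof.
move=> w0 wk w1 HM; set c : R := N.+1%:R^-1.
have c0 : 0 <= c by rewrite invr_ge0.
pose w' t := \sum_(l < N.+1) c * shift (m + l) w t.
pose left t := shift m (fun t => if (t < k)%N then c else 0) t.
have shl l t : 0 <= shift (m + l) w t by exact: shift_ge0.
have left0 t : 0 <= left t by apply: shift_ge0 => u; case: ifP.
have w'0 t : 0 <= w' t by apply: sumr_ge0 => l _; rewrite mulr_ge0.
apply: le_trans (_ : family_value (m + N.+1) w' fam + family_value (m + N.+1) left
  fam <= _).
  apply: family_value_sub => // t tm; rewrite /left !shiftE; case: ltnP => mt;
    first by rewrite addr0.
  have [tk|kt] := ltnP; first by rewrite lerDr.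
  rewrite addr0 /w' -big_distrr /= -[leLHS]mulr1 ler_wpM2l // -w1.
  have tN : ((t - m).+1 <= N.+1)%N by rewrite ltnS leq_subLR -ltnS -addnS.
  apply: le_trans (_ : \sum_(l < (t - m).+1) shift (m + l) w t <= _); last first.
    rewrite (big_ord_widen _ (fun l => shift (m + l) w t) tN) big_mkcond /=.
    by apply: ler_sum => l _; case: ifP.
  (* At stage [t] the translates contribute values of [w]; reversing [l] lists them as [w 0], [w 1],
     and so on, with sum one since [k <= t - m]. *)
  rewrite (reindex_inj rev_ord_inj) /=.
  apply: le_trans (_ : \sum_(l < (t - m).+1) w l <= _); last first.
    apply: ler_sum => l _; rewrite shiftE subSS.
    have lt := ltn_ord l; rewrite ltnS in lt.
    have -> : (m + (t - m - l) = t - l)%N by lia.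
    by rewrite ltnNge leq_subr /= subKn // (leq_trans lt) ?leq_subr.
  rewrite /total_weight (big_ord_widen _ (fun l => w l) (leqW kt)) big_mkcond /=.
  by apply: ler_sum => l _; case: ifP.
apply: lerD; last first.
  apply: le_trans (family_value_le _ left0) _; rewrite /left total_weight_shift /total_weight.
  rewrite -[leLHS]/(total_weight N.+1 (fun t => if (t < k)%N then c else 0)).
  apply: le_trans (total_weight_le (m := k + N.+1) _ _) _ => [t|| ];
    [by case: ifP|exact: leq_addl|].
  rewrite total_weight_tail => [|t kt]; last by rewrite ltnNge kt.
  by rewrite /total_weight (eq_bigr (fun=> c)) => [|t _];
    rewrite ?ltn_ord // sumr_const card_ord mulr_natl.
rewrite /family_value; apply: le_trans (_ : \sum_b \sum_(l < N.+1) c * value (m + N.+1) (shift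
  (m + l) w) (fam b) <= _).
  by apply: ler_sum => b _; exact: (value_sum q i0 j0 g01 (m + N.+1) N.+1 (w := fun l => shift
    (m + l) w) shl c0 (sp0 b)).
rewrite exchange_big /=; apply: le_trans (_ : \sum_(l < N.+1) c * M <= _); last first.
  by rewrite sumr_const card_ord -[_ *+ _]mulr_natr mulrAC mulVf ?mul1r.
apply: ler_sum => l _; rewrite -big_distrr ler_wpM2l //=.
apply: le_trans (HM (m + l)%N); apply: ler_sum => b _.
(* A translate may reach beyond the block: a longer horizon can only raise the value, and stages of
   weight zero are then dropped. *)
apply: le_trans (value_horizon q i0 j0 g01 (m + N.+1) (l + k) _ (sp0 b)) _; first exact: shl.
have -> : (m + N.+1 + (l + k) = m + l + k + N.+1)%N by lia.
rewrite (value_tail q i0 j0 g01) // => t mt; rewrite shiftE ltnNge (leq_trans _ mt) ?leq_addr //=.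
by rewrite wk // leq_subRL // (leq_trans _ mt) ?leq_addr.
Qed.

Definition block_value n : R :=
  sup [set family_value (m + n.+1) (shift m (fun=> n.+1%:R^-1)) fam | m in [set:
    nat]]%classic.

Definition limit_value : R := inf [set block_value n | n in [set: nat]]%classic.

Lemma unif_ge0 n (t : nat) : 0 <= n.+1%:R^-1 :> R.
Proof. by rewrite invr_ge0. Qed.

Lemma block_value_has_sup n : has_sup
  [set family_value (m + n.+1) (shift m (fun=> n.+1%:R^-1)) fam | m in [set:
    nat]]%classic.
Proof.
split; first by exists (family_value (0 + n.+1) (shift 0 (fun=> n.+1%:R^-1)) fam);
  exists 0%N.
exists 1 => _ [m _ <-]; apply: le_trans (family_value_le _ (shift_ge0 m (unif_ge0 n))) _.
by rewrite total_weight_shift /total_weight sumr_const card_ord -[_ *+ _]mulr_natr mulVf.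
Qed.

Lemma family_value_le_block m n : family_value (m + n.+1) (shift m (fun=> n.+1%:R^-1))
  fam <= block_value n.
Proof. by apply: ub_le_sup; [case: (block_value_has_sup n)|exists m]. Qed.

Lemma block_value_ge0 n : 0 <= block_value n.
Proof. exact: le_trans (family_value_ge0 _ (shift_ge0 0 (unif_ge0 n))) (family_value_le_block 0
  n). Qed.

Lemma block_value_has_inf : has_inf [set block_value n | n in [set: nat]]%classic.
Proof.
by split; [exists (block_value 0); exists 0%N|exists 0 => _ [n _ <-]; exact: block_value_ge0].
Qed.

Lemma limit_value_approx e : 0 < e -> exists n, block_value n <= limit_value + e.
Proof.
move=> e0; have [_ [n _ <-] /ltW H] := inf_adherent e0 block_value_has_inf.
by exists n.
Qed.

(** [delta] is fixed before [w]: a delay of at most [M] stages then costs at most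
    [M * w 0 <= e / 3]. The block length is fixed after [w], large compared with its support [k], as
    is allowed because [limit_value] is an infimum over lengths. *)
Lemma limit_value_le_slow e : 0 < e -> exists2 delta, 0 < delta & forall k w,
  (forall t, 0 <= w t) -> (forall t, (k <= t)%N -> w t = 0) -> total_weight k w = 1 ->
  (forall t, w t.+1 <= w t) -> w 0 <= delta -> limit_value <= family_value k w fam + e.
Proof.
move=> e0; have e3 : 0 < e / 3 by rewrite divr_gt0.
have [M HM] := bounded_delay e3; exists (e / 3 / M.+1%:R); first by rewrite divr_gt0.
move=> k w w0 wk w1 wdec wd.
have Bd m : family_value (m + k) (shift m w) fam <= family_value k w fam + e
  / 3 + e / 3.
  have [m' m'M] := HM m k w w0 w1; move/le_trans; apply.
  rewrite lerD2r; apply: le_trans (family_value_delay m' w0 wk wdec) _; rewrite lerD2l.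
  apply: le_trans (_ : M.+1%:R * (e / 3 / M.+1%:R) <= _).
    by rewrite ler_pM // ler_nat leqW.
  by rewrite mulrC divfK.
pose n := Num.truncn (k%:R / (e / 3)).
have nk : k%:R / n.+1%:R <= e / 3.
  rewrite ler_pdivrMr // mulrC -ler_pdivrMr // ltW //.
  by case/andP: (truncn_itv (divr_ge0 (ler0n R k) (ltW e3))).
apply: le_trans (_ : block_value n <= _).
  by apply: ge_inf; [case: block_value_has_inf|exists n].
apply: ge_sup; first by case: (block_value_has_sup n).
move=> _ [m _ <-]; apply: le_trans (family_value_block m n w0 wk w1 Bd) _.
have -> : family_value k w fam + e = family_value k w fam + e / 3 + e / 3 + e
  / 3 by field.
by rewrite lerD2l.
Qed.

End Initial.
End Asymptotics.

(** * The repeated game against the controlled problem *)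

Section Payoff.
Variables (R : realType) (K I J C D : finType).
Variables (q : K -> I -> J -> fdist R (K * C * D)%type) (g : K -> I -> J -> R).
Hypothesis g01 : forall k i j, 0 <= g k i j <= 1.
Implicit Types (A B : finType) (w : nat -> R).
Notation next_family := (next_family q).
Notation stage_pay := (stage_pay g).
Notation plan1 := (seq (I * C) -> fdist R I).
Notation plan2 := (seq (J * D) -> fdist R J).

Definition after (X Y : Type) (f : seq X -> Y) (x : X) : seq X -> Y := fun h => f (x :: h).

Fixpoint state_payoff n (w : nat -> R) (k : K) (sigma : plan1) (tau : plan2) : R :=
  if n is n'.+1 then
    \sum_i \sum_j sigma [::] i * tau [::] j * (w 0 * g k i j +
      \sum_(x : K * C * D) q k i j x *
        state_payoff n' (w \o S) x.1.1 (after sigma (i, x.1.2)) (after tau (j, x.2)))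
  else 0.

Definition family_payoff n w A (s : A -> K -> R) (sigma : A -> plan1) (tau : plan2) : R :=
  \sum_al \sum_k s al k * state_payoff n w k (sigma al) tau.

(** Player 2's mixed action factors out because it depends on his own history alone; what remains is
    the payoff of the next families. *)
Lemma family_payoffS n w A (s : A -> K -> R) (sigma : A -> plan1) (tau : plan2) :
  family_payoff n.+1 w s sigma tau = \sum_j tau [::] j * (w 0 * stage_pay j s (fun al => sigma
    al [::]) +
    \sum_d family_payoff n (w \o S) (next_family j s (fun al => sigma al [::]) d)
      (fun t => after (sigma t.1.1) (t.1.2, t.2)) (after tau (j, d))).
Proof.
pose G al i j k : R := w 0 * g k i j + \sum_(x : K * C * D) q k i j x *
  state_payoff n (w \o S) x.1.1 (after (sigma al) (i, x.1.2)) (after tau (j, x.2)).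
transitivity (\sum_j tau [::] j * \sum_al \sum_i \sum_k
    sigma al [::] i * s al k * G al i j k).
  rewrite /family_payoff /=; under [RHS]eq_bigr do rewrite big_distrr /=.
  rewrite [RHS]exchange_big; apply: eq_bigr => al _ /=.
  under [LHS]eq_bigr do rewrite big_distrr /=.
  under [RHS]eq_bigr do rewrite big_distrr /=.
  rewrite [RHS]exchange_big [LHS]exchange_big /=; apply: eq_bigr => i _.
  under [LHS]eq_bigr do rewrite big_distrr /=.
  rewrite [LHS]exchange_big /=; apply: eq_bigr => j _.
  rewrite big_distrr /=; apply: eq_bigr => k _; rewrite /G; ring.
apply: eq_bigr => j _; congr (_ * _).
transitivity (w 0 * stage_pay j s (fun al => sigma al [::]) +
  \sum_al \sum_i \sum_k sigma al [::] i * s al k * \sum_(x : K * C * D) q k i j x *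
  state_payoff n (w \o S) x.1.1 (after (sigma al) (i, x.1.2)) (after tau (j, x.2))).
  rewrite /stage_pay big_distrr -big_split; apply: eq_bigr => al _ /=.
  rewrite big_distrr -big_split; apply: eq_bigr => i _ /=.
  rewrite big_distrr -big_split; apply: eq_bigr => k _ /=.
  by rewrite /G mulrDr; congr (_ + _); ring.
congr (_ + _); rewrite /family_payoff exchange_big [in RHS]exchange_big /= !sum_pair.
rewrite [LHS]exchange_big /=; apply: eq_bigr => al _; apply: eq_bigr => i _.
rewrite /next_family /=.
transitivity (\sum_(x : K * C * D) sigma al [::] i * step q i j x.1.2 x.2 (s al) x.1.1 *
  state_payoff n (w \o S) x.1.1 (after (sigma al) (i, x.1.2)) (after tau (j, x.2))).
  under eq_bigr do rewrite big_distrr /=.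
  rewrite exchange_big; apply: eq_bigr => -[[k' c] d] _ /=.
  rewrite /step big_distrr /= big_distrl /=; apply: eq_bigr => k _; ring.
rewrite !sum_pair /= [LHS]exchange_big; apply: eq_bigr => c _ /=.
by rewrite exchange_big.
Qed.

Lemma family_payoff0 w A (s : A -> K -> R) (sigma : A -> plan1) (tau : plan2) :
  family_payoff 0 w s sigma tau = 0.
Proof. by rewrite /family_payoff big1 // => al _; rewrite big1 // => k _; rewrite mulr0. Qed.

Lemma family_payoff_ext n w A (s : A -> K -> R) (sigma sigma' : A -> plan1) (tau : plan2) :
  (forall al k, s al k != 0 -> sigma al = sigma' al) ->
  family_payoff n w s sigma tau = family_payoff n w s sigma' tau.
Proof.
move=> H; apply: eq_bigr => al _; apply: eq_bigr => k _.
by have [->|/H ->//] := eqVneq (s al k) 0; rewrite !mul0r.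
Qed.

Lemma state_payoff_bounds n w k sigma tau : (forall t, 0 <= w t) -> 0 <= state_payoff n w k
  sigma tau <= total_weight n w.
Proof.
elim: n w k sigma tau => [|n IH] w k sigma tau w0 /=;
  first by rewrite /total_weight big_ord0 lexx.
have H i j : 0 <= w 0 * g k i j + \sum_(x : K * C * D) q k i j x *
    state_payoff n (w \o S) x.1.1 (after sigma (i, x.1.2)) (after tau (j, x.2)) <= total_weight
      n.+1 w.
  have /andP[g0 g1] := g01 k i j.
  apply/andP; split.
    rewrite addr_ge0 ?mulr_ge0 // sumr_ge0 // => x _.
    by rewrite mulr_ge0 ?fdist_ge0 //; case/andP: (IH (w \o S) x.1.1 (after sigma (i, x.1.2))
      (after tau (j, x.2)) (fun t => w0 t.+1)).
  rewrite total_weightS lerD ?ler_piMr // -[leRHS]mul1r -(fdist_sumT (q k i j)) big_distrl /=.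
  apply: ler_sum => x _; rewrite ler_wpM2l ?fdist_ge0 //.
  by case/andP: (IH (w \o S) x.1.1 (after sigma (i, x.1.2)) (after tau (j, x.2)) (fun t => w0
    t.+1)).
apply/andP; split.
  apply: sumr_ge0 => i _; apply: sumr_ge0 => j _.
  by rewrite !mulr_ge0 ?fdist_ge0 //; case/andP: (H i j).
rewrite -[leRHS]mul1r -(fdist_sumT (sigma [::])) big_distrl /=; apply: ler_sum => i _.
rewrite -[leRHS]mulr1 -(fdist_sumT (tau [::])) big_distrr /=; apply: ler_sum => j _.
rewrite -[leRHS]mulrA [total_weight _ _ * _]mulrC mulrA ler_wpM2l ?mulr_ge0 ?fdist_ge0 //.
by case/andP: (H i j).
Qed.

End Payoff.

(** * Posteriors of player 1 that ignore the private information of player 2 *)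

Section Good.
Variables (R : realType) (K I J C D : finType).
Variables (q : K -> I -> J -> fdist R (K * C * D)%type) (k0 : K).
Notation norm := (norm k0).
Notation next_family := (next_family q).
Notation step := (step q).
Notation event := (I * J * C * D)%type.

Definition run (x : K -> R) (l : seq event) : K -> R :=
  foldl (fun x (e : event) => step e.1.1.1 e.1.1.2 e.1.2 e.2 x) x l.

Definition obs1 (e : event) : I * C := (e.1.1.1, e.1.2).
Definition obs2 (e : event) : J * D := (e.1.1.2, e.2).

(* From the prior [x], the posterior of player 1 is not affected by what only
   player 2 observes. This is what (A1) says about the initial posteriors. *)
Definition posterior_stable (x : K -> R) : Prop := forall l l', map obs1 l = map obs1 l' ->
  0 < mass (run x l) -> 0 < mass (run x l') -> norm (run x l) = norm (run x l').

Lemma run_rcons x l (e : event) :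
  run x (rcons l e) = step e.1.1.1 e.1.1.2 e.1.2 e.2 (run x l).
Proof. by rewrite -cats1 /run foldl_cat. Qed.

Lemma run_ge0 x l : (forall k, 0 <= x k) -> forall k, 0 <= run x l k.
Proof. by elim: l x => [|e l IH] x x0 //=; apply: IH; exact: step_ge0. Qed.

Lemma run_scale c x x' l : (forall k, x k = c * x' k) ->
  forall k, run x l k = c * run x' l k.
Proof. by elim: l x x' => [|e l IH] x x' xx' //=; apply: IH; exact: step_scale. Qed.

Lemma posterior_stable_scale c x x' : (forall k, 0 <= x' k) -> 0 <= c ->
  (forall k, x k = c * x' k) -> posterior_stable x' -> posterior_stable x.
Proof.
move=> x0 c0 xx' gx l l' ll'.
have mE l'' : mass (run x l'') = c * mass (run x' l'').
  by rewrite -mass_scale; apply: eq_bigr => k _; exact: run_scale.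
have [cz|cn0] := eqVneq c 0; first by rewrite !mE cz mul0r ltxx.
have cp : 0 < c by rewrite lt0r cn0.
rewrite !mE !pmulr_rgt0 // => m m'.
rewrite (norm_scale k0 (run_ge0 l x0) cp (run_scale l xx')).
by rewrite (norm_scale k0 (run_ge0 l' x0) cp (run_scale l' xx')); exact: gx.
Qed.

Lemma posterior_stable_step i j c d x : posterior_stable x -> posterior_stable (step i j c d x).
Proof. by move=> gx l l' ll'; apply: (gx ((i, j, c, d) :: l) ((i, j, c, d) :: l'));
  rewrite /= ll'. Qed.

Lemma posterior_stable_norm x : (forall k, 0 <= x k) -> 0 < mass x -> posterior_stable x ->
  posterior_stable (norm x).
Proof.
move=> x0 m0; apply: (@posterior_stable_scale (mass x)^-1) => //; first by rewrite invr_ge0 ltW.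
by move=> k; rewrite normE // mulrC.
Qed.

Definition stable_family (A : finType) (s : A -> K -> R) : Prop := forall al, posterior_stable
  (s al).

Lemma stable_next j (A : finType) (s : A -> K -> R) (a : A -> fdist R I) d :
  nonneg s -> stable_family s -> stable_family (next_family j s a d).
Proof.
move=> s0 gs t; apply: (@posterior_stable_scale (a t.1.1 t.1.2)) (fun=> erefl) _ => //.
- by apply: step_ge0; exact: s0.
- exact: fdist_ge0.
- exact/posterior_stable_step/gs.
Qed.

Definition stable_belief (y : fdist R (fdist R K)) : Prop := forall x, x \in finsupp y ->
  posterior_stable x.

Lemma stable_canon (A : finType) (s : A -> K -> R) :
  nonneg s -> 0 < total_mass s -> stable_family s -> stable_belief (canon k0 s).
Proof.
move=> s0 t0 gs x /(canon_supp s0 t0)[al m0 ->].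
by apply: posterior_stable_norm; [exact: s0| |exact: gs].
Qed.

Lemma stable_belief_family y : stable_belief y -> stable_family (belief_family y).
Proof.
move=> gy x; apply: (@posterior_stable_scale (y (val x))) (fun=> erefl) _.
- exact: fdist_ge0.
- exact: fdist_ge0.
- exact/gy/fsvalP.
Qed.

(** Computed with any [(j, d)] of positive likelihood. For a stable [x] the choice is immaterial, so
    player 1 can use it without seeing [j] or [d]. *)
Definition update (x : fdist R K) i c : fdist R K :=
  if [pick jd : J * D | 0 < mass (step i jd.1 c jd.2 x)] is Some jd
  then norm (step i jd.1 c jd.2 x) else dret R k0.

Lemma updateE (x : fdist R K) i j c d : posterior_stable x -> 0 < mass (step i j c d x) ->
  update x i c = norm (step i j c d x).
Proof.
move=> gx m0; rewrite /update; case: pickP => [[j' d'] /= m'|/(_ (j, d))]; last by rewrite m0.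
exact: (gx [:: (i, j', c, d')] [:: (i, j, c, d)]).
Qed.

(** Besides the update rule, this returns the positivity facts under which [belief_known]
    applies. *)
Lemma norm_next j (A : finType) (s : A -> K -> R) (a : A -> fdist R I) d t :
  nonneg s -> stable_family s -> 0 < mass (next_family j s a d t) ->
  [/\ 0 < mass (s t.1.1), 0 < a t.1.1 t.1.2, 0 < mass (step t.1.2 j t.2 d (norm (s t.1.1))) &
    norm (next_family j s a d t) = update (norm (s t.1.1)) t.1.2 t.2].
Proof.
move=> s0 gs; rewrite mass_next.
have -> : mass (step t.1.2 j t.2 d (s t.1.1)) =
    mass (s t.1.1) * mass (step t.1.2 j t.2 d (norm (s t.1.1))).
  by rewrite -mass_scale; apply: eq_bigr => k _; rewrite (step_norm q k0).
have a0 := fdist_ge0 (a t.1.1) t.1.2.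
have m0 := mass_ge0 (s0 t.1.1).
have n0 k : 0 <= norm (s t.1.1) k by exact: fdist_ge0.
have st0 := mass_ge0 (step_ge0 q t.1.2 j t.2 d n0).
move=> H; have : a t.1.1 t.1.2 * (mass (s t.1.1) * mass (step t.1.2 j t.2 d (norm (s t.1.1))))
  != 0.
  by rewrite gt_eqF.
rewrite !mulf_eq0 !negb_or => /and3P[an0 mn0 stn0].
have ap : 0 < a t.1.1 t.1.2 by rewrite lt0r an0.
have mp : 0 < mass (s t.1.1) by rewrite lt0r mn0.
have stp : 0 < mass (step t.1.2 j t.2 d (norm (s t.1.1))) by rewrite lt0r stn0.
split=> //; rewrite (updateE (j := j) (d := d)) //; last exact: posterior_stable_norm.
apply: (@norm_scale _ _ _ (a t.1.1 t.1.2 * mass (s t.1.1))).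
- exact: step_ge0.
- by rewrite mulr_gt0.
- by move=> k; rewrite /next_family (step_norm q k0) // mulrA.
Qed.

End Good.

(** * Best replies of player 2 and guaranteed plans of player 1 *)

Section Control.
Variables (R : realType) (K I J C D : finType).
Variables (q : K -> I -> J -> fdist R (K * C * D)%type) (g : K -> I -> J -> R).
Variables (k0 : K) (i0 : I) (j0 : J).
Hypothesis g01 : forall k i j, 0 <= g k i j <= 1.
Implicit Types (A B : finType) (w : nat -> R).
Implicit Types (y : fdist R (fdist R K)) (a : fdist R K -> fdist R I).
Notation norm := (norm k0).
Notation equivalent := (equivalent k0).
Notation belief_action := (belief_action k0).
Notation canon := (canon k0).
Notation next_family := (next_family q).
Notation stage_pay := (stage_pay g).
Notation value := (value q g j0).
Notation family_payoff := (family_payoff q g).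
Notation step := (step q).
Notation stable_family := (stable_family q k0).
Notation stable_belief := (stable_belief q k0).
Notation plan1 := (seq (I * C) -> fdist R I).
Notation plan2 := (seq (J * D) -> fdist R J).
Notation next_belief j y a d := (next_family j (belief_family y) (belief_action (belief_family
  y) a) d).

(** This and the next hypothesis are (A3) and (A2b) at a stable belief: [f] tests the law of the
    next second order belief, and [F] is player 1's computation of it. *)
Hypothesis transition_indep : forall y a (f : fdist R (fdist R K) -> R) j, stable_belief y ->
  \sum_d total_mass (next_belief j y a d) * f (canon (next_belief j y a d)) =
  \sum_d total_mass (next_belief j0 y a d) * f (canon (next_belief j0 y a d)).

Hypothesis belief_known : forall y a, stable_belief y ->
  exists F : fdist R K -> I -> C -> fdist R (fdist R K), forall j d x i c,
    x \in finsupp y -> 0 < a x i -> 0 < mass (step i j c d x) ->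
    canon (next_belief j y a d) = F x i c.

Lemma equivalent_trans l l' A B (E : finType) (s : A -> K -> R) (s' : B -> K -> R) (s'' : E ->
  K -> R) :
  equivalent l s s' -> equivalent l' s' s'' -> equivalent (l * l') s s''.
Proof. by move=> h1 h2 h; rewrite h1 h2 mulrA. Qed.

Lemma average_next A (s : A -> K -> R) (sigma : A -> fdist R I) : nonneg s ->
  exists a, (forall j, stage_pay j s sigma = stage_pay j s (belief_action s a)) /\
    forall j d, equivalent 1 (next_family j s sigma d) (next_family j s (belief_action s a) d).
Proof.
move=> s0; have [a aE] := average_strategy k0 i0 sigma s0; exists a; split=> [j|j d h].
  by rewrite !(stage_pay_typed_pairing g k0) //; apply: eq_bigr.
by rewrite mul1r !pairing_next //; apply: eq_bigr.
Qed.

(** The sum is an integral over the next second order belief. Averaging [sigma] over equal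
    posteriors and passing to [canon s] brings it to the form covered by [transition_indep]. *)
Lemma sum_value_indep n w A (s : A -> K -> R) (sigma : A -> fdist R I) j :
  (forall t, 0 <= w t) -> nonneg s -> stable_family s ->
  \sum_d value n w (next_family j s sigma d) = \sum_d value n w (next_family j0 s sigma d).
Proof.
move=> w0 s0 gs; have [a [_ aE]] := average_next sigma s0; set y := canon s.
have H j' : \sum_d value n w (next_family j' s sigma d) = total_mass s *
    \sum_d total_mass (next_belief j' y a d) * value n w (belief_family (canon (next_belief j'
      y a d))).
  rewrite big_distrr; apply: eq_bigr => d _ /=.
  have y0 : nonneg (belief_family y) by exact: belief_family_ge0.
  have := equivalent_trans (aE j' d) (equivalent_nxt q j' d a s0 y0 (equivalent_canon k0 s0)).
  rewrite mul1r => E; have t0 := total_mass_ge0 s0.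
  rewrite (value_eqv q i0 j0 g01 n w0 (next_family_ge0 q j' sigma d s0) (next_family_ge0 q j' _
    d y0) t0 E).
  by rewrite -(value_canon q k0 i0 j0 g01 n w0 (next_family_ge0 q j' _ d y0)).
rewrite !H; have := total_mass_ge0 s0; rewrite le_eqVlt => /orP[/eqP <-|t0];
  first by rewrite !mul0r.
congr (_ * _); exact: (transition_indep a (fun z => value n w (belief_family z)) j
  (stable_canon s0 t0 gs)).
Qed.

(** Knowing [sigma], player 2 knows the family after each of his histories and minimises the stage
    payoff there. His signals then follow his own actions instead of [j0], which [sum_value_indep]
    allows. At weight zero nothing is at stake, and [tau0] is kept so that blocks can be glued. *)
Lemma best_reply n w A (s : A -> K -> R) (sigma : A -> plan1) (tau0 : plan2) :
  (forall t, 0 <= w t) -> nonneg s -> stable_family s ->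
  exists tau : plan2, (forall h, w (size h) = 0 -> tau h = tau0 h) /\
    family_payoff n w s sigma tau <= value n w s.
Proof.
elim: n w A s sigma tau0 => [|n IH] w A s sigma tau0 w0 s0 gs.
  by exists tau0; split=> //; rewrite family_payoff0.
pose a al := sigma al [::].
have Hjd (jd : J * D) := IH (w \o S) _ (next_family jd.1 s a jd.2)
  (fun t => after (sigma t.1.1) (t.1.2, t.2)) (after tau0 jd)
  (fun t => w0 t.+1) (next_family_ge0 q jd.1 a jd.2 s0) (stable_next s0 gs).
have [tau' tauE] := choice Hjd.
have [js jsE] := min_payP g j0 s a.
pose tau (h : seq (J * D)) := if h is jd :: h' then tau' jd h'
  else if w 0 == 0 then tau0 [::] else dret R js.
exists tau; split.
  case=> [|jd h] /= wh; first by rewrite wh eqxx.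
  by case: (tauE jd) => -> //.
rewrite family_payoffS -/a; apply: le_trans (action_value_le q i0 j0 g01 n a w0 s0).
have -> : action_value q g j0 n w s a = \sum_j tau [::] j * action_value q g j0 n w s a.
  by rewrite -big_distrl /= fdist_sumT mul1r.
have -> : \sum_j tau [::] j * (w 0 * stage_pay j s a + \sum_d family_payoff n (w \o S)
  (next_family j s a d)
      (fun t => after (sigma t.1.1) (t.1.2, t.2)) (after tau (j, d))) =
    w 0 * min_pay g j0 s a + \sum_j tau [::] j * \sum_d family_payoff n (w \o S) (next_family j
      s a d)
      (fun t => after (sigma t.1.1) (t.1.2, t.2)) (after tau (j, d)).
  under eq_bigr do rewrite mulrDr; rewrite big_split /=; congr (_ + _).
  under eq_bigr do rewrite mulrCA; rewrite -big_distrr /=.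
  have [-> |wn0] := eqVneq (w 0) 0; first by rewrite !mul0r.
  by rewrite -expectT expect_dret jsE.
have -> : \sum_j tau [::] j * action_value q g j0 n w s a = w 0 * min_pay g j0 s a +
    \sum_j tau [::] j * \sum_d value n (w \o S) (next_family j s a d).
  rewrite -[w 0 * _]mul1r -(fdist_sumT (tau [::])) big_distrl -big_split.
  apply: eq_bigr => j _ /=.
  by rewrite -mulrDr (sum_value_indep n a j (fun t => w0 t.+1) s0 gs).
rewrite lerD2l; apply: ler_sum => j _; rewrite ler_wpM2l ?fdist_ge0 //.
by apply: ler_sum => d _; case: (tauE (j, d)).
Qed.

(* That [rho] depends neither on [tau] nor on the weights [w'] makes it possible
   to treat many horizons at once. *)
Lemma guaranteed_plan n w e : (forall t, 0 <= w t) -> 0 < e ->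
  exists (sigma : fdist R (fdist R K) -> fdist R K -> plan1)
         (rho : fdist R (fdist R K) -> nat -> R),
  forall y, stable_belief y ->
  [/\ forall t, 0 <= rho y t <= 1,
      value n w (belief_family y) <= \sum_(t < n) w t * rho y t + e &
      forall A (s : A -> K -> R) tau w', nonneg s -> stable_family s ->
        (0 < total_mass s -> canon s = y) -> (forall t, 0 <= w' t) ->
        total_mass s * \sum_(t < n) w' t * rho y t <=
          family_payoff n w' s (fun al => sigma y (norm (s al))) tau].
Proof.
elim: n w e => [|n IH] w e w0 e0.
  exists (fun _ _ _ => dret R i0), (fun _ _ => 0) => y gy; split.
  - by move=> t; rewrite lexx ler01.
  - by rewrite big_ord0 add0r ltW.
  move=> A s tau w' _ _ _ _; by rewrite big_ord0 mulr0 family_payoff0.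
have e2 : 0 < e / 2 by rewrite divr_gt0.
have [sigma' [rho' H']] := IH (w \o S) (e / 2) (fun t => w0 t.+1) e2.
(* A near optimal rule can be taken to depend on the posterior only, which is what the strategy will
   know. *)
have aP y : exists a, value n.+1 w (belief_family y) <= action_value q g j0 n w (belief_family
  y) (belief_action (belief_family y) a) + e / 2.
  have y0 : nonneg (belief_family y) by exact: belief_family_ge0.
  have [b bE] := value_approx q i0 j0 g01 n w0 y0 e2.
  have [a [a1 a2]] := average_next b y0; exists a; apply: le_trans bE _.
  rewrite lerD2r /action_value; apply: eq_ler; congr (_ * _ + _).
    by rewrite (@min_pay_scale _ _ _ _ g j0 1 _ _ (belief_family y) (belief_family y) b
      (belief_action (belief_family y) a)) ?mul1r // => j; rewrite mul1r.
  apply: eq_bigr => d _.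
  rewrite -[RHS]mul1r; exact: (value_eqv q i0 j0 g01 n (fun t => w0 t.+1) (next_family_ge0 q j0
    b d y0) (next_family_ge0 q j0 _ d y0) ler01 (a2 j0 d)).
have [a aE] := choice aP.
have FP y : exists F : fdist R K -> I -> C -> fdist R (fdist R K), stable_belief y -> forall j
  d x i c,
    x \in finsupp y -> 0 < a y x i -> 0 < mass (step i j c d x) ->
    canon (next_belief j y (a y) d) = F x i c.
  case: (pselect (stable_belief y)) => gy; last by exists (fun _ _ _ => y).
  by have [F HF] := belief_known (a y) gy; exists F.
have [F FE] := choice FP.
(* Player 1 carries the pair [(y, x)]: [F] updates player 2's belief, [update] his own posterior. *)
pose sigma y x (h : seq (I * C)) := if h is (i, c) :: h'
  then sigma' (F y x i c) (update q k0 x i c) h' else a y x.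
(* The expected [min_pay] at stage [t] along the transitions under [j0]. *)
pose rho y t := if t is t'.+1
  then \sum_d total_mass (next_belief j0 y (a y) d) * rho' (canon (next_belief j0 y (a y) d)) t'
  else min_pay g j0 (belief_family y) (belief_action (belief_family y) (a y)).
exists sigma, rho => y gy.
have y0 : nonneg (belief_family y) by exact: belief_family_ge0.
have gl := stable_belief_family gy.
have nz j d : nonneg (next_belief j y (a y) d) by exact: next_family_ge0.
have gn j d : 0 < total_mass (next_belief j y (a y) d) -> stable_belief (canon (next_belief j y
  (a y) d)).
  by move=> t0; apply: stable_canon => //; exact: stable_next.
split.
- case=> [|t] /=; first by rewrite min_pay_ge0 //= -(total_mass_belief_family k0 y)
  min_pay_le_total_mass.
  have H d : 0 <= total_mass (next_belief j0 y (a y) d) * rho' (canon (next_belief j0 y (a y)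
    d)) t <=
      total_mass (next_belief j0 y (a y) d).
    have := total_mass_ge0 (nz j0 d); rewrite le_eqVlt => /orP[/eqP <-|t0];
      first by rewrite mul0r lexx.
    by have [/(_ t)/andP[r0 r1] _ _] := H' _ (gn _ _ t0); apply/andP; split;
      [rewrite mulr_ge0 // ltW|rewrite ler_piMr // ltW].
  apply/andP; split; first by apply: sumr_ge0 => d _; case/andP: (H d).
  rewrite -(total_mass_belief_family k0 y) -(sum_total_mass_next q j0 (belief_family y)
    (belief_action (belief_family y) (a y))).
  by apply: ler_sum => d _; case/andP: (H d).
- apply: le_trans (aE y) _; rewrite [in leRHS](splitr e) addrA lerD2r.
  rewrite big_ord_recl /= -addrA lerD2l.
  under [X in _ <= X + _]eq_bigr do rewrite /= big_distrr /=.
  rewrite exchange_big /= -[e / 2]mul1r -[X in _ <= _ + X * _](total_mass_belief_family k0 y)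
    -(sum_total_mass_next q j0 (belief_family y) (belief_action (belief_family y) (a y))).
  rewrite big_distrl -big_split; apply: ler_sum => d _ /=.
  rewrite (value_canon q k0 i0 j0 g01 n (fun t => w0 t.+1) (nz j0 d)).
  have := total_mass_ge0 (nz j0 d); rewrite le_eqVlt => /orP[/eqP <-|t0].
    by rewrite !mul0r big1 ?addr0 // => t _; rewrite mul0r mulr0.
  have [_ H _] := H' _ (gn _ _ t0).
  under eq_bigr do rewrite mulrCA.
  by rewrite -big_distrr -mulrDr ler_wpM2l // ltW.
move=> A s tau w' s0 gs sy w'0.
have ss : equivalent (total_mass s) s (belief_family y).
  have := total_mass_ge0 s0; rewrite le_eqVlt => /orP[/eqP/esym ts|/sy <-];
    last exact: equivalent_canon.
  by move=> h; rewrite pairing_total_mass0 // ts mul0r.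
have nE j d := equivalent_nxt q j d (a y) s0 y0 ss.
rewrite family_payoffS.
have sE : (fun al => sigma y (norm (s al)) [::]) = belief_action s (a y) by [].
rewrite sE big_ord_recl mulrDr /= mulrCA.
(* The continuation secured after [j]. By [QE] it does not depend on [j], so it can be averaged over
   player 2's mixed action. *)
pose Q j := \sum_d total_mass (next_family j s (belief_action s (a y)) d) *
  \sum_(t < n) w' t.+1 * rho' (canon (next_belief j y (a y) d)) t.
have QE j : Q j = total_mass s * \sum_(t < n) w' t.+1 *
    \sum_d total_mass (next_belief j0 y (a y) d) * rho' (canon (next_belief j0 y (a y) d)) t.
  rewrite /Q; under eq_bigr do rewrite (equivalent_total_mass (nE j _)) -mulrA.
  rewrite -big_distrr /=; congr (_ * _).
  rewrite (transition_indep (a y) (fun z => \sum_(t < n) w' t.+1 * rho' z t) j gy).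
  under eq_bigr do rewrite big_distrr /=.
  rewrite exchange_big; apply: eq_bigr => t _ /=; rewrite big_distrr /=.
  by apply: eq_bigr => d _; rewrite mulrCA.
set X := (X in _ + X <= _).
have -> : w' 0 * (total_mass s * min_pay g j0 (belief_family y) (belief_action (belief_family
  y) (a y))) + X =
    \sum_j tau [::] j * (w' 0 * (total_mass s * min_pay g j0 (belief_family y) (belief_action
      (belief_family y) (a y))) + Q j).
  by under eq_bigr do rewrite QE; rewrite -big_distrl /= fdist_sumT mul1r.
apply: ler_sum => j _; rewrite ler_wpM2l ?fdist_ge0 //; apply: lerD.
  rewrite ler_wpM2l // (equivalent_pay g j (a y) s0 y0 ss) ler_wpM2l ?total_mass_ge0 //.
  exact: min_pay_le.
apply: ler_sum => d _; set s' := next_family j s _ d.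
have s'0 : nonneg s' by exact: next_family_ge0.
have gs' : stable_family s' by exact: stable_next.
have := total_mass_ge0 s'0; rewrite le_eqVlt => /orP[/eqP ts'|ts'].
  rewrite -ts' mul0r; apply: sumr_ge0 => t _; apply: sumr_ge0 => k _.
  rewrite mulr_ge0 //; have := state_payoff_bounds q g01 n (w := w' \o S) k
    (after (sigma y (norm (s t.1.1))) (t.1.2, t.2)) (after tau (j, d)) (fun t => w'0 t.+1).
  by case/andP.
have cE : canon s' = canon (next_belief j y (a y) d) by exact: (canon_equivalent s'0 (nz j d)
  ts' (nE j d)).
have tp : 0 < total_mass (next_belief j y (a y) d).
  have := total_mass_ge0 (nz j d); rewrite le_eqVlt => /orP[/eqP E|//].
  by move: ts'; rewrite (equivalent_total_mass (nE j d)) -E mulr0 ltxx.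
have [_ _ H] := H' _ (gn _ _ tp).
apply: le_trans (H _ s' (after tau (j, d)) (w' \o S) s'0 gs' (fun=> cE) (fun t => w'0 t.+1)) _.
(* Types of weight zero may disagree; on the others, [FE] identifies the belief carried by the
   strategy with the true one. *)
apply: eq_ler; apply: family_payoff_ext => t k st0.
have mt : 0 < mass (s' t).
  rewrite lt0r mass_ge0 ?andbT; last exact: s'0.
  by apply: contra st0 => /eqP m0; rewrite (mass_eq0 (s'0 t) m0).
have [m1 a1 m2 nE'] := norm_next s0 gs mt.
apply/funext => h; rewrite nE' /after /sigma.
have xy : norm (s t.1.1) \in finsupp y.
  have tsp : 0 < total_mass s.
    rewrite /total_mass (bigD1 t.1.1) //= ltr_pwDl ?sumr_ge0 // => al _; exact: mass_ge0.
  rewrite -(sy tsp) finsupp_gt0 canonE // divr_gt0 //.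
  rewrite /pairing (bigD1 t.1.1) //= eqxx mulr1 ltr_pwDl ?sumr_ge0 // => al _.
  by rewrite mulr_ge0 ?mass_ge0 ?ler0n.
by rewrite (FE y gy j d _ _ _ xy a1 m2).
Qed.

End Control.

(** * One stage transitions under (A2b) and (A3) *)

Section OneShot.
Variables (R : realType) (K I J C D : finType).
Variables (q : K -> I -> J -> fdist R (K * C * D)%type).
Variables (k0 : K) (j0 : J).
Notation belief_action := (belief_action k0).
Notation canon := (canon k0).
Notation next_family := (next_family q).
Notation step := (step q).
Notation stable_belief := (stable_belief q k0).
Notation update := (update q k0).
Notation next_belief j y a d := (next_family j (belief_family y) (belief_action (belief_family
  y) a) d).
Notation play := (play K I J C D).
Notation init_law := (@init_law R K I J C D).

Lemma dmapE (T T' : choiceType) (P : fdist R T) (X : T -> T') u :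
  dmap X P u = expect P (fun t => (X t == u)%:R).
Proof. by rewrite -expect_eq0P expect_dmap. Qed.

Lemma sum_point (T : finType) (t0 : T) (F : T -> R) :
  \sum_t (t == t0)%:R * F t = F t0.
Proof.
rewrite (bigD1 t0) //= eqxx mul1r big1 ?addr0 // => t /negPf ->.
by rewrite mul0r.
Qed.

Section Law.
Variables (y : fdist R (fdist R K)) (a : fdist R K -> fdist R I) (b : fdist R J).

(** Initial signals are natural numbers, so a posterior is announced by its position in the support
    of [y]. *)
Definition code (x : fdist R K) : nat := index x (finsupp y).

Lemma codeK x : x \in finsupp y -> nth (dret R k0) (finsupp y) (code x) = x.
Proof. exact: nth_index. Qed.

Lemma code_inj x x' : x \in finsupp y -> x' \in finsupp y -> (code x == code x') = (x == x').
Proof.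
by move=> xy x'y; apply/eqP/eqP => [e|->//]; rewrite -(codeK xy) e codeK.
Qed.

(* Player 1 is told [x], drawn from [y], the state is drawn from [x], and
   player 2 is told nothing. *)
Definition prior : fdist R (start K) :=
  dbind y (fun x => dmap (fun k : K => (k, code x, 0%N) : start K) x).

Definition act : strategy1 R I C := fun h => a (nth (dret R k0) (finsupp y) h.1).

Definition one_shot_law : fdist R play := play_law q prior act (fun=> b) 1.

Lemma prior_supp t : t \in finsupp prior ->
  exists2 x, x \in finsupp y & exists k, t = (k, code x, 0%N).
Proof.
move=> /finsupp_dbindP[x xy /finsupp_dmap[k kx ->]].
by exists x => //; exists k.
Qed.

Lemma expect_init f : expect (init_law prior) f =
  expect y (fun x => \sum_k x k * f ((k, code x, 0%N), [::])).
Proof.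
rewrite /Defs.init_law expect_dmap expect_dbind; apply: eq_expect => x xy /=.
by rewrite expect_dmap expectT.
Qed.

(** Player 2's signal is constant, so both factorisations are trivial; for the same reason [y_1] is
    constant in [prior_A2a]. *)
Lemma prior_A1a : property_A1a prior.
Proof.
move=> k c d; rewrite -[prior (k, c, d)]expect_eq0P !dmapE.
have H0 t : t \in finsupp prior -> t.2 = 0%N by case/prior_supp => x _ [k' ->].
have -> : expect prior (fun t => (t == (k, c, d))%:R) =
    expect prior (fun t => (t.1 == (k, c))%:R) * (0 == d)%:R.
  rewrite -expect_mulr; apply: eq_expect => -[kc d'] /H0 /= ->.
  by rewrite xpair_eqE /=; case: (kc == _); case: (0%N == d); rewrite ?mul1r ?mul0r ?mulr0.
have -> : expect prior (fun t => ((t.1.2, t.2) == (c, d))%:R) =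
    expect prior (fun t => (t.1.2 == c)%:R) * (0 == d)%:R.
  rewrite -expect_mulr; apply: eq_expect => -[kc d'] /H0 /= ->.
  by rewrite xpair_eqE /=; case: (kc.2 == _); case: (0%N == d); rewrite ?mul1r ?mul0r ?mulr0.
ring.
Qed.

Lemma prior_A2a : property_A2a I J C D prior.
Proof.
exists (fun=> belief2 (init_law prior) ((k0, 0%N, 0%N), [::])) => w.
by move=> /finsupp_dmap[t /prior_supp[x _ [k ->]] ->]; apply: eq_cond_law.
Qed.

Lemma prior_belief1 x k : x \in finsupp y -> k \in finsupp x ->
  belief1 (init_law prior) ((k, code x, 0%N), [::]) = x.
Proof.
move=> xy kx; apply: cond_law_unique => [|u].
  apply/finsupp_dmap; exists (k, code x, 0%N) => //.
  by apply: finsupp_dbind xy _; apply/finsupp_dmap; exists k.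
rewrite !expect_init /= -expectZ; apply: eq_expect => x' x'y.
rewrite /hist1 /= /signal1 /= !xpair_eqE /= !andbT code_inj //.
case: eqP => [->|_].
  under eq_bigr do rewrite andbT mulrC.
  rewrite sum_point; under eq_bigr do rewrite mulr1.
  by rewrite fdist_sumT mulr1.
under eq_bigr do rewrite andbF mulr0.
under [in RHS]eq_bigr do rewrite mulr0.
by rewrite !big1 ?mulr0.
Qed.

Lemma act_reduced : @reduced R K I J C D prior act.
Proof.
exists (fun x _ _ => a x) => w /finsupp_dmap[t /finsupp_dbindP[x xy /finsupp_dmap[k kx ->]] ->] h.
by rewrite prior_belief1 // /act /= codeK.
Qed.

Lemma one_shot_law_supp w : w \in finsupp one_shot_law -> exists x k i j t,
  [/\ x \in finsupp y, k \in finsupp x, i \in finsupp (a x), j \in finsupp b &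
      t \in finsupp (q k i j)] /\ w = ((k, code x, 0%N), [:: ((i, j), t)]).
Proof.
move=> /finsupp_dbindP[_ /finsupp_dmap[_ /finsupp_dbindP[x xy /finsupp_dmap[k kx ->]] ->]].
move=> /finsupp_dbindP[i ia /finsupp_dbindP[j jb /finsupp_dmap[t tq ->]]].
by exists x, k, i, j, t; split=> //; split=> //; rewrite /act /= codeK in ia.
Qed.

Lemma one_shot_law_suppI x k i j t : x \in finsupp y -> k \in finsupp x ->
  i \in finsupp (a x) -> j \in finsupp b -> t \in finsupp (q k i j) ->
  ((k, code x, 0%N), [:: ((i, j), t)]) \in finsupp one_shot_law.
Proof.
move=> xy kx ia jb tq; apply: (@finsupp_dbind _ _ _ _ _ ((k, code x, 0%N), [::])).
  apply/finsupp_dmap; exists (k, code x, 0%N) => //.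
  by apply: finsupp_dbind xy _; apply/finsupp_dmap; exists k.
apply: (@finsupp_dbind _ _ _ _ _ i); first by rewrite /act /= codeK.
by apply: finsupp_dbind jb _; apply/finsupp_dmap; exists t.
Qed.

Lemma expect_one_shot_law f (F : fdist R K -> I -> J -> K -> C -> D -> R) :
  (forall x k i j k' c d, x \in finsupp y ->
    f ((k, code x, 0%N), [:: ((i, j), (k', c, d))]) = F x i j k' c d) ->
  expect one_shot_law f = expect y (fun x => \sum_i \sum_j \sum_c \sum_d \sum_k'
    a x i * b j * step i j c d x k' * F x i j k' c d).
Proof.
move=> fF; rewrite expect_dbind expect_init; apply: eq_expect => x xy.
transitivity (\sum_k \sum_i \sum_j \sum_t x k * a x i * b j * q k i j t *
    F x i j t.1.1 t.1.2 t.2).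
  apply: eq_bigr => k _; rewrite expect_dbind expectT big_distrr; apply: eq_bigr => i _ /=.
  rewrite expect_dbind expectT !big_distrr; apply: eq_bigr => j _ /=.
  rewrite expect_dmap expectT !big_distrr; apply: eq_bigr => -[[k' c] d] _ /=.
  by rewrite fF // /act /= codeK //; ring.
rewrite exchange_big; apply: eq_bigr => i _; rewrite exchange_big; apply: eq_bigr => j _ /=.
rewrite exchange_big !sum_pair [LHS]exchange_big; apply: eq_bigr => c _ /=.
rewrite exchange_big; apply: eq_bigr => d _; apply: eq_bigr => k' _ /=.
by rewrite /step big_distrr /= big_distrl /=; apply: eq_bigr => k _; ring.
Qed.

Hypothesis gy : stable_belief y.

Lemma step_update (x : fdist R K) i j c d u : x \in finsupp y ->
  step i j c d x u = mass (step i j c d x) * update x i c u.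
Proof.
move=> xy; have s0 := step_ge0 q i j c d (fdist_ge0 x).
rewrite {1}(mass_norm k0 u s0); have := mass_ge0 s0; rewrite le_eqVlt.
move=> /orP[/eqP <-|m0]; first by rewrite !mul0r.
by rewrite (updateE (gy xy) m0).
Qed.

(** By stability the vectors [step i j c d x], for all [j] and [d], are multiples of one posterior,
    so summing over what player 1 does not see leaves it unchanged. *)
Lemma one_shot_law_belief1 x k i j t : x \in finsupp y -> k \in finsupp x ->
  i \in finsupp (a x) -> j \in finsupp b -> t \in finsupp (q k i j) ->
  belief1 one_shot_law ((k, code x, 0%N), [:: ((i, j), t)]) = update x i t.1.2.
Proof.
move=> xy kx ia jb tq; apply: cond_law_unique => [|u]; first exact: one_shot_law_suppI.
rewrite (expect_one_shot_law (F := fun x' i' j' k' c' d' =>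
   (k' == u)%:R * ((x' == x) && (i' == i) && (c' == t.1.2))%:R)); last first.
  move=> x' k1 i' j' k' c' d' x'y; rewrite /last_state /states /hist1 /signal1 /=.
  by rewrite !xpair_eqE eqseq_cons xpair_eqE code_inj // andbT -natrM mulnb -!andbA.
rewrite (expect_one_shot_law (F := fun x' i' j' k' c' d' =>
   ((x' == x) && (i' == i) && (c' == t.1.2))%:R)); last first.
  move=> x' k1 i' j' k' c' d' x'y; rewrite /last_state /states /hist1 /signal1 /=.
  by rewrite !xpair_eqE eqseq_cons xpair_eqE code_inj // andbT andbA.
rewrite -expectZ; apply: eq_expect => x' x'y.
do 4!(rewrite big_distrr; apply: eq_bigr => ? _ /=).
under eq_bigr do rewrite mulrCA -mulrA.
rewrite sum_point -!mulrA.
under [in RHS]eq_bigr do rewrite -!mulrA.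
set e := (_ && _); case: (boolP e) => [/andP[/andP[/eqP -> /eqP ->] /eqP ->]|_]; last first.
  by rewrite big1 ?mulr0 // => ? _; rewrite !mulr0.
rewrite step_update //; under eq_bigr do rewrite mulr1 mulrA.
by rewrite -big_distrr /= mulr1 -/(mass _); ring.
Qed.

Lemma pairing_next_belief j d h : pairing k0 (next_belief j y a d) h =
  expect y (fun x => \sum_i \sum_c a x i * mass (step i j c d x) * h (update x i c)).
Proof.
rewrite pairing_next; last exact: belief_family_ge0.
under eq_bigr do rewrite typed_pairing_belief_action pairing_belief_family.
rewrite -expect_sum; apply: eq_expect => x xy; apply: eq_bigr => i _.
rewrite big_distrr; apply: eq_bigr => c _ /=; rewrite -mulrA.
have := mass_ge0 (step_ge0 q i j c d (fdist_ge0 x)); rewrite le_eqVlt.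
move=> /orP[/eqP <-|m0]; first by rewrite !mul0r.
by rewrite (updateE (gy xy) m0).
Qed.

Lemma expect_one_shot_law_JD f (F : J -> D -> fdist R K -> R) :
  (forall x k i j k' c d, x \in finsupp y ->
    f ((k, code x, 0%N), [:: ((i, j), (k', c, d))]) = F j d (update x i c)) ->
  expect one_shot_law f = \sum_j b j * \sum_d pairing k0 (next_belief j y a d) (F j d).
Proof.
move=> fF; rewrite (expect_one_shot_law (F := fun x i j _ c d => F j d (update x i c))) //.
under [RHS]eq_bigr do (under eq_bigr do rewrite pairing_next_belief).
under [RHS]eq_bigr do rewrite -expect_sum -expectZ.
rewrite -expect_sum; apply: eq_expect => x xy.
rewrite exchange_big; apply: eq_bigr => j _ /=.
under [LHS]eq_bigr do rewrite exchange_big /=.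
rewrite [LHS]exchange_big big_distrr; apply: eq_bigr => d _ /=.
rewrite big_distrr; apply: eq_bigr => i _ /=.
rewrite big_distrr; apply: eq_bigr => c _ /=.
by rewrite -big_distrl -big_distrr /= -/(mass _); ring.
Qed.

(** On the event that player 2 saw [(j, t.2)], the law of player 1's posterior is given by [pairing]
    times [b j], a factor that disappears on conditioning. *)
Lemma one_shot_law_belief2 x k i j t : x \in finsupp y -> k \in finsupp x ->
  i \in finsupp (a x) -> j \in finsupp b -> t \in finsupp (q k i j) ->
  belief2 one_shot_law ((k, code x, 0%N), [:: ((i, j), t)]) = canon (next_belief j y a t.2).
Proof.
move=> xy kx ia jb tq; set w := (_, [:: _]).
have wP : w \in finsupp one_shot_law by exact: one_shot_law_suppI.
have n0 : nonneg (next_belief j y a t.2) by apply: next_family_ge0; exact: belief_family_ge0.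
have E h : expect one_shot_law (fun w' => (hist2 w' == hist2 w)%:R * h (belief1 one_shot_law
  w')) =
    b j * pairing k0 (next_belief j y a t.2) h.
  pose up (w' : play) := update (nth (dret R k0) (finsupp y) (signal1 w'))
    (head i [seq s.1.1 | s <- w'.2]) (head t.1.2 [seq s.2.1.2 | s <- w'.2]).
  rewrite (@eq_expect _ _ _ _ (fun w' => (hist2 w' == hist2 w)%:R * h (up w'))); last first.
    move=> _ /one_shot_law_supp[x' [k' [i' [j' [t' [[x'y k'x i'a j'b t'q] ->]]]]]].
    by rewrite one_shot_law_belief1 // /up /signal1 /= codeK.
  rewrite (expect_one_shot_law_JD (F := fun j' d' z => (j' == j)%:R * ((d' == t.2)%:R * h z)));
    last first.
    move=> x' k1 i' j' k' c' d' x'y; rewrite /up /hist2 /signal1 /signal2 /= codeK //.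
    by rewrite xpair_eqE /= eqseq_cons andbT xpair_eqE mulrA -natrM mulnb.
  have pZ j' d' : pairing k0 (next_belief j' y a d') (fun z => (j' == j)%:R * ((d' == t.2)%:R *
    h z)) =
      (j' == j)%:R * ((d' == t.2)%:R * pairing k0 (next_belief j' y a d') h).
    by rewrite /pairing !big_distrr; apply: eq_bigr => al _ /=; ring.
  under eq_bigr do (under eq_bigr do rewrite pZ).
  under eq_bigr do rewrite -big_distrr /= sum_point mulrCA.
  by rewrite sum_point.
have pE : expect one_shot_law (fun w' => (hist2 w' == hist2 w)%:R) = b j * total_mass
  (next_belief j y a t.2).
  rewrite (total_mass_pairing k0) -E; apply: eq_expect => w' _.
  by rewrite mulr1.
have t0 : 0 < total_mass (next_belief j y a t.2).
  have := cond_prob_gt0 (@hist2 K I J C D) wP; rewrite pE.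
  by rewrite pmulr_rgt0 // -finsupp_gt0.
apply: cond_law_unique => // z; rewrite pE canonE //.
transitivity (b j * pairing k0 (next_belief j y a t.2) (fun z' => (z' == z)%:R)).
  by rewrite -E; apply: eq_expect => w' _; rewrite mulrC -natrM mulnb.
by rewrite mulrCA divfK ?gt_eqF.
Qed.

Lemma expect_belief_law f : expect (belief_law one_shot_law) f =
  \sum_j b j * \sum_d total_mass (next_belief j y a d) * f (canon (next_belief j y a d)).
Proof.
pose F (w' : play) := f (if w' is (_, [:: ((_, j), (_, d))]) then canon (next_belief j y a d)
  else dret R (dret R k0)).
rewrite expect_dmap (@eq_expect _ _ _ _ (fun w' : play => F w')); last first.
  move=> _ /one_shot_law_supp[x' [k' [i' [j' [t' [[x'y k'x i'a j'b t'q] ->]]]]]] /=.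
  by rewrite one_shot_law_belief2 // /F; case: t' {t'q} => -[].
rewrite (expect_one_shot_law_JD (F := fun j d _ => f (canon (next_belief j y a d)))) //.
by apply: eq_bigr => j _; congr (_ * _); apply: eq_bigr => d _;
  rewrite (total_mass_pairing k0) /pairing big_distrl; apply: eq_bigr => al _; rewrite /= mulr1.
Qed.

End Law.

Hypotheses (hA2b : assumption_A2b q) (hA3 : assumption_A3 q).

Lemma transition_indep y (a : fdist R K -> fdist R I) (f : fdist R (fdist R K) -> R) j :
  stable_belief y ->
  \sum_d total_mass (next_belief j y a d) * f (canon (next_belief j y a d)) =
  \sum_d total_mass (next_belief j0 y a d) * f (canon (next_belief j0 y a d)).
Proof.
move=> gy; have := hA3 (@prior_A1a y) (@prior_A2a y) (act_reduced y a)
  (fun=> dret R j) (fun=> dret R j0).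
move=> /(congr1 (fun P => expect P f)); rewrite !expect_belief_law //.
by rewrite -!expectT !expect_dret.
Qed.

(** Player 2 plays every action with positive probability, so that the single map [f2] given by
    (A2b) is valid for all [j] at once. *)
Lemma belief_known y (a : fdist R K -> fdist R I) : stable_belief y ->
  exists F : fdist R K -> I -> C -> fdist R (fdist R K), forall j d x i c,
    x \in finsupp y -> 0 < a x i -> 0 < mass (step i j c d x) ->
    canon (next_belief j y a d) = F x i c.
Proof.
move=> gy; have [f2 f2E] := hA2b (fun=> uniform_fdist R j0) (@prior_A2a y) (act_reduced y a).
exists (fun x i c => f2 (code y x) i c) => j d x i c xy ia m0.
have [k [k' [kx tq]]] : exists k k', k \in finsupp x /\ (k', c, d) \in finsupp (q k i j).
  apply: contrapT => H; move: m0; rewrite /mass big1 ?ltxx // => k' _.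
  rewrite /step big1 // => k _; apply/eqP; rewrite mulf_eq0.
  apply: contrapT => /negP; rewrite negb_or -!mem_finsupp => /andP[kx tq].
  by apply: H; exists k, k'.
rewrite -finsupp_gt0 in ia.
have jb : j \in finsupp (uniform_fdist R j0) by rewrite finsupp_gt0 uniform_fdist_gt0.
have wP := one_shot_law_suppI xy kx ia jb tq.
by rewrite -(one_shot_law_belief2 gy xy kx ia jb tq) (f2E _ wP (code y x) i c).
Qed.

End OneShot.

(** * Plays, posteriors and payoffs *)

Section Bridge.
Variables (R : realType) (K I J C D : finType).
Variables (q : K -> I -> J -> fdist R (K * C * D)%type) (g : K -> I -> J -> R).
Variables (p : fdist R (start K)) (k0 : K) (i0 : I) (j0 : J).
Hypothesis g01 : forall k i j, 0 <= g k i j <= 1.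
Notation norm := (norm k0).
Notation canon := (canon k0).
Notation play := (play K I J C D).
Notation play_law := (play_law q).
Notation state_payoff := (state_payoff q g).
Notation family_payoff := (family_payoff q g).
Notation run := (run q).
Notation obs1 := (@obs1 I J C D).
Notation obs2 := (@obs2 I J C D).
Notation init_law := (@init_law R K I J C D).

(** Strictly above all initial signals of positive probability, so that ['I_bound] can index
    them. *)
Definition bound : nat := (\max_(t <- finsupp p) maxn t.1.2 t.2).+1.

Definition start_mass (d c : nat) : K -> R := fun k => p (k, c, d).

Definition start_family (d c : 'I_bound) : K -> R := start_mass d c.

Lemma start_family_ge0 d : nonneg (start_family d).
Proof. by move=> c k; exact: fdist_ge0. Qed.

Lemma expect_start f : expect p f =
  \sum_(d < bound) \sum_(c < bound) \sum_k p (k, val c, val d) * f (k, val c, val d).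
Proof.
transitivity (\sum_(t : K * 'I_bound * 'I_bound)
    p (t.1.1, val t.1.2, val t.2) * f (t.1.1, val t.1.2, val t.2)).
  pose S : {fset start K} := [fset (t.1.1, val t.1.2, val t.2) | t in {: K * 'I_bound *
    'I_bound}].
  rewrite (@expect_sub _ _ _ S).
    rewrite /S big_imfset //=; last first.
      by move=> [[k c] d] [[k' c'] d'] _ _ /= [-> /val_inj -> /val_inj ->].
    by rewrite big_enum.
  apply/fsubsetP => -[[k c] d] tp.
  have : (maxn c d < bound)%N by rewrite /bound ltnS;
    exact: (@leq_bigmax_seq _ _ xpredT (fun t : start K => maxn t.1.2 t.2) _ tp isT).
  rewrite gtn_max => /andP[cb db].
  by apply/imfsetP; exists (k, Ordinal cb, Ordinal db).
rewrite !sum_pair /= [LHS]exchange_big /=.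
under eq_bigr do rewrite exchange_big /=.
rewrite exchange_big [RHS]exchange_big /=.
rewrite [in RHS]exchange_big /=.
by [].
Qed.

Lemma sum_total_mass_start : \sum_d total_mass (start_family d) = 1.
Proof.
rewrite -(expect_cst p 1) expect_start; apply: eq_bigr => d _; apply: eq_bigr => c _.
by apply: eq_bigr => k _; rewrite mulr1.
Qed.

Lemma hist1_rcons (w : play) i j t :
  hist1 (w.1, rcons w.2 ((i, j), t)) = ((hist1 w).1, rcons (hist1 w).2 (i, t.1.2)).
Proof. by rewrite /hist1 /= map_rcons. Qed.

Lemma hist2_rcons (w : play) i j t :
  hist2 (w.1, rcons w.2 ((i, j), t)) = ((hist2 w).1, rcons (hist2 w).2 (j, t.2)).
Proof. by rewrite /hist2 /= map_rcons. Qed.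

Lemma states_rcons (w : play) (e : (I * J) * (K * C * D)) :
  states (w.1, rcons w.2 e) = rcons (states w) e.2.1.1.
Proof. by rewrite /states /= map_rcons. Qed.

Lemma last_state_rcons (w : play) (e : (I * J) * (K * C * D)) :
  last_state (w.1, rcons w.2 e) = e.2.1.1.
Proof. by rewrite /last_state states_rcons last_rcons. Qed.

Lemma zip_rconsl (S T : Type) (s : seq S) (t : seq T) a :
  size s = size t -> zip (rcons s a) t = zip s t.
Proof. by elim: s t => [|x s IH] [|y t] //= [/IH ->]. Qed.

Lemma total_payoff_rcons (w : play) i j t :
  total_payoff g (w.1, rcons w.2 ((i, j), t)) = total_payoff g w + g (last_state w) i j.
Proof.
have [b [bz sb]] : exists b, states w = rcons b (last_state w) /\ size b = size w.2.
  exists (belast w.1.1.1 [seq s.2.1.1 | s <- w.2]).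
  by rewrite size_belast size_map -lastI.
rewrite /total_payoff states_rcons bz -[(w.1, _).2]/(rcons w.2 (i, j, t)).
rewrite [zip (rcons b _) w.2]zip_rconsl // zip_rconsl ?size_rcons ?sb //.
by rewrite zip_rcons // big_rcons.
Qed.

Section Play.
Variables (sigma : strategy1 R I C) (tau : strategy2 R J D).

Lemma expect_next_law (w : play) f : expect (next_law q sigma tau w) f =
  \sum_i \sum_j sigma (hist1 w) i * tau (hist2 w) j *
    \sum_t q (last_state w) i j t * f (w.1, rcons w.2 ((i, j), t)).
Proof.
rewrite expect_dbind expectT; apply: eq_bigr => i _.
rewrite expect_dbind expectT big_distrr; apply: eq_bigr => j _ /=.
by rewrite expect_dmap expectT mulrA.
Qed.

(** [play_law] extends plays at the end while [state_payoff] recurses from the start; taking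
    expectations backwards reconciles the two. *)
Lemma expect_play_law n f : expect (play_law p sigma tau n) f =
  expect p (fun t => iter n (fun f w => expect (next_law q sigma tau w) f) f (t, [::])).
Proof.
elim: n f => [|n IH] f; first by rewrite /= expect_dmap.
by rewrite iterSr -IH /= expect_dbind.
Qed.

Lemma iter_payoff n (w : play) :
  iter n (fun f w => expect (next_law q sigma tau w) f) (total_payoff g) w =
  total_payoff g w + state_payoff n (fun=> 1) (last_state w)
    (fun h => sigma ((hist1 w).1, (hist1 w).2 ++ h))
    (fun h => tau ((hist2 w).1, (hist2 w).2 ++ h)).
Proof.
elim: n w => [|n IH] w; first by rewrite /= addr0.
rewrite iterS expect_next_law /= !cats0.
have -> : total_payoff g w = \sum_i \sum_j sigma (hist1 w) i * tau (hist2 w) j *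
    \sum_t q (last_state w) i j t * total_payoff g w.
  under eq_bigr do (under eq_bigr do rewrite -big_distrl /= fdist_sumT mul1r).
  under eq_bigr do rewrite -big_distrl -big_distrr /= fdist_sumT mulr1.
  by rewrite -big_distrl /= fdist_sumT mul1r.
rewrite -big_split; apply: eq_bigr => i _; rewrite -big_split; apply: eq_bigr => j _ /=.
rewrite -[(signal1 w, _)]/(hist1 w) -[(signal2 w, _)]/(hist2 w) -mulrDr; congr (_ * _).
have -> : 1 * g (last_state w) i j = \sum_t q (last_state w) i j t * g (last_state w) i j.
  by rewrite -big_distrl /= fdist_sumT.
rewrite -!big_split; apply: eq_bigr => t _; rewrite IH total_payoff_rcons last_state_rcons.
have -> : (fun h => sigma ((hist1 (w.1, rcons w.2 ((i, j), t))).1,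
      (hist1 (w.1, rcons w.2 ((i, j), t))).2 ++ h)) =
    after (fun h => sigma ((hist1 w).1, (hist1 w).2 ++ h)) (i, t.1.2).
  by apply/funext => h; rewrite hist1_rcons /after -cat_rcons.
have -> : (fun h => tau ((hist2 (w.1, rcons w.2 ((i, j), t))).1,
      (hist2 (w.1, rcons w.2 ((i, j), t))).2 ++ h)) =
    after (fun h => tau ((hist2 w).1, (hist2 w).2 ++ h)) (j, t.2).
  by apply/funext => h; rewrite hist2_rcons /after -cat_rcons.
by rewrite /= -!mulrDr addrA.
Qed.

Definition payoff n w : R := \sum_d family_payoff n w (start_family d)
  (fun (c : 'I_bound) h => sigma (val c, h)) (fun h => tau (val d, h)).

Lemma gammaE n : gamma q g n p sigma tau = n%:R^-1 * payoff n (fun=> 1).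
Proof.
rewrite /gamma expectZ expect_play_law; congr (_ * _).
rewrite expect_start; apply: eq_bigr => d _; apply: eq_bigr => c _.
apply: eq_bigr => k _; rewrite iter_payoff; congr (_ * _).
by rewrite /total_payoff /= big_nil add0r.
Qed.

End Play.

Section Posteriors.
Hypothesis hA1 : assumption_A1 q p.

Definition uniform1 : fdist R I := uniform_fdist R i0.
Definition uniform2 : fdist R J := uniform_fdist R j0.

Lemma uniform1_gt0 i : 0 < uniform1 i.
Proof. exact: uniform_fdist_gt0. Qed.

Lemma uniform2_gt0 j : 0 < uniform2 j.
Proof. exact: uniform_fdist_gt0. Qed.

Notation ulaw n := (play_law p (fun=> uniform1) (fun=> uniform2) n).

Definition weight (l : seq (I * J * C * D)) : R :=
  \prod_(e <- l) (uniform1 e.1.1.1 * uniform2 e.1.1.2).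

Lemma weight_gt0 l : 0 < weight l.
Proof.
by rewrite /weight big_seq; apply: prodr_gt0 => e _; rewrite mulr_gt0 ?uniform1_gt0 ?uniform2_gt0.
Qed.

(** Under independent uniform actions, probabilities factor into the positive probability [weight]
    of the actions and the likelihood [run] of state and signals. *)
Lemma joint_law c d l k :
  expect (ulaw (size l)) (fun w => ((last_state w == k) &&
    ((hist1 w, hist2 w) == ((c, map obs1 l), (d, map obs2 l))))%:R) =
  weight l * run (start_mass d c) l k.
Proof.
elim/last_ind: l k => [|l [[[i j] c'] d'] IH] k.
  rewrite /= expect_dmap /weight big_nil mul1r -[RHS]expect_eq0P;
    apply: eq_expect => -[[k' c1] d1] _ /=.
  by rewrite /last_state /hist1 /hist2 /signal1 /signal2 /= !xpair_eqE !andbT andbA.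
rewrite size_rcons /= expect_dbind /weight big_rcons /= -/(weight l).
pose B (w : play) := ((hist1 w, hist2 w) == ((c, map obs1 l), (d, map obs2 l)))%:R : R.
rewrite (@eq_expect _ _ _ _ (fun w => uniform1 i * uniform2 j *
    (\sum_k' (last_state w == k')%:R * B w * q k' i j (k, c', d')))); last first.
  move=> w _; rewrite expect_next_law.
  rewrite (eq_bigr (fun i' => (i' == i)%:R * (\sum_j' (j' == j)%:R * (uniform1 i' * uniform2 j' *
      \sum_t (t == (k, c', d'))%:R * (q (last_state w) i' j' t * B w))))); last first.
    move=> i' _; rewrite big_distrr; apply: eq_bigr => j' _ /=.
    rewrite !mulrA ![_ * \sum_t _]big_distrr; apply: eq_bigr => -[[k1 c1] d1] _ /=.
    rewrite last_state_rcons hist1_rcons hist2_rcons /B !map_rcons !xpair_eqE !eqseq_rcons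
      !xpair_eqE /=.
    case: (k1 == k); case: (i' == i); case: (c1 == c'); case: (j' == j); case: (d1 == d');
      rewrite ?andbF ?andbT ?mulr0 ?mul0r ?mulr1 ?mul1r ?andbA //=; ring.
  rewrite sum_point sum_point sum_point; congr (_ * _).
  rewrite (eq_bigr (fun k' => (k' == last_state w)%:R * (B w * q k' i j (k, c', d')))).
    by rewrite sum_point mulrC.
  by move=> k' _; rewrite eq_sym mulrA.
rewrite expectZ expect_sum [weight l * _]mulrC -!mulrA; congr (_ * (_ * _)).
rewrite run_rcons /step big_distrr.
apply: eq_bigr => k' _ /=; rewrite expect_mulr mulrA; congr (_ * _).
by rewrite -IH; apply: eq_expect => w _; rewrite /B -natrM mulnb.
Qed.

Lemma joint_hist c d l :
  expect (ulaw (size l)) (fun w =>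
    ((hist1 w, hist2 w) == ((c, map obs1 l), (d, map obs2 l)))%:R) =
  weight l * mass (run (start_mass d c) l).
Proof.
rewrite /mass big_distrr /=; under [RHS]eq_bigr do rewrite -joint_law.
rewrite -expect_sum; apply: eq_expect => w _.
under eq_bigr do rewrite -mulnb natrM eq_sym.
by rewrite sum_point.
Qed.

Lemma start_mass_ge0 c d k : 0 <= start_mass d c k.
Proof. exact: fdist_ge0. Qed.

Lemma hist_supp c d l : 0 < mass (run (start_mass d c) l) ->
  exists2 w, w \in finsupp (ulaw (size l)) &
    (hist1 w, hist2 w) = ((c, map obs1 l), (d, map obs2 l)).
Proof.
move=> m0; apply: contrapT => H.
have := joint_hist c d l; rewrite /expect big_seq big1 => [/esym/eqP|w wP].
  by rewrite gt_eqF // mulr_gt0 ?weight_gt0.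
by case: eqP => [E|]; [case: H; exists w|rewrite mulr0].
Qed.

Lemma posterior_hist c d l w : w \in finsupp (ulaw (size l)) ->
  (hist1 w, hist2 w) = ((c, map obs1 l), (d, map obs2 l)) ->
  cond_law (ulaw (size l)) (@last_state K I J C D) (@hist1 K I J C D) w =
  norm (run (start_mass d c) l).
Proof.
move=> wP E; rewrite -(hA1 wP); apply: cond_law_unique => // u.
rewrite E joint_law joint_hist {1}(mass_norm k0 u (run_ge0 q l (start_mass_ge0 c d))).
by ring.
Qed.

(** By (A1) both sides are the posterior given player 1's history alone, and under uniform actions
    every history of positive mass occurs. *)
Lemma posterior_indep c d d' l l' : map obs1 l = map obs1 l' ->
  0 < mass (run (start_mass d c) l) -> 0 < mass (run (start_mass d' c) l') ->
  norm (run (start_mass d c) l) = norm (run (start_mass d' c) l').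
Proof.
move=> ll' /hist_supp[w wP wE] /hist_supp[w' w'P w'E].
have sz : size l = size l' by rewrite -(size_map obs1) ll' size_map.
rewrite -(posterior_hist wP wE) -(posterior_hist w'P w'E) sz.
apply: eq_cond_law; rewrite -[hist1 w]/(hist1 w, hist2 w).1 wE.
by rewrite -[hist1 w']/(hist1 w', hist2 w').1 w'E /= ll'.
Qed.

Lemma stable_start_family d : stable_family q k0 (start_family d).
Proof. by move=> c l l'; exact: posterior_indep. Qed.

Lemma start_belief1 k c d : (k, c, d) \in finsupp p ->
  belief1 (init_law p) ((k, c, d), [::]) = norm (start_mass d c).
Proof.
move=> tp; rewrite -[start_mass d c]/(run (start_mass d c) [::]).
apply: (@posterior_hist c d [::]) => //.
by apply/finsupp_dmap; exists (k, c, d).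
Qed.

(** Links [y_1], about which (A2a) speaks, with the families from which plans are built. *)
Lemma start_belief2 k (c d : 'I_bound) : (k, val c, val d) \in finsupp p ->
  belief2 (init_law p) ((k, val c, val d), [::]) = canon (start_family d).
Proof.
move=> tp; have wP : ((k, val c, val d), [::]) \in finsupp (init_law p).
  by apply/finsupp_dmap; exists (k, val c, val d).
have E h : expect (init_law p) (fun w => (hist2 w == (val d, [::]))%:R * h (belief1 (init_law
  p) w)) =
    pairing k0 (start_family d) h.
  rewrite expect_dmap (@eq_expect _ _ _ _ (fun t => (t.2 == val d)%:R * h (norm (start_mass t.2
    t.1.2)))); last first.
    by move=> [[k1 c1] d1] t1 /=; rewrite start_belief1 // /hist2 /signal2 /= xpair_eqE andbT.
  rewrite expect_start (eq_bigr (fun d' => (d' == d)%:R * pairing k0 (start_family d') h))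
    ?sum_point // => d' _.
  rewrite /pairing big_distrr; apply: eq_bigr => c' _ /=.
  by rewrite mulrCA /mass big_distrl.
have t0 : 0 < total_mass (start_family d).
  rewrite /total_mass (bigD1 c) //= ltr_pwDl ?sumr_ge0 // => [|c' _];
    last exact/mass_ge0/start_family_ge0.
  rewrite /mass (bigD1 k) //= ltr_pwDl ?sumr_ge0 -?finsupp_gt0 // => k' _;
    exact: start_family_ge0.
apply: cond_law_unique => // z.
rewrite canonE //; last exact: start_family_ge0.
have -> : expect (init_law p) (fun t => (hist2 t == hist2 ((k, val c, val d), [::] : seq ((I *
  J) * (K * C * D))))%:R) = total_mass (start_family d).
  by rewrite (total_mass_pairing k0) -E; apply: eq_expect => w _; rewrite mulr1.
rewrite divfK ?gt_eqF // -E; apply: eq_expect => w _.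
by rewrite -mulnb natrM mulrC.
Qed.

End Posteriors.
End Bridge.

(** * Minmax and realization equivalence *)

Section Minmax.
Variable R : realType.

(* Blackwell's approachability argument: answering the current positive parts
   of the regrets keeps the sum of their squares at most linear in time. *)
Lemma minmax (O : finType) (T : Type) (f : T -> O -> R) (v e : R) : 0 < e -> (0 < #|O|)%N ->
  (forall a o, 0 <= f a o <= 1) ->
  (forall theta : fdist R O, exists a, v <= \sum_o theta o * f a o) ->
  exists (L : finType) (lam : fdist R L) (a : L -> T), forall o,
    v - e <= \sum_l lam l * f (a l) o.
Proof.
move=> e0 /card_gt0P[o0 _] f01 H.
(* A negative [v] is trivial since [f] is nonnegative; otherwise [v] is in [[0, 1]] and each regret
   [v - f a o] is in [[-1, 1]]. *)
have [v0|v0] := ltP v 0.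
  have [a _] := H (dret R o0).
  exists unit, (dret R tt), (fun=> a) => o; rewrite -expectT expect_dret.
  by have /andP[f0 _] := f01 a o; lra.
have v1 : v <= 1.
  have [a] := H (dret R o0); move/le_trans; apply; rewrite -expectT expect_dret.
  by case/andP: (f01 a o0).
pose X s o := \sum_(a <- s) (v - f a o).
pose pos s o := Num.max 0 (X s o).
have key n : exists s, size s = n /\ \sum_o pos s o ^+ 2 <= n%:R * #|O|%:R.
  elim: n => [|n [s [sn IH]]].
    exists [::]; split=> //; rewrite mul0r big1 // => o _.
    by rewrite /pos /X big_nil maxxx expr0n.
  have p0 o : 0 <= pos s o by rewrite /pos le_max lexx.
  have [a aE] : exists a, \sum_o pos s o * (v - f a o) <= 0.
    pose S := \sum_o pos s o.
    have [S0|Sn0] := eqVneq S 0.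
      have [a _] := H (dret R o0); exists a; rewrite big1 // => o _.
      move/eqP: S0; rewrite psumr_eq0 // => /allP /(_ o (mem_index_enum _)) /= /eqP ->.
      by rewrite mul0r.
    have Sp : 0 < S by rewrite lt0r Sn0 sumr_ge0.
    have thE o : to_fdistT (fun o => pos s o / S) (dret R o0) o = pos s o / S.
      rewrite to_fdistTE // => [o'|]; first by rewrite divr_ge0 // ltW.
      by rewrite -big_distrl /= -/S divff.
    have [a] := H (to_fdistT (fun o => pos s o / S) (dret R o0)).
    under eq_bigr do rewrite thE mulrAC.
    rewrite -big_distrl /= ler_pdivlMr // => aE; exists a.
    under eq_bigr do rewrite mulrBr; rewrite sumrB subr_le0.
    by rewrite -big_distrl /= mulrC.
  exists (a :: s); split; first by rewrite /= sn.
  apply: le_trans (_ : \sum_o (pos s o ^+ 2 + 2 * (pos s o * (v - f a o)) + 1) <= _).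
    apply: ler_sum => o _; have /andP[f0 f1] := f01 a o.
    have Xp : X s o <= pos s o by rewrite /pos le_max lexx orbT.
    have -> : pos (a :: s) o = Num.max 0 (v - f a o + X s o) by rewrite /pos /X big_cons.
    have po := p0 o; move: (pos s o) (X s o) Xp po => P Y YP P0.
    set d := v - f a o; have d1 : d ^+ 2 <= 1 by rewrite -[leRHS](expr1n _ 2) -subr_ge0
      subr_sqr mulr_ge0 // /d; lra.
    apply: le_trans (_ : (P + d) ^+ 2 <= _); last by rewrite sqrrD; lra.
    rewrite maxEle; case: ifP => [h|_]; last by rewrite expr0n sqr_ge0.
    by rewrite ler_sqr ?nnegrE //; lra.
  rewrite !big_split /= -big_distrr /= sumr_const -natr1 mulrDl mul1r.
  by move: IH aE => /=; lra.
(* With this many steps [n * #|O|] is at most [(e * n) ^ 2], so each average regret is at most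
   [e]. *)
pose n := (Num.truncn (#|O|%:R / e ^+ 2)).+1.
have n0 : 0 < n%:R :> R by rewrite ltr0n.
have ne : #|O|%:R <= e ^+ 2 * n%:R.
  rewrite mulrC -ler_pdivrMr ?exprn_gt0 // ltW //.
  by case/andP: (truncn_itv (divr_ge0 (ler0n R #|O|) (sqr_ge0 e))).
have [s [sn sE]] := key n.
have s_gt0 : (0 < size s)%N by rewrite sn.
pose i0 : 'I_(size s) := Ordinal s_gt0.
exists 'I_(size s), (to_fdistT (fun=> n%:R^-1) (dret R i0)), (fun l => tnth (in_tuple s) l) => o.
have lE l : to_fdistT (fun=> n%:R^-1) (dret R i0) l = n%:R^-1 :> R.
  rewrite to_fdistTE //.
  by rewrite sumr_const card_ord sn -[_ *+ _]mulr_natr mulVf ?gt_eqF.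
under eq_bigr do rewrite lE.
rewrite -big_distrr /= -(big_tnth _ _ s xpredT (fun a => f a o)) mulrC ler_pdivlMr //.
have XE : X s o = v * n%:R - \sum_(a <- s) f a o.
  by rewrite /X sumrB big_const_seq count_predT sn iter_addr_0 mulr_natr.
have : pos s o ^+ 2 <= (e * n%:R) ^+ 2.
  apply: le_trans (_ : \sum_o pos s o ^+ 2 <= _).
    by rewrite (bigD1 o) //= lerDl sumr_ge0 // => o' _; rewrite sqr_ge0.
  by apply: le_trans sE _; rewrite exprMn [n%:R ^+ 2]expr2 mulrA mulrC ler_wpM2r // ltW.
have p0 : 0 <= pos s o by rewrite /pos le_max lexx.
have en0 : 0 <= e * n%:R by rewrite mulr_ge0 // ltW.
rewrite ler_sqr ?nnegrE //.
rewrite /pos ge_max => /andP[_]; rewrite XE; lra.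
Qed.

End Minmax.

Section Mix.
Variables (R : realType) (L X S : finType).

(** Bayes' rule for the hidden index [l], with likelihoods [f l]; [lam] is kept when the observation
    has probability zero. *)
Definition reweight (lam : fdist R L) (f : L -> R) : fdist R L :=
  to_fdistT (fun l => lam l * f l / \sum_l' lam l' * f l') lam.

Lemma reweightE (lam : fdist R L) (f : L -> R) l : (forall l, 0 <= f l) ->
  (\sum_l' lam l' * f l') * reweight lam f l = lam l * f l.
Proof.
move=> f0; have lf l' : 0 <= lam l' * f l' by rewrite mulr_ge0 ?fdist_ge0.
have [z|n0] := eqVneq (\sum_l' lam l' * f l') 0.
  move/eqP: (z); rewrite psumr_eq0 // => /allP /(_ l (mem_index_enum _)) /= /eqP ->.
  by rewrite z mul0r.
rewrite to_fdistTE => [|l'|]; first by rewrite mulrC divfK.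
  by rewrite divr_ge0 // sumr_ge0.
by rewrite -big_distrl /= divff.
Qed.

(* The behaviour strategy that is realization equivalent to the mixture of the
   [plans l] with probabilities [lam l]. *)
Fixpoint mix (lam : fdist R L) (plans : L -> seq (X * S) -> fdist R X)
    (h : seq (X * S)) : fdist R X :=
  if h is e :: h' then
    mix (reweight lam (fun l => plans l [::] e.1)) (fun l => after (plans l) e) h'
  else dbind lam (fun l => plans l [::]).

Lemma mix_agree (lam : fdist R L) (plans : L -> seq (X * S) -> fdist R X) plan h : (forall l,
  plans l h = plan h) -> mix lam plans h = plan h.
Proof.
elim: h lam plans plan => [|e h IH] lam plans plan E /=.
  by apply/fdistP => x; rewrite dbindE -(expect_cst lam (plan [::] x));
    apply: eq_expect => l _; rewrite E.
exact: (IH _ _ (after plan e)).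
Qed.

Lemma after_mix (lam : fdist R L) (plans : L -> seq (X * S) -> fdist R X) e :
  after (mix lam plans) e =
  mix (reweight lam (fun l => plans l [::] e.1)) (fun l => after (plans l) e).
Proof. by []. Qed.

(** The probability of [x] cancels the denominator of Bayes' rule; this identity makes payoffs
    linear in mixtures for either player. *)
Lemma mix_step (lam : fdist R L) (plans : L -> seq (X * S) -> fdist R X) (x : X) (G : L -> R) :
  mix lam plans [::] x * (\sum_l reweight lam (fun l => plans l [::] x) l * G l) =
  \sum_l lam l * (plans l [::] x * G l).
Proof.
rewrite /= dbindE expectT big_distrr; apply: eq_bigr => l _ /=.
by rewrite mulrA reweightE ?mulrA // => l'; exact: fdist_ge0.
Qed.

End Mix.

Section PayoffTheory.
Variables (R : realType) (K I J C D : finType).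
Variables (q : K -> I -> J -> fdist R (K * C * D)%type) (g : K -> I -> J -> R).
Hypothesis g01 : forall k i j, 0 <= g k i j <= 1.
Notation state_payoff := (state_payoff q g).

Lemma state_payoffS n w k sigma tau : state_payoff n.+1 w k sigma tau =
  \sum_i \sum_j sigma [::] i * tau [::] j * (w 0 * g k i j +
      \sum_(x : K * C * D) q k i j x *
        state_payoff n (w \o S) x.1.1 (after sigma (i, x.1.2)) (after tau (j, x.2))).
Proof. by []. Qed.

Lemma state_payoff_mix2 (L : finType) (lam : fdist R L) n w k sigma (taus : L -> seq (J * D) ->
  fdist R J) :
  state_payoff n w k sigma (mix lam taus) = \sum_l lam l * state_payoff n w k sigma (taus l).
Proof.
elim: n w k sigma lam taus => [|n IH] w k sigma lam taus.
  by rewrite big1 // => l _; rewrite mulr0.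
transitivity (\sum_i \sum_j \sum_l lam l * (taus l [::] j * (sigma [::] i * (w 0 * g k i j +
  \sum_(x : K * C * D) q k i j x * state_payoff n (w \o S) x.1.1 (after sigma (i, x.1.2))
    (after (taus l) (j, x.2)))))).
  rewrite state_payoffS; apply: eq_bigr => i _; apply: eq_bigr => j _.
  rewrite -mix_step -mulrA mulrCA; congr (_ * _).
  under [RHS]eq_bigr do rewrite mulrCA; rewrite -big_distrr /=; congr (_ * _).
  under [RHS]eq_bigr do rewrite mulrDr; rewrite big_split -big_distrl /= fdist_sumT mul1r.
  congr (_ + _); under [RHS]eq_bigr do rewrite big_distrr /=.
  rewrite [RHS]exchange_big; apply: eq_bigr => x _ /=.
  by rewrite after_mix IH big_distrr; apply: eq_bigr => l _ /=; rewrite mulrCA.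
under eq_bigr do rewrite exchange_big /=.
rewrite exchange_big; apply: eq_bigr => l _ /=; rewrite big_distrr; apply: eq_bigr => i _ /=.
by rewrite big_distrr; apply: eq_bigr => j _ /=; ring.
Qed.

Lemma state_payoff_mix1 (L : finType) (lam : fdist R L) n w k (sigmas : L -> seq (I * C) ->
  fdist R I) tau :
  state_payoff n w k (mix lam sigmas) tau = \sum_l lam l * state_payoff n w k (sigmas l) tau.
Proof.
elim: n w k tau lam sigmas => [|n IH] w k tau lam sigmas.
  by rewrite big1 // => l _; rewrite mulr0.
transitivity (\sum_i \sum_j \sum_l lam l * (sigmas l [::] i * (tau [::] j * (w 0 * g k i j +
  \sum_(x : K * C * D) q k i j x * state_payoff n (w \o S) x.1.1 (after (sigmas l) (i, x.1.2))
    (after tau (j, x.2)))))).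
  rewrite state_payoffS; apply: eq_bigr => i _; apply: eq_bigr => j _.
  rewrite -mix_step -mulrA; congr (_ * _).
  under [RHS]eq_bigr do rewrite mulrCA; rewrite -big_distrr /=; congr (_ * _).
  under [RHS]eq_bigr do rewrite mulrDr; rewrite big_split -big_distrl /= fdist_sumT mul1r.
  congr (_ + _); under [RHS]eq_bigr do rewrite big_distrr /=.
  rewrite [RHS]exchange_big; apply: eq_bigr => x _ /=.
  by rewrite after_mix IH big_distrr; apply: eq_bigr => l _ /=; rewrite mulrCA.
under eq_bigr do rewrite exchange_big /=.
rewrite exchange_big; apply: eq_bigr => l _ /=; rewrite big_distrr; apply: eq_bigr => i _ /=.
by rewrite big_distrr; apply: eq_bigr => j _ /=; ring.
Qed.

Lemma state_payoff_ext n w w' k sigma sigma' tau tau' :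
  (forall t, (t < n)%N -> w t = w' t) ->
  (forall h, (size h < n)%N -> sigma h = sigma' h) ->
  (forall h, (size h < n)%N -> tau h = tau' h) ->
  state_payoff n w k sigma tau = state_payoff n w' k sigma' tau'.
Proof.
elim: n w w' k sigma sigma' tau tau' => [//|n IH] w w' k sigma sigma' tau tau' ww ss tt /=.
rewrite ww // ss // tt //; apply: eq_bigr => i _; apply: eq_bigr => j _.
congr (_ * (_ + _)); apply: eq_bigr => x _; congr (_ * _).
by apply: IH => [t tn|h hn|h hn] /=; [exact: ww|exact: ss|exact: tt].
Qed.

Lemma state_payoff_cut n m w k sigma tau :
  state_payoff (n + m) (fun t => if (t < n)%N then w t else 0) k sigma tau = state_payoff n w k
    sigma tau.
Proof.
elim: n w k sigma tau => [|n IH] w k sigma tau.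
  rewrite add0n; elim: m k sigma tau => [//|m IH] k sigma tau /=.
  rewrite big1 // => i _; rewrite big1 // => j _; rewrite mul0r add0r big1 ?mulr0 // => x _.
  by rewrite (_ : _ \o _ = fun t => if (t < 0)%N then w t else 0) // IH mulr0.
rewrite addSn /=; apply: eq_bigr => i _; apply: eq_bigr => j _.
congr (_ * (_ + _)); apply: eq_bigr => x _; congr (_ * _).
exact: (IH (w \o S)).
Qed.

Lemma state_payoff_add n c w w' k sigma tau :
  state_payoff n (fun t => c * w t + w' t) k sigma tau = c * state_payoff n w k sigma tau +
    state_payoff n w' k sigma tau.
Proof.
elim: n w w' k sigma tau => [|n IH] w w' k sigma tau /=; first by rewrite mulr0 addr0.
rewrite big_distrr -big_split; apply: eq_bigr => i _ /=.
rewrite big_distrr -big_split; apply: eq_bigr => j _ /=.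
rewrite mulrCA -mulrDr; congr (_ * _); rewrite mulrDl mulrDr addrACA mulrA; congr (_ + _).
rewrite big_distrr -big_split; apply: eq_bigr => x _ /=.
by rewrite (IH (w \o S) (w' \o S)); ring.
Qed.

(** The strategies are exchanged one stage at a time, each exchange costing at most [#|I| * e] times
    the total weight. *)
Lemma state_payoff_lip n w k (sigma sigma' : seq (I * C) -> fdist R I) tau (e : R) : (forall t,
  0 <= w t) -> 0 <= e ->
  (forall h i, (size h < n)%N -> `|sigma h i - sigma' h i| <= e) ->
  `|state_payoff n w k sigma tau - state_payoff n w k sigma' tau| <= n%:R * (#|I|%:R * e *
    total_weight n w).
Proof.
move=> + e0; elim: n w k sigma sigma' tau => [|n IH] w k sigma sigma' tau w0 H.
  by rewrite /= subr0 normr0 mul0r.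
pose G i j s := w 0 * g k i j + \sum_(x : K * C * D) q k i j x *
  state_payoff n (w \o S) x.1.1 (after s (i, x.1.2)) (after tau (j, x.2)).
have Wn : total_weight n (w \o S) <= total_weight n.+1 w by rewrite total_weightS lerDr.
have W0 := total_weight_ge0 n.+1 w0.
have G01 i j s : 0 <= G i j s <= total_weight n.+1 w.
  have /andP[g0 g1] := g01 k i j.
  have B x := state_payoff_bounds q g01 n (w := w \o S) x.1.1 (after s (i, x.1.2)) (after tau
    (j, x.2)) (fun t => w0 t.+1).
  apply/andP; split.
    by rewrite addr_ge0 ?mulr_ge0 ?sumr_ge0 // => x _; rewrite mulr_ge0 ?fdist_ge0 //;
      case/andP: (B x).
  rewrite total_weightS lerD ?ler_piMr // -[leRHS]mul1r -(fdist_sumT (q k i j)) big_distrl /=.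
  by apply: ler_sum => x _; rewrite ler_wpM2l ?fdist_ge0 //; case/andP: (B x).
set B := n%:R * (#|I|%:R * e * total_weight n.+1 w).
have B0 : 0 <= B by rewrite !mulr_ge0.
have GB i j : `|G i j sigma - G i j sigma'| <= B.
  rewrite /G opprD addrACA subrr add0r -sumrB; apply: le_trans (ler_norm_sum _ _ _) _.
  rewrite -[leRHS]mul1r -(fdist_sumT (q k i j)) big_distrl; apply: ler_sum => x _ /=.
  rewrite -mulrBr normrM ger0_norm ?fdist_ge0 // ler_wpM2l ?fdist_ge0 //.
  apply: le_trans (IH (w \o S) x.1.1 _ _ _ (fun t => w0 t.+1) _) _ => [h i' hn|].
    exact: H.
  by rewrite ler_wpM2l // ler_wpM2l // mulr_ge0.
have -> : state_payoff n.+1 w k sigma tau - state_payoff n.+1 w k sigma' tau =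
    \sum_i \sum_j tau [::] j * ((sigma [::] i - sigma' [::] i) * G i j sigma +
       sigma' [::] i * (G i j sigma - G i j sigma')).
  rewrite -sumrB; apply: eq_bigr => i _; rewrite -sumrB; apply: eq_bigr => j _.
  by rewrite -/(G i j sigma) -/(G i j sigma'); ring.
apply: le_trans (ler_norm_sum _ _ _) _.
apply: le_trans (_ : \sum_i (e * total_weight n.+1 w + sigma' [::] i * B) <= _).
  apply: ler_sum => i _; apply: le_trans (ler_norm_sum _ _ _) _.
  rewrite -[leRHS]mul1r -(fdist_sumT (tau [::])) big_distrl; apply: ler_sum => j _ /=.
  rewrite normrM ger0_norm ?fdist_ge0 // ler_wpM2l ?fdist_ge0 //.
  apply: le_trans (ler_normD _ _) _; apply: lerD.
    by rewrite normrM ler_pM ?H // ger0_norm; case/andP: (G01 i j sigma).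
  by rewrite normrM ger0_norm ?fdist_ge0 // ler_wpM2l ?fdist_ge0.
rewrite big_split /= -[X in _ + X]big_distrl /= fdist_sumT mul1r sumr_const -[_ *+ _]mulr_natl.
by rewrite /B -natr1; apply/eq_ler; ring.
Qed.

End PayoffTheory.

(** * Guarantees of the two players *)

Section Game.
Variables (R : realType) (K I J C D : finType).
Variables (q : K -> I -> J -> fdist R (K * C * D)%type) (g : K -> I -> J -> R).
Variables (p : fdist R (start K)) (k0 : K) (i0 : I) (j0 : J).
Hypothesis g01 : forall k i j, 0 <= g k i j <= 1.
Implicit Types (sigma : strategy1 R I C) (tau : strategy2 R J D) (w : nat -> R).
Notation payoff := (payoff q g p).
Notation start_family := (@start_family R K p).
Notation family_value n w := (family_value q g j0 n w start_family).
Notation bound := (@bound R K p).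

Lemma payoff_bounds sigma tau n w : (forall t, 0 <= w t) -> 0 <= payoff sigma tau n w <=
  total_weight n w.
Proof.
move=> w0; have B k s t := state_payoff_bounds q g01 n k s t w0.
apply/andP; split.
  apply: sumr_ge0 => d _; apply: sumr_ge0 => c _; apply: sumr_ge0 => k _.
  by rewrite mulr_ge0 ?start_family_ge0 //; case/andP: (B k (fun h => sigma (val c, h)) (fun h
    => tau (val d, h))).
rewrite -[leRHS]mul1r -(sum_total_mass_start p) big_distrl; apply: ler_sum => d _ /=.
rewrite /total_mass big_distrl; apply: ler_sum => c _; rewrite big_distrl;
  apply: ler_sum => k _ /=.
by rewrite ler_wpM2l ?start_family_ge0 //; case/andP: (B k (fun h => sigma (val c, h)) (fun h
  => tau (val d, h))).
Qed.

Lemma payoff_ext sigma tau tau' n w w' : (forall t, (t < n)%N -> w t = w' t) ->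
  (forall d h, (size h < n)%N -> tau (d, h) = tau' (d, h)) ->
  payoff sigma tau n w = payoff sigma tau' n w'.
Proof.
move=> ww tt; apply: eq_bigr => d _; apply: eq_bigr => c _; apply: eq_bigr => k _.
by congr (_ * _); apply: state_payoff_ext => // h; exact: tt.
Qed.

Lemma payoff_cut sigma tau n m w :
  payoff sigma tau (n + m) (fun t => if (t < n)%N then w t else 0) = payoff sigma tau n w.
Proof.
apply: eq_bigr => d _; apply: eq_bigr => c _; apply: eq_bigr => k _.
by congr (_ * _); exact: state_payoff_cut.
Qed.

Lemma payoff_add sigma tau n c w w' :
  payoff sigma tau n (fun t => c * w t + w' t) = c * payoff sigma tau n w + payoff sigma tau n w'.
Proof.
rewrite big_distrr -big_split; apply: eq_bigr => d _ /=.
rewrite big_distrr -big_split; apply: eq_bigr => c' _ /=.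
rewrite big_distrr -big_split; apply: eq_bigr => k _ /=.
by rewrite state_payoff_add; ring.
Qed.

Definition mix_strategy (X S : finType) (L : finType) (lam : fdist R L)
    (ss : L -> nat * seq (X * S) -> fdist R X) : nat * seq (X * S) -> fdist R X :=
  fun ch => mix lam (fun l h => ss l (ch.1, h)) ch.2.

Lemma payoff_mix1 (L : finType) (lam : fdist R L) (ss : L -> strategy1 R I C) tau n w :
  payoff (mix_strategy lam ss) tau n w = \sum_l lam l * payoff (ss l) tau n w.
Proof.
under [RHS]eq_bigr do rewrite big_distrr /=.
rewrite [RHS]exchange_big; apply: eq_bigr => d _ /=.
under [RHS]eq_bigr do rewrite big_distrr /=.
rewrite [RHS]exchange_big; apply: eq_bigr => c _ /=.
under [RHS]eq_bigr do rewrite big_distrr /=.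
rewrite [RHS]exchange_big; apply: eq_bigr => k _ /=.
have E := state_payoff_mix1 q g lam n w k (fun l h => ss l (val c, h)) (fun h => tau (val d, h)).
rewrite -[state_payoff _ _ _ _ _ _ _]/(state_payoff q g n w k (mix lam (fun l h => ss l (val c,
  h))) (fun h => tau (val d, h))).
by rewrite E big_distrr; apply: eq_bigr => l _ /=; rewrite mulrCA.
Qed.

Lemma payoff_mix2 (L : finType) (lam : fdist R L) sigma (ts : L -> strategy2 R J D) n w :
  payoff sigma (mix_strategy lam ts) n w = \sum_l lam l * payoff sigma (ts l) n w.
Proof.
under [RHS]eq_bigr do rewrite big_distrr /=.
rewrite [RHS]exchange_big; apply: eq_bigr => d _ /=.
under [RHS]eq_bigr do rewrite big_distrr /=.
rewrite [RHS]exchange_big; apply: eq_bigr => c _ /=.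
under [RHS]eq_bigr do rewrite big_distrr /=.
rewrite [RHS]exchange_big; apply: eq_bigr => k _ /=.
have E := state_payoff_mix2 q g lam n w k (fun h => sigma (val c, h)) (fun l h => ts l (val d,
  h)).
rewrite -[state_payoff _ _ _ _ _ _ _]/(state_payoff q g n w k (fun h => sigma (val c, h)) (mix
  lam (fun l h => ts l (val d, h)))).
by rewrite E big_distrr; apply: eq_bigr => l _ /=; rewrite mulrCA.
Qed.

Lemma payoff_lip sigma sigma' tau n w e : (forall t, 0 <= w t) -> 0 <= e ->
  (forall c h i, (c < bound)%N -> (size h < n)%N -> `|sigma (c, h) i - sigma' (c, h) i| <= e) ->
  `|payoff sigma tau n w - payoff sigma' tau n w| <= n%:R * (#|I|%:R * e * total_weight n w).
Proof.
move=> w0 e0 H; rewrite -sumrB; apply: le_trans (ler_norm_sum _ _ _) _; set B := (leRHS).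
rewrite -[leRHS]mul1r -(sum_total_mass_start p) big_distrl; apply: ler_sum => d _ /=.
rewrite -sumrB /total_mass big_distrl; apply: le_trans (ler_norm_sum _ _ _) _;
  apply: ler_sum => c _ /=.
rewrite -sumrB /mass big_distrl; apply: le_trans (ler_norm_sum _ _ _) _; apply: ler_sum => k _ /=.
rewrite -mulrBr normrM ger0_norm ?start_family_ge0 // ler_wpM2l ?start_family_ge0 //.
by apply: (state_payoff_lip q g01) => // h i hn; apply: H.
Qed.

Hypotheses (hA1 : assumption_A1 q p) (hA3 : assumption_A3 q).

Lemma reply sigma tau0 n w : (forall t, 0 <= w t) ->
  exists tau, (forall d h, w (size h) = 0 -> tau (d, h) = tau0 (d, h)) /\
    payoff sigma tau n w <= family_value n w.
Proof.
move=> w0.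
have H (d : 'I_bound) := best_reply i0 g01 (transition_indep j0 hA3) n
  (fun c h => sigma (val c, h)) (fun h => tau0 (val d, h)) w0 (@start_family_ge0 _ _ p d)
    (@stable_start_family R K I J C D q p k0 i0 j0 hA1 d).
have [tau' tauE] := choice H.
exists (fun dh => if insub dh.1 is Some d then tau' d dh.2 else tau0 dh); split.
  move=> d h wh /=; case: insubP => [d' _ dE|//].
  by have [-> //] := tauE d'; rewrite dE.
apply: ler_sum => d _; have [_ B] := tauE d.
by rewrite /= valK; exact: B.
Qed.

(* Player 2 answers all the strategies of player 1 at once: by compactness
   finitely many of them matter, and [minmax] applies to those. *)
Lemma block_strategy tau0 n w e : (forall t, 0 <= w t) -> total_weight n w <= 1 -> 0 < e ->
  exists tau, (forall d h, w (size h) = 0 -> tau (d, h) = tau0 (d, h)) /\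
    forall sigma, payoff sigma tau n w <= family_value n w + e.
Proof.
move=> w0 w1 e0.
(* A payoff over [n] stages sees a strategy of player 1 only through these coordinates. *)
pose N := ('I_bound * n.-bseq (I * C) * I)%type.
pose f sigma (x : N) := sigma (val x.1.1, val x.1.2) x.2.
pose e1 := e / 2 / (n * #|I|).+1%:R.
have e10 : 0 < e1 by rewrite !divr_gt0.
have [s x|L [rep net]] := @finite_net R _ N f e1 (fun=> dret R i0) _ e10.
  by rewrite fdist_ge0 fdist_le1.
have netGP sigma : exists l, forall tau, payoff sigma tau n w <= payoff (rep l) tau n w + e / 2.
  have [l lE] := net sigma; exists l => tau.
  rewrite -lerBlDl; apply: le_trans (ler_norm _) _.
  apply: le_trans (payoff_lip (e := e1) tau w0 (ltW e10) _) _.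
    move=> c h i cb hn; have hn' : (size h <= n)%N by exact: ltnW.
    exact: (lE (Ordinal cb, Bseq hn', i)).
  apply: le_trans (_ : n%:R * (#|I|%:R * e1 * 1) <= _).
    by rewrite ler_wpM2l // ler_wpM2l // mulr_ge0 // ltW.
  have c1 : (n * #|I|)%:R / (n * #|I|).+1%:R <= 1 :> R by rewrite ler_pdivrMr // mul1r ler_nat.
  have -> : n%:R * (#|I|%:R * e1 * 1) = e / 2 * ((n * #|I|)%:R / (n * #|I|).+1%:R).
    by rewrite /e1 natrM; ring.
  by rewrite ler_piMr // divr_ge0 // ltW.
pose agrees tau := forall d h, w (size h) = 0 -> tau (d, h) = tau0 (d, h).
(* Only strategies that continue [tau0] are mixed, and by [mix_agree] the mixture continues it
   too. *)
pose T := {tau | agrees tau}.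
have [l0 _] := netGP (fun=> dret R i0).
have B l tau : 0 <= payoff (rep l) tau n w <= 1.
  by have /andP[a b] := payoff_bounds (rep l) tau n w0; rewrite a (le_trans b).
have [||t l|theta|L2 [lam [a aE]]] :=
  @minmax R L T (fun t l => 1 - payoff (rep l) (sval t) n w) (1 - family_value n w) (e / 2).
- by rewrite divr_gt0.
- by apply/card_gt0P; exists l0.
- by have := B l (sval t); lra.
(* A mixture of the representatives is realised by one strategy, to which [reply] answers. *)
- have [tau [tg tV]] := reply (mix_strategy theta rep) tau0 n w0.
  exists (exist _ tau tg) => /=; rewrite payoff_mix1 in tV.
  under eq_bigr do rewrite mulrBr mulr1.
  by rewrite sumrB fdist_sumT lerD2l lerN2.
exists (mix_strategy lam (fun l => sval (a l))); split.
  move=> d h wh; apply: (@mix_agree _ _ _ _ _ _ (fun h => tau0 (d, h))) => l.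
  by case: (a l) => /= t; exact.
move=> sigma; have [l lE] := netGP sigma; apply: le_trans (lE _) _.
rewrite payoff_mix2; have := aE l; under eq_bigr do rewrite mulrBr mulr1.
by rewrite sumrB fdist_sumT; lra.
Qed.

End Game.

(** * The block strategy of player 2 *)

Section Player2.
Variables (R : realType) (K I J C D : finType).
Variables (q : K -> I -> J -> fdist R (K * C * D)%type) (g : K -> I -> J -> R).
Variables (p : fdist R (start K)) (k0 : K) (i0 : I) (j0 : J).
Hypothesis g01 : forall k i j, 0 <= g k i j <= 1.
Hypotheses (hA1 : assumption_A1 q p) (hA3 : assumption_A3 q).
Implicit Types (sigma : strategy1 R I C) (tau : strategy2 R J D) (w : nat -> R).
Notation payoff := (payoff q g p).
Notation start_family := (@start_family R K p).
Notation limit_value := (limit_value q g j0 start_family).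

Lemma payoff_horizon sigma tau n m w : (forall t, 0 <= w t) -> (n <= m)%N ->
  payoff sigma tau n w <= payoff sigma tau m w.
Proof.
move=> w0 nm; rewrite -(subnKC nm) -(payoff_cut q g p sigma tau n (m - n)).
pose w1 t := if (t < n)%N then w t else 0; pose w2 t := if (t < n)%N then 0 else w t.
rewrite (@payoff_ext _ _ _ _ _ _ q g p sigma tau tau (n + (m - n)) w (fun t => 1 * w1 t + w2
  t)) //; last first.
  by move=> t _; rewrite /w1 /w2; case: ifP; rewrite ?mul1r ?addr0 ?mulr0 ?add0r.
rewrite payoff_add mul1r lerDl.
have w20 t : 0 <= w2 t by rewrite /w2; case: ifP.
by case/andP: (payoff_bounds q p g01 sigma tau (n + (m - n)) w20).
Qed.

Lemma player2_guarantees : guarantees2 q g p limit_value.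
Proof.
move=> eps eps0; pose e := eps / 4.
have e0 : 0 < e by rewrite divr_gt0.
have sp0 d : nonneg (start_family d) by exact: start_family_ge0.
have sp1 := sum_total_mass_start p.
have [n nE] := limit_value_approx q i0 j0 g01 sp0 sp1 e0.
pose b := n.+1.
have b0 : 0 < b%:R :> R by rewrite ltr0n.
(* Uniform weights on block [r]; being zero before it, they force [block_strategy] to keep what was
   fixed earlier. *)
pose wb r := shift (r * b) (fun=> b%:R^-1 : R).
have wb0 r t : 0 <= wb r t by apply: shift_ge0 => u; exact: unif_ge0.
have Wb r : total_weight (r * b + b) (wb r) <= 1.
  by rewrite total_weight_shift /total_weight sumr_const card_ord -[_ *+ _]mulr_natr mulVf
    ?gt_eqF.
have step (x : nat * strategy2 R J D) : exists tau,
    (forall d h, (size h < x.1 * b)%N -> tau (d, h) = x.2 (d, h)) /\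
    forall sigma, payoff sigma tau (x.1 * b + b) (wb x.1) <= limit_value + e + e.
  have [tau [t1 t2]] := block_strategy k0 i0 j0 g01 hA1 hA3 x.2 (wb0 x.1) (Wb x.1) e0.
  exists tau; split=> [d h hx|sigma]; first by apply: t1; rewrite /wb shiftE hx.
  apply: le_trans (t2 sigma) _; rewrite lerD2r; apply: le_trans nE.
  exact: (family_value_le_block q i0 j0 g01 sp0 sp1).
have [nextt nextE] := choice step.
pose ts := fix ts r := if r is r'.+1 then nextt (r', ts r') else fun=> dret R j0.
have ts_agree d h r u : (size h < r * b)%N -> ts (r + u)%N (d, h) = ts r (d, h).
  move=> hr; elim: u => [|u IH]; first by rewrite addn0.
  rewrite addnS /=; have [-> //] := nextE (r + u, ts (r + u))%N.
  by rewrite /= (leq_trans hr) // leq_mul2r leq_addr orbT.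
(* The diagonal strategy: in block [r] it follows [ts r.+1], with which all later [ts] agree
   there. *)
pose taus : strategy2 R J D := fun dh => ts (size dh.2 %/ b).+1 dh.
have tausE d h r : (size h < r.+1 * b)%N -> taus (d, h) = ts r.+1 (d, h).
  move=> hr; have rh : (size h %/ b <= r)%N by rewrite -ltnS ltn_divLR.
  rewrite -[taus _]/(ts (size h %/ b).+1 (d, h)).
  have -> : r.+1 = ((size h %/ b).+1 + (r - size h %/ b))%N by rewrite addSn subnKC.
  by rewrite ts_agree // ltn_ceil.
have block sigma r : payoff sigma taus (r * b + b) (wb r) <= limit_value + e + e.
  rewrite (@payoff_ext _ _ _ _ _ _ q g p sigma taus (ts r.+1) _ _ (wb r)) //.
    by have [_] := nextE (r, ts r); exact.
  by move=> d h hr; apply: tausE; rewrite mulSn addnC.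
have total sigma r : payoff sigma taus (r * b) (fun=> 1) <= (r * b)%:R * (limit_value + e + e).
  elim: r => [|r IH].
    rewrite !mul0n mul0r; have := payoff_bounds q p g01 sigma taus 0 (w := fun=> 1) (fun=> ler01).
    by rewrite /total_weight big_ord0 => /andP[].
  rewrite mulSn addnC.
  rewrite (@payoff_ext _ _ _ _ _ _ q g p sigma taus taus (r * b + b) _
    (fun t => b%:R * wb r t + (if (t < r * b)%N then 1 else 0))) //; last first.
    move=> t _; rewrite /wb shiftE; case: ifP => _; first by rewrite mulr0 add0r.
    by rewrite addr0 mulfV ?gt_eqF.
  rewrite payoff_add payoff_cut natrD mulrDl addrC lerD // ler_wpM2l //.
have v0 : 0 <= limit_value.
  have [m /le_trans H] : exists m, block_value q g j0 start_family m <= limit_value + e by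
    exists n.
  apply: lb_le_inf; first by exists (block_value q g j0 start_family 0); exists 0%N.
  by move=> _ [k _ <-]; exact: block_value_ge0.
set v := limit_value in v0 block total *.
have ve0 : 0 <= v + e + e by rewrite !addr_ge0 // ltW.
(* From this horizon on, the incomplete last block costs at most [e] on average; with the two errors
   [e] per block this stays below [eps = 4 * e]. *)
pose N := (Num.truncn (b%:R * (v + e + e) / e)).+1.
exists taus, N => m Nm sigma.
have m0 : (0 < m)%N by exact: leq_trans Nm.
have m0' : 0 < m%:R :> R by rewrite ltr0n.
rewrite gammaE mulrC ler_pdivrMr //.
have mb : (m <= (m %/ b).+1 * b)%N by rewrite ltnW // ltn_ceil.
apply: le_trans (payoff_horizon sigma taus (w := fun=> 1) (fun=> ler01) mb) _.
apply: le_trans (total _ _) _.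
apply: le_trans (_ : (m%:R + b%:R) * (v + e + e) <= _).
  rewrite ler_wpM2r // -natrD ler_nat mulSn addnC leq_add2r; exact: leq_trunc_div.
have H : b%:R * (v + e + e) <= e * m%:R.
  rewrite [leRHS]mulrC -ler_pdivrMr //; apply: le_trans (_ : N%:R <= _); last by rewrite ler_nat.
  apply: ltW; case/andP: (truncn_itv (divr_ge0 (mulr_ge0 (ler0n R b) ve0) (ltW e0))) => _; exact.
rewrite mulrDl; apply: le_trans (lerD (lexx _) H) _.
have -> : eps = 4 * e by rewrite /e; field.
have : 0 <= e * m%:R by rewrite mulr_ge0 // ltW.
by rewrite /v; lra.
Qed.

End Player2.

(** * Limits of distributions along an ultrafilter *)

Section Limit.
Variable R : realType.
Local Open Scope classical_set_scope.

Lemma cvg_bigsum (T : Type) (F : set_system T) (X : finType) (f : X -> T -> R) (l : X -> R) :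
  Filter F -> (forall x, f x t @[t --> F] --> l x) ->
  (\sum_x f x t) @[t --> F] --> \sum_x l x.
Proof.
move=> FF H; elim: (index_enum X) => [|x r IH].
  by under eq_fun do rewrite big_nil; rewrite big_nil; exact: cvg_cst.
by under eq_fun do rewrite big_cons; rewrite big_cons; apply: cvgD.
Qed.

(** Each coordinate stays in the compact [[0, 1]], hence converges along the ultrafilter; signs and
    the finite sum pass to the limit. *)
Lemma fdist_limit (F : set_system nat) (X : finType) (P : nat -> fdist R X) :
  UltraFilter F -> exists Q : fdist R X, forall x, P m x @[m --> F] --> Q x.
Proof.
move=> FU; have FP : ProperFilter F by exact: ultra_proper.
have L x : exists l : R, P m x @[m --> F] --> l.
  have A : ((fun m => P m x) @ F) `[0, 1].
    by apply: nearW => m; rewrite /= in_itv /= fdist_ge0 fdist_le1.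
  have [l [_ cl]] := @segment_compact R 0 1 ((fun m => P m x) @ F) _ A; exists l => B Bl.
  have [//|nB] := in_ultra_setVsetC ((fun m => P m x) @^-1` B) FU.
  by have [z [nBz Bz]] := cl (~` B) B nB Bl.
have [l lE] := choice L.
have l0 x : 0 <= l x.
  by apply: (cvgr_to_ge (lE x)); apply: nearW => m; exact: fdist_ge0.
have l1 : \sum_x l x = 1.
  apply: (@cvg_unique _ (@norm_hausdorff _ R) ((\sum_x P m x) @[m --> F])).
    exact: cvg_bigsum.
  have -> : (fun m => \sum_x P m x) = fun=> 1 by apply/funext => m; exact: fdist_sumT.
  exact: cvg_cst.
exists (to_fdistT l (P 0%N)) => x; rewrite to_fdistTE //; exact: lE.
Qed.

End Limit.

(** * The uniform guarantee of player 1 *)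

Section Player1.
Variables (R : realType) (K I J C D : finType).
Variables (q : K -> I -> J -> fdist R (K * C * D)%type) (g : K -> I -> J -> R).
Variables (p : fdist R (start K)) (k0 : K) (i0 : I) (j0 : J).
Hypothesis g01 : forall k i j, 0 <= g k i j <= 1.
Hypotheses (hA1 : assumption_A1 q p) (hA2a : property_A2a I J C D p).
Hypotheses (hA2b : assumption_A2b q) (hA3 : assumption_A3 q).
Implicit Types (sigma : strategy1 R I C) (tau : strategy2 R J D) (w : nat -> R).
Notation payoff := (payoff q g p).
Notation start_family := (@start_family R K p).
Notation family_value n w := (family_value q g j0 n w start_family).
Notation limit_value := (limit_value q g j0 start_family).
Notation bound := (@bound R K p).
Notation norm := (norm k0).
Notation canon := (canon k0).

(** Player 1 must start from his signal alone: (A2a) gives [y_1] as [f1 c], and by (A1) his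
    posterior [x1 c] does not depend on player 2's signal. *)
Lemma guaranteed_strategy n w e : (forall t, 0 <= w t) -> 0 < e ->
  exists sigma (rho : nat -> R), [/\ forall t, 0 <= rho t <= 1,
    family_value n w <= \sum_(t < n) w t * rho t + e &
    forall tau w', (forall t, 0 <= w' t) -> \sum_(t < n) w' t * rho t <= payoff sigma tau n w'].
Proof.
move=> w0 e0; have [f1 f1E] := hA2a.
have [sigma [rho H]] := guaranteed_plan i0 g01 (transition_indep j0 hA3)
  (belief_known j0 hA2b (k0 := k0)) n w0 e0.
pose x1 (c : nat) := if [pick d : 'I_bound | 0 < mass (start_mass p d c)] is Some d
  then norm (start_mass p d c) else dret R k0.
have x1E (c d : 'I_bound) : 0 < mass (start_family d c) -> x1 c = norm (start_family d c).
  move=> m0; rewrite /x1; case: pickP => [d' m'|/(_ d)]; last by rewrite m0.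
  exact: (posterior_indep k0 i0 j0 hA1 (l := [::]) (l' := [::])).
have f1c (c d : 'I_bound) : 0 < mass (start_family d c) -> f1 c = canon (start_family d).
  move=> m0; have [k kp] : exists k, (k, val c, val d) \in finsupp p.
    apply: contrapT => N; move: m0; rewrite /mass big1 ?ltxx // => k _.
    by apply/eqP; rewrite -[start_family d c k]/(p (k, val c, val d)) -[_ == _]negbK
      -mem_finsupp; apply/negP => kp; apply: N; exists k.
  rewrite -(start_belief2 k0 i0 j0 hA1 kp) f1E //.
  by apply/finsupp_dmap; exists (k, val c, val d).
have sp0 d : nonneg (start_family d) by exact: start_family_ge0.
have gy d : 0 < total_mass (start_family d) -> stable_belief q k0 (canon (start_family d)).
  by move=> t0; apply: stable_canon => //; exact: (@stable_start_family R K I J C D q p k0 i0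
    j0 hA1 d).
pose rho' t := \sum_d total_mass (start_family d) * rho (canon (start_family d)) t.
exists (fun ch => sigma (f1 ch.1) (x1 ch.1) ch.2), rho'.
have tot0 d : total_mass (start_family d) = 0 \/ 0 < total_mass (start_family d).
  by have := total_mass_ge0 (sp0 d); rewrite le_eqVlt => /orP[/eqP <-|->]; [left|right].
have sumE (w' : nat -> R) : \sum_(t < n) w' t * rho' t =
    \sum_d total_mass (start_family d) * \sum_(t < n) w' t * rho (canon (start_family d)) t.
  under eq_bigr do rewrite big_distrr /=.
  rewrite exchange_big; apply: eq_bigr => d _ /=; rewrite big_distrr.
  by apply: eq_bigr => t _ /=; rewrite mulrCA.
split.
- move=> t.
  have B d : 0 <= total_mass (start_family d) * rho (canon (start_family d)) t <= total_mass
    (start_family d).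
    have [->|t0] := tot0 d; first by rewrite mul0r lexx.
    have [/(_ t)/andP[r0 r1] _ _] := H _ (gy d t0).
    by apply/andP; split; [rewrite mulr_ge0 // ltW|rewrite ler_piMr // ltW].
  apply/andP; split; first by apply: sumr_ge0 => d _; case/andP: (B d).
  by rewrite -(sum_total_mass_start p); apply: ler_sum => d _; case/andP: (B d).
- rewrite sumE -[e]mul1r -(sum_total_mass_start p) big_distrl -big_split;
  apply: ler_sum => d _ /=.
  rewrite (value_canon q k0 i0 j0 g01 n w0 (sp0 d)) -mulrDr.
  have [->|t0] := tot0 d; first by rewrite !mul0r.
  by rewrite ler_pM2l //; case: (H _ (gy d t0)).
move=> tau w' w'0; rewrite sumE; apply: ler_sum => d _.
have [->|t0] := tot0 d.
  rewrite mul0r; apply: sumr_ge0 => c _; apply: sumr_ge0 => k _.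
  rewrite mulr_ge0 ?sp0 //.
  by case/andP: (state_payoff_bounds q g01 n k (fun h => sigma (f1 c) (x1 c) h) (fun h => tau
    (val d, h)) w'0).
have [_ _ Hd] := H _ (gy d t0).
apply: le_trans (Hd _ (start_family d) (fun h => tau (val d, h)) w' (sp0 d) _ (fun=> erefl)
  w'0) _.
  exact: (@stable_start_family R K I J C D q p k0 i0 j0 hA1 d).
apply/eq_ler/family_payoff_ext => c k ck.
have m0 : 0 < mass (start_family d c).
  rewrite lt0r mass_ge0 ?andbT; last exact: sp0.
  by apply: contra ck => /eqP m0; rewrite (mass_eq0 (sp0 d c) m0).
by rewrite /= (f1c c d) // (x1E c d).
Qed.

(** [N] does not depend on the length [m] of the window; this uniformity is what survives the
    passage to the limit. *)
Lemma finite_horizon e : 0 < e -> exists N, forall m, exists sigma,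
  forall n tau, (N < n <= N.+1 + m)%N -> limit_value - e <= gamma q g n p sigma tau.
Proof.
move=> e0; have e3 : 0 < e / 3 by rewrite divr_gt0.
have sp0 d : nonneg (start_family d) by exact: start_family_ge0.
have [delta d0 slow] := limit_value_le_slow q k0 i0 j0 g01 sp0 (sum_total_mass_start p) e3.
pose N := Num.truncn delta^-1; exists N => m.
have Nd : N.+1%:R^-1 <= delta.
  rewrite -[leRHS]invrK lef_pV2 ?posrE ?invr_gt0 // ltW //.
  by have /andP[] := truncn_itv (ltW (etrans (invr_gt0 delta) d0)).
pose k := (N.+1 + m)%N.
(* Pairing a strategy with its secured stage payoffs removes [tau]: the opponent only chooses a
   horizon. *)
pose T := {x : strategy1 R I C * (nat -> R) | (forall t, 0 <= x.2 t <= 1) /\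
  forall tau w', (forall t, 0 <= w' t) -> \sum_(t < k) w' t * x.2 t <= payoff x.1 tau k w'}.
(* Cesaro weights of horizon [N.+1 + o], extended by zero to the common length [k]. *)
pose u (o : nat) (t : nat) : R := if (t < N.+1 + o)%N then (N.+1 + o)%:R^-1 else 0.
have u0 o t : 0 <= u o t by rewrite /u; case: ifP.
have Wu (o : 'I_m.+1) : total_weight k (u o) = 1.
  have ok : (N.+1 + o + (m - o) = k)%N by rewrite -addnA subnKC // -ltnS ltn_ord.
  rewrite -ok total_weight_tail => [|t nt]; last by rewrite /u ltnNge nt.
  rewrite /total_weight (eq_bigr (fun=> (N.+1 + o)%:R^-1)) => [|t _]; last by rewrite /u ltn_ord.
  by rewrite sumr_const card_ord -[_ *+ _]mulr_natr mulVf.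
have [||x o|theta|L [lam [a aE]]] := @minmax R 'I_m.+1 T
  (fun x o => \sum_(t < k) u o t * (sval x).2 t) (limit_value - e / 3 - e / 3) (e / 3).
- exact: e3.
- by rewrite card_ord.
- have [x01 _] := svalP x; apply/andP; split.
    by apply: sumr_ge0 => t _; rewrite mulr_ge0 //; case/andP: (x01 t).
  apply: le_trans (_ : total_weight k (u o) <= _); last by rewrite Wu.
  apply: ler_sum => t _; rewrite ler_piMr //.
  by case/andP: (x01 t).
(* A mixture of Cesaro weights is nonincreasing and starts at most at [N.+1%:R^-1 <= delta], so it
   is slow. *)
- pose w t := \sum_o theta o * u o t.
  have w0 t : 0 <= w t by apply: sumr_ge0 => o _; rewrite mulr_ge0 ?fdist_ge0.
  have [sigma [rho [r01 Vr Hr]]] := guaranteed_strategy k w0 e3.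
  exists (exist _ (sigma, rho) (conj r01 Hr)) => /=.
  have -> : \sum_o theta o * (\sum_(t < k) u o t * rho t) = \sum_(t < k) w t * rho t.
    under eq_bigr do rewrite big_distrr /=.
    rewrite exchange_big; apply: eq_bigr => t _ /=; rewrite big_distrl.
    by apply: eq_bigr => o _ /=; rewrite mulrA.
  have : limit_value <= family_value k w + e / 3.
    apply: slow => //.
    - move=> t kt; rewrite /w big1 // => o _; rewrite /u ltnNge.
      by rewrite (leq_trans _ kt) ?mulr0 // leq_add2l -ltnS ltn_ord.
    - rewrite /total_weight /w exchange_big /= -(fdist_sumT theta); apply: eq_bigr => o _.
      by rewrite -big_distrr /= -/(total_weight k (u o)) Wu mulr1.
    - move=> t; apply: ler_sum => o _; rewrite ler_wpM2l ?fdist_ge0 // /u.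
      case: (ltnP t.+1) => h; first by rewrite ltnW.
      by case: ifP.
    - apply: le_trans Nd; apply: le_trans (_ : \sum_o theta o * N.+1%:R^-1 <= _); last first.
        by rewrite -big_distrl /= fdist_sumT mul1r.
      apply: ler_sum => o _ /=; rewrite ler_wpM2l ?fdist_ge0 // /u addSn /=.
      by rewrite lef_pV2 ?posrE ?ltr0n // ler_nat ltnS leq_addr.
  lra.
exists (mix_strategy lam (fun l => (sval (a l)).1)) => n tau /andP[Nn nk].
pose o := (n - N.+1)%N; have om : (o < m.+1)%N by rewrite ltnS leq_subLR.
have no : (N.+1 + o)%N = n by rewrite subnKC.
have kn : (n + (k - n) = k)%N by rewrite subnKC.
have GE sg : payoff sg tau k (u o) = n%:R^-1 * payoff sg tau n (fun=> 1).
  rewrite -kn -(payoff_cut q g p sg tau n (k - n) (fun=> 1)).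
  rewrite (@payoff_ext _ _ _ _ _ _ q g p sg tau tau _ _ (fun t => n%:R^-1 * (if (t < n)%N then
    1 else 0) + 0)) //.
    rewrite payoff_add; set z := payoff _ _ _ (fun=> 0).
    have : 0 <= z <= total_weight (n + (k - n)) (fun=> 0 : R) by exact: payoff_bounds.
    by rewrite /total_weight big1 // -eq_le => /eqP <-; rewrite addr0.
  by move=> t _; rewrite addr0 /u no; case: ifP; rewrite ?mulr1 ?mulr0.
rewrite gammaE payoff_mix1 big_distrr /=.
apply: le_trans (_ : \sum_l lam l * (\sum_(t < k) u o t * (sval (a l)).2 t) <= _).
  by have := aE (Ordinal om); rewrite /=; lra.
apply: ler_sum => l _; rewrite mulrCA ler_wpM2l ?fdist_ge0 // -GE.
by have [_ Hl] := svalP (a l); exact: (Hl tau (u o) (u0 o)).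
Qed.

Local Open Scope classical_set_scope.

(** Over [n] stages the payoff is a polynomial in finitely many action probabilities. *)
Lemma state_payoff_cvg (F : set_system nat) n w k (s : nat -> seq (I * C) -> fdist R I)
    (s' : seq (I * C) -> fdist R I)
    (tau : seq (J * D) -> fdist R J) :
  Filter F -> (forall h i, s m h i @[m --> F] --> s' h i) ->
  state_payoff q g n w k (s m) tau @[m --> F] --> state_payoff q g n w k s' tau.
Proof.
move=> FF; elim: n w k s s' tau => [|n IH] w k s s' tau H; first exact: cvg_cst.
under eq_fun do rewrite state_payoffS.
rewrite state_payoffS; apply: cvg_bigsum => i; apply: cvg_bigsum => j.
apply: cvgM; first by apply: cvgM; [exact: H|exact: cvg_cst].
apply: cvgD; first exact: cvg_cst.
apply: cvg_bigsum => x; apply: cvgM; first exact: cvg_cst.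
by apply: IH => h i'; exact: H.
Qed.

Lemma player1_guarantees : guarantees1 q g p limit_value.
Proof.
move=> eps eps0; have [N NE] := finite_horizon eps0.
have [ss ssE] := choice NE.
have [F [FU Foo]] := ultraFilterLemma eventually_filter.
have FP : ProperFilter F by exact: ultra_proper.
have [sigma sigmaE] := choice (fun ch => fdist_limit (fun m => ss m ch) FU).
exists sigma, N.+1 => n Nn tau.
have cv : gamma q g n p (ss m) tau @[m --> F] --> gamma q g n p sigma tau.
  under eq_fun do rewrite gammaE.
  rewrite gammaE; apply: cvgM; first exact: cvg_cst.
  apply: cvg_bigsum => d; apply: cvg_bigsum => c; apply: cvg_bigsum => k.
  apply: cvgM; first exact: cvg_cst.
  by apply: state_payoff_cvg => h i; exact: sigmaE.
(* A fixed horizon [n] lies in the window of [ss m] for all large [m], and [F] contains every set of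
   all large integers. *)
apply: (cvgr_to_ge cv); apply: Foo.
near=> m; apply: ssE; rewrite Nn /=; apply: leq_trans (leq_addl _ _).
by near: m; exact: nbhs_infty_ge.
Unshelve. all: by end_near.
Qed.

End Player1.

Theorem theorem2p3 (R : realType) (K I J C D : finType)
  (g : K -> I -> J -> R) (q : K -> I -> J -> fdist R (K * C * D)%type)
  (p : fdist R (K * nat * nat)%type)
  (I_nonempty : (0 < #|I|)%N) (J_nonempty : (0 < #|J|)%N)
  (g_bounded : forall k i j, 0 <= g k i j <= 1)
  (hA1 : assumption_A1 q p) (hA2a : property_A2a I J C D p)
  (hA2b : assumption_A2b q) (hA3 : assumption_A3 q) :
  lower_uniform_value q g p = upper_uniform_value q g p.
Proof.
have [i0 _] : exists i, i \in I by apply/card_gt0P.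
have [j0 _] : exists j, j \in J by apply/card_gt0P.
(* A point in the support of [p] provides the default state [k0]. *)
have [[[k0 c] d] _] : exists t, t \in finsupp p.
  apply: contrapT => H; have := fdist_sum1 p.
  rewrite big_seq big1 => [/eqP|t tp]; first by rewrite eq_sym oner_eq0.
  by case: H; exists t.
have h1 := player1_guarantees k0 i0 j0 g_bounded hA1 hA2a hA2b hA3.
have h2 := player2_guarantees k0 i0 j0 g_bounded hA1 hA3.
set v := limit_value _ _ _ _ in h1 h2.
(* The two guaranteeing strategies are played against each other at a common horizon. *)
have le12 v1 v2 : guarantees1 q g p v1 -> guarantees2 q g p v2 -> v1 <= v2.
  move=> g1 g2; apply/ler_addgt0Pr => e e0; have e2 : 0 < e / 2 by rewrite divr_gt0.
  have [sigma [N1 s1]] := g1 _ e2; have [tau [N2 s2]] := g2 _ e2.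
  have := s1 _ (leq_maxl N1 N2) tau; have := s2 _ (leq_maxr N1 N2) sigma; lra.
apply: (@trans_eq _ _ v%:E); apply/eqP; rewrite eq_le; apply/andP; split.
- by apply: ge_ereal_sup => _ [v1 g1 <-]; rewrite lee_fin; exact: le12.
- by apply: ereal_sup_ubound; exists v.
- by apply: le_ereal_inf_tmp => _ [v2 g2 <-]; rewrite lee_fin; exact: le12.
- by apply: ereal_inf_lbound; exists v.
Qed.
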